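(* Let $W$ be a restricted $\mathcal{L}^*$-module of level $\ell_{1234}$. Then there exists a $\phi$-coordinated $V_{\widehat{\mathfrak{L}^*}}(\ell_{1234},0)$-module structure $Y_W(\cdot,x)$ on $W$, uniquely determined by $$Y_W((T^m)_{-1}\mathbf{1},x)=T_m(x),\qquad Y_W((E^m)_{-1}\mathbf{1},x)=E_m(x)\qquad(m\in\mathbb{Z}).$$
   Context: The rank two twisted Heisenberg–Virasoro algebra $\mathcal{L}^*$ has basis $\{t_1^mt_2^n, E_{m,n}: (m,n)\in\mathbb{Z}^2\setminus\{(0,0)\}\}\cup\{K_1,K_2,K_3,K_4\}$, $K_i$ central, with $[t_1^mt_2^n,t_1^rt_2^s]=0$, $[t_1^mt_2^n,E_{r,s}]=(nr-ms)t_1^{m+r}t_2^{n+s}+\delta_{m+r,0}\delta_{n+s,0}(mK_1+nK_2)$, $[E_{m,n},E_{r,s}]=(nr-ms)E_{m+r,n+s}+\delta_{m+r,0}\delta_{n+s,0}(mK_3+nK_4)$ (terms with index $(0,0)$ are interpreted as $0$). Set $T_m(x)=\sum_{n\in\mathbb{Z}}t_1^mt_2^nx^{-n}$ and $E_m(x)=\sum_nE_{m,n}x^{-n}$ (omitting $(0,0)$ terms). An $\mathcal{L}^*$-module $W$ is restricted if $T_m(x),E_m(x)\in\mathrm{Hom}(W,W((x)))$ for all $m$, i.e. for each $w$, $t_1^mt_2^nw=0$ and $E_{m,n}w=0$ for $n$ sufficiently large; it has level $\ell_{1234}$ if $K_i$ acts as $\ell_i\in\mathbb{C}$. $\widehat{\mathfrak{L}^*}$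 is the Lie algebra with basis $\{T^m\otimes t^n, E^r\otimes t^s:(m,n),(r,s)\in\mathbb{Z}^2\}\cup\{K_1,\dots,K_4\}$, $K_i$ central, $[T^m\otimes t^n,T^r\otimes t^s]=0$, $[T^m\otimes t^n,E^r\otimes t^s]=(nr-ms)T^{m+r}\otimes t^{n+s-1}+m\delta_{m+r,0}\delta_{n+s+1,0}K_1+n\delta_{m+r,0}\delta_{n+s,0}K_2$, $[E^m\otimes t^n,E^r\otimes t^s]=(nr-ms)E^{m+r}\otimes t^{n+s-1}+m\delta_{m+r,0}\delta_{n+s+1,0}K_3+n\delta_{m+r,0}\delta_{n+s,0}K_4$. Write $(T^m)_n=T^m\otimes t^n$, $(E^r)_s=E^r\otimes t^s$. $V_{\widehat{\mathfrak{L}^*}}(\ell_{1234},0)=U(\widehat{\mathfrak{L}^*})\otimes_{U(\widehat{\mathfrak{L}^*}_{\ge0})}\mathbb{C}$, where $\widehat{\mathfrak{L}^*}_{\ge0}$ is spanned by $T^m\otimes t^n,E^r\otimes t^n$ ($n\ge0$) acting as $0$ and $K_i$ acting as $\ell_i$; $\mathbf{1}=1\otimes1$. It is a vertex algebra with vacuum $\mathbf{1}$, $Y((T^m)_{-1}\mathbf{1},x)=\sum_n(T^m)_nx^{-n-1}$, $Y((E^r)_{-1}\mathbf{1},x)=\sum_s(E^r)_sx^{-s-1}$, generated by $\{(T^m)_{-1}\mathbf{1},(E^r)_{-1}\mathbf{1}\}$. A $\phi$-coordinated module ($\phi(x,z)=xe^z$) for a vertex algebra $V$ is a space $W$ with a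 linear map $Y_W(\cdot,x):V\to\mathrm{Hom}(W,W((x)))$ such that $Y_W(\mathbf{1},x)=\mathbf{1}_W$ and for $u,v\in V$ there is $k\in\mathbb{N}$ with $(x_1-x_2)^kY_W(u,x_1)Y_W(v,x_2)\in\mathrm{Hom}(W,W((x_1,x_2)))$ and $(x_2e^z-x_2)^kY_W(Y(u,z)v,x_2)=((x_1-x_2)^kY_W(u,x_1)Y_W(v,x_2))|_{x_1=x_2e^z}$. *)

(* Defs.v *)
From HB Require Import structures.
From mathcomp Require Import all_boot all_order all_algebra.
From mathcomp Require Import complex.
From mathcomp Require Import Rstruct.
From Stdlib Require Import Rdefinitions.

Set Implicit Arguments.
Unset Strict Implicit.
Unset Printing Implicit Defensive.

Import Order.TTheory GRing.Theory Num.Theory.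
Local Open Scope ring_scope.

Notation C := (complex Rdefinitions.R).

Definition islin (U V : lmodType C) (f : U -> V) : Prop :=
  forall (a : C) (x y : U), f (a *: x + y) = a *: f x + f y.

Definition kd (a b : int) : C := if a == b then 1 else 0.

Definition zbinom (p : int) (i : nat) : C :=
  (\prod_(j < i) (p%:~R - j%:R)) / (i`!)%:R.

(* Modules for the rank two twisted Heisenberg-Virasoro algebra L^*.         *)
(* A module structure is given by operators tW m n (action of t_1^m t_2^n)   *)
(* and EW m n (action of E_{m,n}) for (m,n) <> (0,0); the values at (0,0)    *)
(* are irrelevant (never used).  The central elements K_i act as l_i         *)
(* (level l_{1234}), which is built into the bracket relations.              *)

Definition nz (m n : int) : bool := (m != 0) || (n != 0).

Definition tz (W : lmodType C) (tW : int -> int -> W -> W) (m n : int) (w : W) : W :=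
  if nz m n then tW m n w else 0.

Definition Lstar_module (l1 l2 l3 l4 : C) (W : lmodType C)
    (tW EW : int -> int -> W -> W) : Prop :=
  (forall m n, islin (tW m n)) /\ (forall m n, islin (EW m n)) /\
  (forall m n r s w, nz m n -> nz r s ->
     tW m n (tW r s w) - tW r s (tW m n w) = 0) /\
  (forall m n r s w, nz m n -> nz r s ->
     tW m n (EW r s w) - EW r s (tW m n w) =
       (n * r - m * s)%:~R *: tz tW (m + r) (n + s) w
       + (kd (m + r) 0 * kd (n + s) 0 * (m%:~R * l1 + n%:~R * l2)) *: w) /\
  (forall m n r s w, nz m n -> nz r s ->
     EW m n (EW r s w) - EW r s (EW m n w) =
       (n * r - m * s)%:~R *: tz EW (m + r) (n + s) w
       + (kd (m + r) 0 * kd (n + s) 0 * (m%:~R * l3 + n%:~R * l4)) *: w).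

(* restricted: T_m(x), E_m(x) in Hom(W, W((x))) *)
Definition restricted (W : lmodType C) (tW EW : int -> int -> W -> W) : Prop :=
  forall (m : int) (w : W), exists N : int, forall n : int, N <= n ->
    tW m n w = 0 /\ EW m n w = 0.

(* Modules for the Lie algebra \hat{L^*} of level l_{1234}:                  *)
(* TV m n = action of T^m (x) t^n,  EV r s = action of E^r (x) t^s.          *)

Definition Lhat_module (l1 l2 l3 l4 : C) (M : lmodType C)
    (TV EV : int -> int -> M -> M) : Prop :=
  (forall m n, islin (TV m n)) /\ (forall m n, islin (EV m n)) /\
  (forall m n r s w, TV m n (TV r s w) - TV r s (TV m n w) = 0) /\
  (forall m n r s w,
     TV m n (EV r s w) - EV r s (TV m n w) =
       (n * r - m * s)%:~R *: TV (m + r) (n + s - 1) w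
       + (m%:~R * kd (m + r) 0 * kd (n + s + 1) 0 * l1
          + n%:~R * kd (m + r) 0 * kd (n + s) 0 * l2) *: w) /\
  (forall m n r s w,
     EV m n (EV r s w) - EV r s (EV m n w) =
       (n * r - m * s)%:~R *: EV (m + r) (n + s - 1) w
       + (m%:~R * kd (m + r) 0 * kd (n + s + 1) 0 * l3
          + n%:~R * kd (m + r) 0 * kd (n + s) 0 * l4) *: w).

(* w is annihilated by \hat{L^*}_{>=0} (apart from the K_i, acting as l_i) *)
Definition nonneg_annihilated (M : lmodType C) (TV EV : int -> int -> M -> M)
    (w : M) : Prop :=
  forall m n : int, 0 <= n -> TV m n w = 0 /\ EV m n w = 0.

(* (V, TV, EV, vac) is the induced module
     V_{\hat{L^*}}(l_{1234},0) = U(\hat{L^*}) (x)_{U(\hat{L^*}_{>=0})} C,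
   vac = 1 (x) 1, characterized by its universal property: for every
   \hat{L^*}-module M of level l_{1234} and every w in M annihilated by
   \hat{L^*}_{>=0}, there is a unique module homomorphism V -> M sending
   vac to w. *)
Definition vacuum_module (l1 l2 l3 l4 : C) (V : lmodType C)
    (TV EV : int -> int -> V -> V) (vac : V) : Prop :=
  Lhat_module l1 l2 l3 l4 TV EV /\ nonneg_annihilated TV EV vac /\
  forall (M : lmodType C) (TM EM : int -> int -> M -> M) (w : M),
    Lhat_module l1 l2 l3 l4 TM EM -> nonneg_annihilated TM EM w ->
    (exists f : V -> M, islin f /\ f vac = w /\
        (forall m n v, f (TV m n v) = TM m n (f v)) /\
        (forall m n v, f (EV m n v) = EM m n (f v))) /\
    (forall f g : V -> M,
        islin f -> f vac = w ->
        (forall m n v, f (TV m n v) = TM m n (f v)) ->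
        (forall m n v, f (EV m n v) = EM m n (f v)) ->
        islin g -> g vac = w ->
        (forall m n v, g (TV m n v) = TM m n (g v)) ->
        (forall m n v, g (EV m n v) = EM m n (g v)) ->
        forall v, f v = g v).

(* Vertex algebras.  YV u n v = u_n v, where Y(u,x) = \sum_n u_n x^{-n-1}.   *)

Definition vertex_algebra (V : lmodType C) (vac : V) (YV : V -> int -> V -> V)
    : Prop :=
  (* Y(.,x) is a linear map V -> Hom(V, V((x))) *)
  (forall n v, islin (fun u => YV u n v)) /\
  (forall u n, islin (YV u n)) /\
  (forall u v, exists N : int, forall n : int, N <= n -> YV u n v = 0) /\
  (forall n v, YV vac n v = if n == -1 then v else 0) /\
  (forall u n, 0 <= n -> YV u n vac = 0) /\
  (forall u, YV u (-1) vac = u) /\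
  (* Jacobi identity, in component (Borcherds) form; all sums are finite
     once N is beyond the truncation bounds *)
  (forall (u v w : V) (p q r : int) (N : nat),
     (forall i : nat, leq N i ->
        YV u (r + i%:Z) v = 0 /\ YV v (q + i%:Z) w = 0 /\ YV u (p + i%:Z) w = 0) ->
     \sum_(i < N) zbinom p i *: YV (YV u (r + i%:Z) v) (p + q - i%:Z) w =
     \sum_(i < N) ((-1) ^+ i * zbinom r i) *:
        (YV u (p + r - i%:Z) (YV v (q + i%:Z) w)
         - (-1) ^ r *: YV v (q + r - i%:Z) (YV u (p + i%:Z) w))).

(* phi-coordinated modules, phi(x,z) = x e^z.                                *)
(* YW v n w = coefficient of x^n in Y_W(v,x) w.                              *)

(* coefficient of x1^a x2^b in (x1 - x2)^k Y_W(u,x1) Y_W(v,x2) w *)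
Definition prod_coef (V W : lmodType C) (YW : V -> int -> W -> W)
    (k : nat) (u v : V) (w : W) (a b : int) : W :=
  \sum_(p < k.+1) ('C(k, p)%:R * (-1) ^+ (k - p)) *:
      YW u (a - p%:Z) (YW v (b - k%:Z + p%:Z) w).

(* coefficient of x2^c z^r (r >= 0) in  F(x2 e^z, x2), for
   F = \sum_{a,b >= N} F_{a,b} x1^a x2^b :
     (1/r!) \sum_{a+b=c, a,b >= N} a^r F_{a,b} *)
Definition subst_coef (W : lmodType C) (F : int -> int -> W) (N c : int) (r : nat)
    : W :=
  (r`!%:R)^-1 *:
    \sum_(i < absz (c - 2 * N + 1) | (i%:Z <= c - 2 * N))
        ((N + i%:Z)%:~R ^+ r) *: F (N + i%:Z) (c - N - i%:Z).

(* coefficient of x2^c z^q in (x2 e^z - x2)^k Y_W(Y(u,z)v, x2) w, where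
   (x2 e^z - x2)^k = x2^k \sum_p binom(k,p) (-1)^(k-p) e^{pz} and
   Y(u,z)v = \sum_n u_n v z^{-n-1} with u_n v = 0 for n >= M *)
Definition assoc_coef (V W : lmodType C) (YV : V -> int -> V -> V)
    (YW : V -> int -> W -> W) (k : nat) (u v : V) (w : W) (M c q : int) : W :=
  \sum_(p < k.+1) ('C(k, p)%:R * (-1) ^+ (k - p)) *:
    \sum_(j < absz (q + M + 1) | (j%:Z < q + M + 1))
       ((j`!%:R)^-1 * (p%:R ^+ j)) *:
          YW (YV u (j%:Z - q - 1) v) (c - k%:Z) w.

Definition phi_coordinated_module (V W : lmodType C) (vac : V)
    (YV : V -> int -> V -> V) (YW : V -> int -> W -> W) : Prop :=
  (* Y_W(.,x) is a linear map V -> Hom(W, W((x))) *)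
  (forall n w, islin (fun v => YW v n w)) /\
  (forall v n, islin (YW v n)) /\
  (forall v w, exists N : int, forall n : int, n < N -> YW v n w = 0) /\
  (forall n w, YW vac n w = if n == 0 then w else 0) /\
  (forall u v : V, exists k : nat, forall w : W,
     exists N : int,
       (* (x1-x2)^k Y_W(u,x1)Y_W(v,x2) w in W((x1,x2)) *)
       (forall a b : int, (a < N) || (b < N) -> prod_coef YW k u v w a b = 0) /\
       (* (x2 e^z - x2)^k Y_W(Y(u,z)v,x2) w
            = ((x1-x2)^k Y_W(u,x1)Y_W(v,x2) w)|_{x1 = x2 e^z} *)
       (forall M : int, (forall n : int, M <= n -> YV u n v = 0) ->
         forall c q : int,
           assoc_coef YV YW k u v w M c q =
           if q < 0 then 0
           else subst_coef (prod_coef YW k u v w) N c (absz q))).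

(* the generating-field conditions
     Y_W((T^m)_{-1} 1, x) = T_m(x) = \sum_n t_1^m t_2^n x^{-n},
     Y_W((E^m)_{-1} 1, x) = E_m(x) = \sum_n E_{m,n} x^{-n}   ((0,0) omitted) *)
Definition generating_fields (V W : lmodType C) (TV EV : int -> int -> V -> V)
    (vac : V) (tW EW : int -> int -> W -> W) (YW : V -> int -> W -> W) : Prop :=
  forall (m n : int) (w : W),
    YW (TV m (-1) vac) n w = tz tW m (- n) w /\
    YW (EV m (-1) vac) n w = tz EW m (- n) w.

(* Main.v *)
(** A field on [W] is [a(x) = \sum_n a_n x^n] in [Hom(W, W((x)))].  For local
    fields the normally ordered product
    [N_t(a, c) = \sum_(i >= t) x^i a_i c(x) + \sum_(i < t) c(x) x^i a_i]
    satisfies [N_t - N_(t+1) = x^t [a_t, c(x)]] and is polynomial in [t].  The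
    products [a_n c] that a coordinated module structure forces are defined by
    [N_t(a, c) = Res_z e^(-t z) kappa(z) \sum_n (a_n c) z^(-n-1)] with
    [kappa = 1 / (1 - e^(-z))], together with [(x a')_n c = - n a_(n-1) c].
    Computing [[N_s(a, .), N_t(b, .)]] directly and comparing kernels yields
    Borcherds' commutator formula for these products; together with Dong's lemma
    this makes the fields local to all [T_m(x)], [E_m(x)] into an
    [\hat{L^*}]-module in which the identity is a vacuum vector.  The universal
    property of [V] then gives a map [v |-> Y_W(v, x)].  It carries [u_n v] to
    [Y_W(u)_n Y_W(v)], by induction on [v]: both sides obey the same commutator
    formula with the generators, and at the vacuum both are iterated derivatives.
    Associativity for [x_1 = x_2 e^z] and uniqueness are then read off the
    residue formula. *)

Require Import Defs.
From HB Require Import structures.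
From mathcomp Require Import all_boot all_order all_algebra.
From mathcomp Require Import complex Rstruct.
From mathcomp Require Import boolp functions ring zify.

Set Implicit Arguments.
Unset Strict Implicit.
Unset Printing Implicit Defensive.

Import Order.TTheory GRing.Theory Num.Theory.
Local Open Scope ring_scope.

(** * Sums over the integers *)

Section IntegerSums.
Variable M : zmodType.
Implicit Types f g : int -> M.

(** Everything rests on one dictionary. In coefficients, $(x_1-x_2)^K[a(x_1),c(x_2)]=0$ says that
    the $K$-th difference of $t\mapsto x^t[a_t,c(x)]$ vanishes, so locality is polynomial dependence
    on $t$ and delta functions never appear. On kernels, multiplication by $\xi=1-e^{-z}$ is the
    difference operator, by $e^{-z}$ the shift, and $\kappa=1/\xi$ is evaluation at $0$; pairing
    with a kernel is therefore polynomial interpolation. This is how $\phi(x,z)=xe^z$ enters: shifts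
    of a mode index are exponentials in $z$. The pairing only covers kernels with at most a simple
    pole. Hence products with $n\le-2$ are reached through $x\,d/dx$, and the commutator formula is
    proved for indices at least $-1$ and then moved down. No vertex algebra of fields on $W$ is
    constructed: the Borcherds identity is available in $V$, and for fields only the commutator
    formula and the rules for $x\,d/dx$ are proved. *)

Definition zfin f := exists lo hi : int, forall i, (i < lo) || (hi <= i) -> f i = 0.

Definition zint (lo : int) (n : nat) f : M := \sum_(k < n) f (lo + k%:Z).

(* Junk value [0] when the support of [f] is infinite. *)
Definition zsum f : M :=
  if pselect (exists p : int * nat,
                forall i, (i < p.1) || (p.1 + p.2%:Z <= i) -> f i = 0) is left H
  then zint (sval (cid H)).1 (sval (cid H)).2 f else 0.

Lemma eq_zint (lo : int) n f g : (forall i, lo <= i < lo + n%:Z -> f i = g i) ->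
  zint lo n f = zint lo n g.
Proof. by move=> h; apply: eq_bigr => k _; apply: h; case: k => k /= ?; lia. Qed.

Lemma zint_cat lo p q f : zint lo (p + q) f = zint lo p f + zint (lo + p%:Z) q f.
Proof.
rewrite /zint big_split_ord /=; congr (_ + _).
by apply: eq_bigr => k _; rewrite PoszD addrA.
Qed.

Lemma zint0 (lo : int) n f : (forall i, lo <= i < lo + n%:Z -> f i = 0) -> zint lo n f = 0.
Proof. by move=> h; rewrite /zint big1 // => -[k kn] _; apply: h => /=; lia. Qed.

Lemma zint_sub (lo : int) n (lo' : int) n' f : lo' <= lo -> lo + n%:Z <= lo' + n'%:Z ->
  (forall i, (i < lo) || (lo + n%:Z <= i) -> f i = 0) -> zint lo' n' f = zint lo n f.
Proof.
move=> h1 h2 h.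
have -> : n' = (absz (lo - lo')%R + (n + absz (lo' + n'%:Z - (lo + n%:Z))%R))%N by lia.
rewrite zint_cat zint_cat zint0 ?add0r; last by move=> i hi; apply: h; lia.
rewrite [X in _ + X]zint0 ?addr0; last by move=> i hi; apply: h; lia.
by have -> : lo' + (absz (lo - lo')%R)%:Z = lo by lia.
Qed.

Lemma zsumI (lo : int) n f :
  (forall i, (i < lo) || (lo + n%:Z <= i) -> f i = 0) -> zsum f = zint lo n f.
Proof.
move=> h; rewrite /zsum; case: pselect => [H|[]]; last by exists (lo, n).
case: (cid H) => -[lo1 n1] /= h1.
pose l := Num.min lo lo1; pose m := absz (Num.max (lo + n%:Z) (lo1 + n1%:Z) - l)%R.
rewrite -(@zint_sub lo1 n1 l m) -?(@zint_sub lo n l m) //; rewrite /m /l; lia.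
Qed.

Lemma zfinP f : zfin f ->
  exists (lo : int) n, forall i, (i < lo) || (lo + n%:Z <= i) -> f i = 0.
Proof.
case=> lo [hi h]; exists lo, (absz (hi - lo)%R) => i hi'; apply: h; lia.
Qed.

Lemma zsum_nfin f : ~ zfin f -> zsum f = 0.
Proof.
move=> h; rewrite /zsum; case: pselect => // -[[lo n] /= H].
by case: h; exists lo, (lo + n%:Z).
Qed.

Lemma zfin2 f g : zfin f -> zfin g -> exists (lo : int) n,
  forall i, (i < lo) || (lo + n%:Z <= i) -> f i = 0 /\ g i = 0.
Proof.
move=> [l [h H]] [l' [h' H']].
exists (Num.min l l'), (absz (Num.max h h' - Num.min l l')%R).
by move=> i hi; split; [apply: H|apply: H']; lia.
Qed.

Lemma eq_zsum f g : f =1 g -> zsum f = zsum g.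
Proof. by move=> h; congr zsum; apply: funext. Qed.

Lemma zsum0 f : (forall i, f i = 0) -> zsum f = 0.
Proof. by move=> h; rewrite (@zsumI 0 0) ?zint0. Qed.

Lemma zsum1 (k : int) f : (forall i, i != k -> f i = 0) -> zsum f = f k.
Proof.
move=> h; rewrite (@zsumI k 1); first by rewrite /zint big_ord1 addr0.
by move=> i hi; apply: h; lia.
Qed.

Lemma zfinD f g : zfin f -> zfin g -> zfin (fun i => f i + g i).
Proof.
move=> hf hg; have [lo [n h]] := zfin2 hf hg; exists lo, (lo + n%:Z) => i hi.
by have [-> ->] := h i hi; rewrite addr0.
Qed.

Lemma zsumD f g : zfin f -> zfin g -> zsum (fun i => f i + g i) = zsum f + zsum g.
Proof.
move=> hf hg; have [lo [n h]] := zfin2 hf hg.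
rewrite !(@zsumI lo n) /zint ?big_split //= => i hi; have [] := h i hi => // -> ->.
by rewrite addr0.
Qed.

Lemma zfin_shift k f : zfin f -> zfin (fun i => f (i + k)).
Proof. by case=> l [h H]; exists (l - k), (h - k) => i hi; apply: H; lia. Qed.

(** No finiteness hypothesis: a function and its shift have finite support together, and otherwise
    both sums take the default value 0. *)
Lemma zsum_shift k f : zsum (fun i => f (i + k)) = zsum f.
Proof.
have [hf|hf] := pselect (zfin f).
  have [lo [n h]] := zfinP hf.
  rewrite [RHS](@zsumI lo n) // [LHS](@zsumI (lo - k) n) => [|i hi]; last by apply: h; lia.
  by apply: eq_bigr => i _; congr f; lia.
rewrite !zsum_nfin // => /(@zfin_shift (- k)) h; apply: hf.
by case: h => l [u H]; exists l, u => i /H; rewrite subrK.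
Qed.

Lemma zfin_opp f : zfin f -> zfin (fun i => f (- i)).
Proof. by case=> l [h H]; exists (1 - h), (1 - l) => i hi; apply: H; lia. Qed.

Lemma zsum_opp f : zsum (fun i => f (- i)) = zsum f.
Proof.
have [hf|hf] := pselect (zfin f).
  have [lo [n h]] := zfinP hf.
  rewrite [RHS](@zsumI lo n) // [LHS](@zsumI (1 - lo - n%:Z) n) => [|i hi]; last by apply: h; lia.
  rewrite /zint (reindex_inj rev_ord_inj) /=.
  by apply: eq_bigr => -[i hi] _; congr f => /=; lia.
rewrite !zsum_nfin // => /zfin_opp h; apply: hf.
by case: h => l [u H]; exists l, u => i /H; rewrite opprK.
Qed.

Lemma zsum_flip k f : zsum (fun i => f (k - i)) = zsum f.
Proof.
rewrite -(zsum_opp f) -(zsum_shift (- k) (fun i => f (- i))).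
by apply: eq_zsum => i; congr f; lia.
Qed.

Lemma zfin_sum (n : nat) (F : nat -> int -> M) : (forall k, zfin (F k)) ->
  zfin (fun i => \sum_(k < n) F k i).
Proof.
move=> h; elim: n => [|n IH]; first by exists 0, 0 => i _; rewrite big_ord0.
under eq_fun do rewrite big_ord_recr /=; exact: zfinD.
Qed.

Lemma zsum_sum (n : nat) (F : nat -> int -> M) : (forall k, zfin (F k)) ->
  zsum (fun i => \sum_(k < n) F k i) = \sum_(k < n) zsum (F k).
Proof.
move=> h; elim: n => [|n IH]; first by rewrite big_ord0 zsum0 // => i; rewrite big_ord0.
under eq_zsum do rewrite big_ord_recr /=.
by rewrite big_ord_recr /= zsumD ?IH //; exact: zfin_sum.
Qed.

(** Support inside a box. Finite rows and columns alone would not justify exchanging the sums. *)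
Definition zfinj (F : int -> int -> M) := exists lo hi : int,
  forall i j, [|| i < lo, hi <= i, j < lo | hi <= j] -> F i j = 0.

Lemma zfinj_row F i : zfinj F -> zfin (F i).
Proof. by case=> l [h H]; exists l, h => j hj; apply: H; lia. Qed.

Lemma zfinj_swap F : zfinj F -> zfinj (fun j i => F i j).
Proof. by case=> l [h H]; exists l, h => i j hj; apply: H; lia. Qed.

Lemma zfinj_zsum F : zfinj F -> zfin (fun i => zsum (F i)).
Proof.
by case=> l [h H]; exists l, h => i hi; apply: zsum0 => j; apply: H; lia.
Qed.

Lemma zsum_exchange F : zfinj F ->
  zsum (fun i => zsum (F i)) = zsum (fun j => zsum (fun i => F i j)).
Proof.
case=> l [h H]; pose n := absz (h - l)%R.
rewrite [LHS](@zsumI l n) => [|i hi]; last by apply: zsum0 => j; apply: H; lia.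
rewrite [RHS](@zsumI l n) => [|i hi]; last by apply: zsum0 => j; apply: H; lia.
transitivity (zint l n (fun i => zint l n (F i))).
  by apply: eq_zint => i hi; apply: zsumI => j hj; apply: H; lia.
rewrite /zint exchange_big /=; apply: eq_bigr => j _.
by rewrite (@zsumI l n) // => i hi; apply: H; lia.
Qed.

(** Passage to the total degree $t=i+j$, by which [fN_comm] collects coefficients. *)
Lemma zfinj_shear F : zfinj F -> zfinj (fun i t => F i (t - i)).
Proof.
by case=> l [h H]; exists (Num.min l (l + l)), (Num.max h (h + h)) => i j hj; apply: H; lia.
Qed.

End IntegerSums.

Lemma zsum_morph (M M' : zmodType) (g : M -> M') (f : int -> M) :
  (forall x y, g (x + y) = g x + g y) -> zfin f -> zsum (fun i => g (f i)) = g (zsum f).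
Proof.
move=> gD hf; have g0 : g 0 = 0 by apply: (addrI (g 0)); rewrite -gD !addr0.
have [lo [n h]] := zfinP hf.
rewrite !(@zsumI _ lo n) // => [|i /h ->//].
by rewrite /zint (big_morph g gD g0).
Qed.

Lemma zfin_morph (M M' : zmodType) (g : M -> M') (f : int -> M) :
  g 0 = 0 -> zfin f -> zfin (fun i => g (f i)).
Proof. by move=> g0 [l [h H]]; exists l, h => i /H ->. Qed.

Lemma zsumZ (R : pzRingType) (M : lmodType R) (c : R) (f : int -> M) : zfin f ->
  zsum (fun i => c *: f i) = c *: zsum f.
Proof. by apply: zsum_morph; exact: scalerDr. Qed.

Lemma zsumN (M : zmodType) (f : int -> M) : zfin f ->
  zsum (fun i => - f i) = - zsum f.
Proof. by apply: zsum_morph; exact: opprD. Qed.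

(** * Formal Laurent series *)

Section LaurentSeries.
Variable R : numFieldType.

(** Series in the variable $z$ of the residue formula. The commutative ring structure given below
    lets identities between exponentials be closed by [ring]. *)
Record laurent := Laurent {
  lcoef :> int -> R;
  lcoefP : exists B : int, forall n, n < B -> lcoef n = 0 }.

Implicit Types f g h : laurent.

Lemma laurentP f g : (forall n, f n = g n) -> f = g.
Proof.
case: f g => f hf [g hg] /= h; have eg : f = g by apply: funext.
by case: g / eg hg h => hg _; congr Laurent; exact: Prop_irrelevance.
Qed.

HB.instance Definition _ := gen_eqMixin laurent.
HB.instance Definition _ := gen_choiceMixin laurent.

Definition lconv f g (n : int) : R := zsum (fun i => f i * g (n - i)).

Lemma zfin_conv f g n : zfin (fun i => f i * g (n - i)).
Proof.
have [B hB] := lcoefP f; have [B' hB'] := lcoefP g.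
exists B, (n - B' + 1) => i /orP[hi|hi]; first by rewrite hB ?mul0r.
by rewrite hB' ?mulr0 //; lia.
Qed.

Lemma lconv_ord f g (A B : int) :
  (forall n, n < A -> f n = 0) -> (forall n, n < B -> g n = 0) ->
  (forall n, n < A + B -> lconv f g n = 0) /\ lconv f g (A + B) = f A * g B.
Proof.
move=> hf hg; split=> [n hn|].
  apply: zsum0 => i; have [hi|hi] := ltP i A; first by rewrite hf ?mul0r.
  by rewrite hg ?mulr0 //; lia.
rewrite /lconv (@zsum1 _ A) => [|i hi]; first by congr (_ * g _); lia.
have [hi'|hi'] := ltP i A; first by rewrite hf ?mul0r.
by rewrite hg ?mulr0 //; lia.
Qed.

Program Definition lzero := @Laurent (fun=> 0) _.
Next Obligation. by exists 0. Qed.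
Program Definition lone := @Laurent (fun n => (n == 0)%:R) _.
Next Obligation. by exists 0 => n hn; rewrite lt_eqF. Qed.
Program Definition lopp f := @Laurent (fun n => - f n) _.
Next Obligation. by have [B h] := lcoefP f; exists B => n /h ->; rewrite oppr0. Qed.
Program Definition ladd f g := @Laurent (fun n => f n + g n) _.
Next Obligation.
have [B h] := lcoefP f; have [B' h'] := lcoefP g; exists (Num.min B B') => n hn.
by rewrite h ?h' ?addr0 //; lia.
Qed.
Program Definition lmul f g := @Laurent (lconv f g) _.
Next Obligation.
have [B h] := lcoefP f; have [B' h'] := lcoefP g.
by exists (B + B'); have [] := lconv_ord h h'.
Qed.

Lemma laddA : associative ladd.
Proof. by move=> f g h; apply: laurentP => n /=; rewrite addrA. Qed.
Lemma laddC : commutative ladd.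
Proof. by move=> f g; apply: laurentP => n /=; rewrite addrC. Qed.
Lemma ladd0 : left_id lzero ladd.
Proof. by move=> f; apply: laurentP => n /=; rewrite add0r. Qed.
Lemma laddN : left_inverse lzero lopp ladd.
Proof. by move=> f; apply: laurentP => n /=; rewrite addNr. Qed.
HB.instance Definition _ := GRing.isZmodule.Build laurent laddA laddC ladd0 laddN.

Lemma lmulC : commutative lmul.
Proof.
move=> f g; apply: laurentP => n /=; rewrite /lconv -(zsum_flip n).
by apply: eq_zsum => i; rewrite mulrC subKr.
Qed.

Lemma lmulA : associative lmul.
Proof.
move=> f g h; apply: laurentP => n /=; rewrite /lconv /= /lconv.
transitivity (zsum (fun i => zsum (fun k => f i * (g (k - i) * h (n - k))))).
  apply: eq_zsum => i; rewrite -(zsum_morph (mulrDr (f i))); last exact: zfin_conv.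
  rewrite -[LHS](@zsum_shift _ (- i)); apply: eq_zsum => k.
  by congr (_ * (_ * h _)); lia.
rewrite zsum_exchange; last first.
  have [A hA] := lcoefP f; have [B hB] := lcoefP g; have [D hD] := lcoefP h.
  exists (Num.min A (A + B)), (Num.max (n - D + 1) (n - D - B + 1)) => i k hik.
  have [hi|hi] := ltP i A; first by rewrite hA ?mul0r.
  have [hj|hj] := ltP (k - i) B; first by rewrite hB ?mul0r ?mulr0.
  by rewrite hD ?mulr0 //; lia.
apply: eq_zsum => k; rewrite -(zsum_morph (g := fun x => x * h (n - k))).
- by apply: eq_zsum => i; rewrite mulrA.
- by move=> x y; rewrite mulrDl.
- exact: zfin_conv.
Qed.

Lemma lmul1 : left_id lone lmul.
Proof.
move=> f; apply: laurentP => n /=; rewrite /lconv (@zsum1 _ 0) => [|i hi] /=.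
  by rewrite mul1r subr0.
by rewrite (negPf hi) mul0r.
Qed.

Lemma lmulDl : left_distributive lmul ladd.
Proof.
move=> f g h; apply: laurentP => n /=; rewrite /lconv -zsumD; try exact: zfin_conv.
by apply: eq_zsum => i; rewrite mulrDl.
Qed.

Lemma lone_neq0 : lone != lzero.
Proof.
by apply/eqP => /(congr1 (fun f : laurent => f 0)) /= /eqP; rewrite oner_eq0.
Qed.

HB.instance Definition _ :=
  GRing.Zmodule_isComNzRing.Build laurent lmulA lmulC lmul1 lmulDl lone_neq0.

Lemma lcoef0 n : (0 : laurent) n = 0. Proof. by []. Qed.
Lemma lcoef1 n : (1 : laurent) n = (n == 0)%:R. Proof. by []. Qed.
Lemma lcoefD f g n : (f + g) n = f n + g n. Proof. by []. Qed.
Lemma lcoefN f n : (- f) n = - f n. Proof. by []. Qed.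
Lemma lcoefB f g n : (f - g) n = f n - g n. Proof. by []. Qed.
Lemma lcoefM f g n : (f * g) n = zsum (fun i => f i * g (n - i)). Proof. by []. Qed.

Lemma lcoef_sum (I : Type) (r : seq I) (P : pred I) (F : I -> laurent) n :
  (\sum_(i <- r | P i) F i) n = \sum_(i <- r | P i) F i n.
Proof. by apply: (big_morph (fun f : laurent => f n)). Qed.

Program Definition lX (k : int) := @Laurent (fun n => (n == k)%:R) _.
Next Obligation. by exists k => n hn; rewrite lt_eqF. Qed.

Program Definition lC (c : R) := @Laurent (fun n => c * (n == 0)%:R) _.
Next Obligation. by exists 0 => n hn; rewrite lt_eqF ?mulr0. Qed.

Lemma lcoefC c f n : (lC c * f) n = c * f n.
Proof.
rewrite lcoefM (@zsum1 _ 0) => [|i hi] /=; first by rewrite ?eqxx mulr1 subr0.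
by rewrite (negPf hi) mulr0 mul0r.
Qed.

Lemma lcoefX k f n : (lX k * f) n = f (n - k).
Proof.
rewrite lcoefM (@zsum1 _ k) => [|i hi] /=; first by rewrite eqxx mul1r.
by rewrite (negPf hi) mul0r.
Qed.

Lemma lC1 : lC 1 = 1. Proof. by apply: laurentP => n; rewrite /= mul1r. Qed.
Lemma lCE c n : lC c n = c * (n == 0)%:R. Proof. by []. Qed.
Lemma lXE k n : lX k n = (n == k)%:R. Proof. by []. Qed.
Lemma lCD c d : lC (c + d) = lC c + lC d.
Proof. by apply: laurentP => n; rewrite lcoefD !lCE mulrDl. Qed.
Lemma lCN c : lC (- c) = - lC c.
Proof. by apply: laurentP => n; rewrite lcoefN !lCE mulNr. Qed.
Lemma lCM c d : lC (c * d) = lC c * lC d.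
Proof. by apply: laurentP => n; rewrite lcoefC !lCE mulrA. Qed.
Lemma lC0 : lC 0 = 0.
Proof. by apply: laurentP => n; rewrite lCE mul0r. Qed.
Lemma lXD k l : lX (k + l) = lX k * lX l.
Proof. by apply: laurentP => n; rewrite lcoefX !lXE; congr (nat_of_bool _)%:R; lia. Qed.

(** A lower bound on the valuation rather than the valuation, so that the zero series is no
    exception. *)
Definition ordge f (A : int) := forall n, n < A -> f n = 0.

Lemma ordgeD f g A : ordge f A -> ordge g A -> ordge (f + g) A.
Proof. by move=> hf hg n hn; rewrite lcoefD hf ?hg ?addr0. Qed.
Lemma ordgeN f A : ordge f A -> ordge (- f) A.
Proof. by move=> hf n hn; rewrite lcoefN hf ?oppr0. Qed.
Lemma ordgeM f g A B : ordge f A -> ordge g B -> ordge (f * g) (A + B).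
Proof. by move=> hf hg; have [] := lconv_ord hf hg. Qed.
Lemma leadM f g A B : ordge f A -> ordge g B -> (f * g) (A + B) = f A * g B.
Proof. by move=> hf hg; have [] := lconv_ord hf hg. Qed.
Lemma ordgeW f (A B : int) : B <= A -> ordge f A -> ordge f B.
Proof. by move=> h hf n hn; apply: hf; lia. Qed.
Lemma ordgeC c f A : ordge f A -> ordge (lC c * f) A.
Proof. by move=> hf n hn; rewrite lcoefC hf ?mulr0. Qed.
Lemma ordge_X k : ordge (lX k) k.
Proof. by move=> n hn; rewrite lXE lt_eqF. Qed.
Lemma ordge_1 : ordge 1 0.
Proof. by move=> n hn; rewrite lcoef1 lt_eqF. Qed.
Lemma ordge_exp f A k : ordge f A -> ordge (f ^+ k) (k%:Z * A).
Proof.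
move=> hf; elim: k => [|k IH]; first by rewrite expr0 mul0r; exact: ordge_1.
by rewrite exprS intS mulrDl mul1r; apply: ordgeM.
Qed.
Lemma lead_exp f A k : ordge f A -> (f ^+ k) (k%:Z * A) = f A ^+ k.
Proof.
move=> hf; elim: k => [|k IH]; first by rewrite expr0 mul0r lcoef1 eqxx.
by rewrite !exprS intS mulrDl mul1r leadM ?IH //; exact: ordge_exp.
Qed.

Program Definition dL f := @Laurent (fun n => (n + 1)%:~R * f (n + 1)) _.
Next Obligation.
have [B h] := lcoefP f; exists (B - 1) => n hn; rewrite h ?mulr0 //; lia.
Qed.

Lemma dLE f n : dL f n = (n + 1)%:~R * f (n + 1). Proof. by []. Qed.
Lemma dLD f g : dL (f + g) = dL f + dL g.
Proof. by apply: laurentP => n; rewrite lcoefD !dLE lcoefD mulrDr. Qed.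
Lemma dLN f : dL (- f) = - dL f.
Proof. by apply: laurentP => n; rewrite lcoefN !dLE lcoefN mulrN. Qed.
Lemma dL0 : dL 0 = 0.
Proof. by apply: laurentP => n; rewrite dLE lcoef0 mulr0. Qed.
Lemma dLC c f : dL (lC c * f) = lC c * dL f.
Proof. by apply: laurentP => n; rewrite lcoefC !dLE lcoefC mulrCA. Qed.
Lemma dL_X k : dL (lX k) = lC k%:~R * lX (k - 1).
Proof.
apply: laurentP => n; rewrite lcoefC dLE !lXE -(inj_eq (addIr (-1))) addrK.
by case: eqP => [->|]; rewrite ?mulr0 // subrK.
Qed.
Lemma dLM f g : dL (f * g) = dL f * g + f * dL g.
Proof.
apply: laurentP => n; rewrite dLE lcoefD !lcoefM.
rewrite -(zsum_morph (mulrDr (n + 1)%:~R)); last exact: (zfin_conv f g).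
have -> : zsum (fun i => dL f i * g (n - i)) = zsum (fun i => i%:~R * f i * g (n + 1 - i)).
  rewrite -[RHS](@zsum_shift _ 1); apply: eq_zsum => i; rewrite dLE -!mulrA.
  by congr (_ * (_ * g _)); lia.
rewrite -zsumD; last exact: (zfin_conv f (dL g)).
  apply: eq_zsum => i; rewrite dLE (_ : n - i + 1 = n + 1 - i); last by lia.
  by rewrite rmorphB /=; ring.
have [l [u H]] := zfin_conv f g (n + 1); exists l, u => i /H.
by rewrite -mulrA => ->; rewrite mulr0.
Qed.
Lemma dL_sum (I : Type) (r : seq I) (P : pred I) (F : I -> laurent) :
  dL (\sum_(i <- r | P i) F i) = \sum_(i <- r | P i) dL (F i).
Proof. exact: (big_morph dL dLD dL0). Qed.

Lemma ordge_dL f A : ordge f A -> ordge (dL f) (A - 1).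
Proof. by move=> hf n hn; rewrite dLE hf ?mulr0 //; lia. Qed.
Lemma ordge_dLn m f A : ordge f A -> ordge (iter m dL f) (A - m%:Z).
Proof.
move=> hf; elim: m => [|m IH] /=; first by rewrite subr0.
by apply: ordgeW (ordge_dL IH); lia.
Qed.
(** Unlike in [ordge_dLn], no order is lost: the factor $n+1$ vanishes at $n=-1$, so power series
    stay power series. *)
Lemma ordge_dLn0 m f : ordge f 0 -> ordge (iter m dL f) 0.
Proof.
move=> hf; elim: m => [//|m IH] n hn; rewrite iterS dLE.
have [hn'|hn'] := ltP (n + 1) 0; first by rewrite IH ?mulr0.
have -> : n + 1 = 0 by lia.
by rewrite mul0r.
Qed.
Lemma dLn_X m k : iter m dL (lX k) = lC (\prod_(j < m) (k%:~R - j%:R)) * lX (k - m%:Z).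
Proof.
elim: m => [|m IH]; first by rewrite big_ord0 lC1 mul1r subr0.
rewrite iterS IH dLC dL_X mulrA -lCM big_ord_recr /= rmorphB /=.
by congr (_ * lX _); lia.
Qed.
Lemma dLnD m f g : iter m dL (f + g) = iter m dL f + iter m dL g.
Proof. by elim: m => //= m ->; rewrite dLD. Qed.
Lemma dLnN m f : iter m dL (- f) = - iter m dL f.
Proof. by elim: m => //= m ->; rewrite dLN. Qed.
Lemma dLnC m c f : iter m dL (lC c * f) = lC c * iter m dL f.
Proof. by elim: m => //= m ->; rewrite dLC. Qed.

(** * Exponentials, the uniformiser $\xi=1-e^{-z}$ and its inverse $\kappa$ *)

Program Definition lexp (c : R) :=
  @Laurent (fun n => if n is Posz m then c ^+ m / m`!%:R else 0) _.
Next Obligation. by exists 0; case. Qed.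

Lemma lexpE c (m : nat) : lexp c m = c ^+ m / m`!%:R. Proof. by []. Qed.
Lemma ordge_lexp c : ordge (lexp c) 0. Proof. by case. Qed.

Lemma fact_neq0 m : (m`!)%:R != 0 :> R.
Proof. by rewrite pnatr_eq0 -lt0n fact_gt0. Qed.

Lemma lexpD c d : lexp (c + d) = lexp c * lexp d.
Proof.
apply: laurentP => -[n|n]; last first.
  have /(_ (Negz n)) -> // := ordgeM (ordge_lexp c) (ordge_lexp d).
rewrite lcoefM (@zsumI _ 0 n.+1) => [|i hi]; last first.
  have [hi'|hi'] := ltP i 0; first by rewrite ordge_lexp ?mul0r.
  by rewrite [X in _ * X]ordge_lexp ?mulr0 //; lia.
rewrite addrC lexpE exprDn mulr_suml /zint; apply: eq_bigr => -[k kn] _ /=.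
rewrite add0r (_ : n%:Z - k%:Z = (n - k)%N); last by lia.
rewrite /= -(@bin_fact n k) // !natrM -mulr_natr.
have h1 := @fact_neq0 (n - k)%N; have h2 := @fact_neq0 k.
have h3 : ('C(n, k))%:R != 0 :> R by rewrite pnatr_eq0 -lt0n bin_gt0.
by field; rewrite h1 h2 h3.
Qed.

Lemma lexp0 : lexp 0 = 1.
Proof.
apply: laurentP => -[[|n]|n] //; first by rewrite lexpE expr0 fact0 divr1.
by rewrite lexpE exprS mul0r mul0r.
Qed.

Lemma dL_lexp c : dL (lexp c) = lC c * lexp c.
Proof.
apply: laurentP => n; rewrite dLE lcoefC; case: n => [n|[|n]].
- have -> : n%:Z + 1 = n.+1 by lia.
  rewrite !lexpE factS natrM exprS; have := @fact_neq0 n.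
  have : n.+1%:R != 0 :> R by rewrite pnatr_eq0.
  rewrite (_ : n.+1%:~R = n.+1%:R :> R) //.
  by move: n.+1%:R (n`!%:R : R) (c ^+ n) => x y z h1 h2; field; rewrite h1 h2.
- by rewrite (_ : Negz 0 + 1 = 0) // mul0r mulr0.
- by rewrite (_ : Negz n.+1 + 1 = Negz n) ?mulr0 //; lia.
Qed.

Lemma dL_lexpM c f : dL (lexp c * f) = lexp c * (lC c * f + dL f).
Proof. by rewrite dLM dL_lexp; ring. Qed.

Definition lxi := 1 - lexp (-1).

Lemma ordge_lxi : ordge lxi 1.
Proof.
case=> [[|n]|n] // _; rewrite lcoefB ?lcoef0 lcoef1 ?lexpE //=.
- by rewrite expr0 fact0 divr1 subrr.
- by rewrite subr0.
Qed.

Lemma lead_lxi : lxi 1 = 1.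
Proof. by rewrite lcoefB lcoef1 lexpE sub0r expr1 (_ : 1`!%:R = 1 :> R) // divr1 opprK. Qed.

(** For $f=z+\cdots$, entry $i$ is the coefficient of $z^{i-1}$ in $1/f$, obtained by solving the
    convolution equation degree by degree. The list is carried along because each entry needs all
    earlier ones. *)
Fixpoint linv_seq f (n : nat) : seq R :=
  if n is m.+1 then
    rcons (linv_seq f m) (- \sum_(i < n) (linv_seq f m)`_i * f (1 + n%:Z - i%:Z))
  else [:: 1].

Lemma size_linv_seq f n : size (linv_seq f n) = n.+1.
Proof. by elim: n => //= n IH; rewrite size_rcons IH. Qed.

Lemma linv_seq_nth f n i : (i <= n)%N -> (linv_seq f n)`_i = (linv_seq f i)`_i.
Proof.
elim: n => [|n IH]; first by rewrite leqn0 => /eqP ->.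
rewrite leq_eqVlt => /orP[/eqP -> //|hi].
by rewrite /= nth_rcons size_linv_seq hi IH.
Qed.

Program Definition lkappa := @Laurent
  (fun n => if n + 1 is Posz m then (linv_seq lxi m)`_m else 0) _.
Next Obligation. by exists (-1) => n hn; case E: (n + 1) => [m|m] //; lia. Qed.

Lemma ordge_lkappa : ordge lkappa (-1).
Proof. by move=> n hn /=; case E: (n + 1) => [m|m] //; lia. Qed.

#[local] Arguments lcoef : simpl never.

Lemma lkappaE (m : nat) : lkappa (m%:Z - 1) = (linv_seq lxi m)`_m.
Proof. by rewrite /lcoef /= subrK. Qed.

Lemma lead_lkappa : lkappa (-1) = 1.
Proof. by rewrite -[-1](add0r) (lkappaE 0). Qed.

Lemma lkappa_xi : lkappa * lxi = 1.
Proof.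
apply: laurentP => n; have h := ordgeM ordge_lkappa ordge_lxi.
have [hn|hn] := ltP n 0; first by rewrite h // lcoef1 lt_eqF.
case: n hn => // -[_|n _].
  by have := leadM ordge_lkappa ordge_lxi; rewrite lead_lkappa lead_lxi mulr1.
rewrite lcoefM (@zsumI _ (-1) n.+2) => [|i hi]; last first.
  have [hi'|hi'] := ltP i (-1); first by rewrite ordge_lkappa ?mul0r.
  by rewrite ordge_lxi ?mulr0 //; lia.
rewrite /zint big_ord_recr /= (addrC (-1)) (lkappaE n.+1) /= nth_rcons size_linv_seq.
rewrite ltnn eqxx (_ : n.+1%:Z - (n.+1%:Z - 1) = 1); last by lia.
rewrite lead_lxi mulr1 -sumrB big1 // => -[i hi] _ /=.
rewrite (addrC (-1)) (lkappaE i) linv_seq_nth //.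
by rewrite (_ : n.+1%:Z - (i%:Z - 1) = 1 + n.+1%:Z - i%:Z) ?subrr //; lia.
Qed.

Lemma lxi_inj f g : lxi * f = lxi * g -> f = g.
Proof.
move=> /(congr1 (fun x => lkappa * x)); rewrite !mulrA lkappa_xi !mul1r //.
Qed.

Lemma lexp_kappaB c : lexp c * lkappa - lexp (c - 1) * lkappa = lexp c.
Proof.
rewrite lexpD -[RHS]mulr1 -lkappa_xi /lxi; ring.
Qed.

(** This is $p(-d/dz)h$. The sign makes $e^{-tz}$ an eigenvector of eigenvalue $p(t)$, so that a
    polynomial weight on modes becomes a differential operator on the kernel. *)
Definition pd (p : {poly R}) h : laurent :=
  \sum_(j < size p) lC p`_j * iter j (fun x => - dL x) h.

Lemma pdE N (p : {poly R}) h : (size p <= N)%N ->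
  pd p h = \sum_(j < N) lC p`_j * iter j (fun x => - dL x) h.
Proof.
move=> hN; rewrite /pd (big_ord_widen _ (fun j => lC p`_j * iter j (fun x => - dL x) h) hN).
rewrite big_mkcond /=; apply: eq_bigr => j _.
by case: ltnP => // hj; rewrite nth_default // lC0 mul0r.
Qed.

Lemma pdD p q h : pd (p + q) h = pd p h + pd q h.
Proof.
pose N := maxn (size p) (size q).
have hp : (size p <= N)%N by rewrite leq_maxl.
have hq : (size q <= N)%N by rewrite leq_maxr.
rewrite (pdE h hp) (pdE h hq) (@pdE N) ?(leq_trans (size_polyD _ _)) //.
by rewrite -big_split; apply: eq_bigr => j _; rewrite coefD lCD mulrDl.
Qed.

Lemma pdZ c p h : pd (c *: p) h = lC c * pd p h.
Proof.
rewrite (@pdE (size p)) ?size_scale_leq // mulr_sumr.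
by apply: eq_bigr => j _; rewrite coefZ lCM mulrA.
Qed.

Lemma pdN p h : pd (- p) h = - pd p h.
Proof. by rewrite -scaleN1r pdZ lCN lC1 mulN1r. Qed.

Lemma pdC c h : pd c%:P h = lC c * h.
Proof. by rewrite (@pdE 1) ?size_polyC_leq1 // big_ord1 coefC eqxx. Qed.

Lemma pdMX p h : pd (p * 'X) h = - dL (pd p h).
Proof.
rewrite (@pdE (size p).+1); last first.
  by rewrite (leq_trans (size_polyMleq _ _)) // size_polyX addn2.
rewrite big_ord_recl coefMX lC0 mul0r add0r /pd dL_sum -sumrN.
by apply: eq_bigr => j _; rewrite coefMX /= dLC mulrN.
Qed.

Lemma pd_cons p c h : pd (p * 'X + c%:P) h = - dL (pd p h) + lC c * h.
Proof. by rewrite pdD pdMX pdC. Qed.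

Lemma pdDr p f g : pd p (f + g) = pd p f + pd p g.
Proof.
elim/poly_ind: p f g => [|p c IH] f g; first by rewrite /pd size_poly0 !big_ord0 addr0.
by rewrite !pd_cons IH dLD mulrDr; ring.
Qed.

Lemma pdNr p f : pd p (- f) = - pd p f.
Proof.
elim/poly_ind: p f => [|p c IH] f; first by rewrite /pd size_poly0 !big_ord0 oppr0.
by rewrite !pd_cons IH dLN mulrN; ring.
Qed.

Lemma pd_lexp p c : pd p (lexp c) = lC p.[- c] * lexp c.
Proof.
elim/poly_ind: p => [|p d IH]; first by rewrite /pd size_poly0 !big_ord0 horner0 lC0 mul0r.
rewrite pd_cons IH dLC dL_lexp hornerMXaddC lCD lCM lCN; ring.
Qed.

(** Conjugation by $e^{cz}$ shifts $-d/dz$ by the constant $c$. *)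
Lemma pd_lexpM p c h : lexp c * pd p h = pd (p \Po ('X + c%:P)) (lexp c * h).
Proof.
elim/poly_ind: p => [|p d IH].
  by rewrite comp_poly0 /pd size_poly0 !big_ord0 mulr0.
rewrite comp_polyD comp_polyC comp_polyM comp_polyX mulrDr pd_cons pdD pdD pdMX.
rewrite pdC -IH mulrC [_ * c%:P]mulrC mul_polyC pdZ -IH dL_lexpM.
by rewrite mulrDl; ring.
Qed.

Lemma pd_expr m c h : pd ((c%:P - 'X) ^+ m) h = lexp (- c) * iter m dL (lexp c * h).
Proof.
elim: m => [|m IH].
  by rewrite expr0 pdC lC1 mul1r mulrA -lexpD addNr lexp0 mul1r.
rewrite exprSr mulrBr pdD -mulNr pdMX mulrC mul_polyC pdZ.
by rewrite pdN dLN opprK IH dL_lexpM lCN iterS; ring.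
Qed.

(** Identifies the kernel produced by telescoping sums with that of the commutator formula. Multiply
    by $\xi$ and put $f=e^{-(s+t)z}\kappa$: then $e^{-z}f=f-e^{-(s+t)z}$, and the last term
    contributes $p(s+t-1)=0$. What remains is the backward difference of $p$ applied to $f$, which
    is $e^{-tz}\frac{1}{m!}\frac{d^m}{dz^m}(e^{tz}f)$. *)
Lemma pd_telescope m (s t : R) (p : {poly R}) :
  p - (p \Po ('X - 1%:P)) = (m`!%:R)^-1 *: (t%:P - 'X) ^+ m -> p.[s + t - 1] = 0 ->
  pd p (lexp (- (s + t)) * lkappa) =
  lC (m`!%:R)^-1 * iter m dL (lexp (- s) * lkappa) * (lexp (- t) * lkappa).
Proof.
move=> hp p0; apply: lxi_inj.
set f := lexp (- (s + t)) * lkappa.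
have hf : lexp (-1) * f = f - lexp (- (s + t)).
  by rewrite -[X in f - X](lexp_kappaB (- (s + t))) subKr lexpD /f; ring.
rewrite {1}/lxi mulrBl mul1r pd_lexpM polyCN hf pdDr pdNr pd_lexp.
have -> : (p \Po ('X - 1%:P)).[- - (s + t)] = 0.
  by rewrite horner_comp hornerXsubC opprK p0.
rewrite lC0 mul0r subr0.
have -> : pd p f - pd (p \Po ('X - 1%:P)) f = pd (p - (p \Po ('X - 1%:P))) f.
  by rewrite pdD pdN.
rewrite hp pdZ pd_expr /f.
have -> : lexp t * (lexp (- (s + t)) * lkappa) = lexp (- s) * lkappa.
  by rewrite mulrA -lexpD; congr (lexp _ * _); ring.
by rewrite -[LHS]mulr1 -lkappa_xi; ring.
Qed.

End LaurentSeries.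

Arguments lcoef : simpl never.

(** * Finite differences and pairings with Laurent series *)

Section Differences.
Variables (R : numFieldType) (M : lmodType R).
Implicit Types (u v : int -> M) (f g h : laurent R).

Definition diff u (t : int) : M := u t - u (t + 1).
(** Polynomial dependence on $t$ of degree less than $K$; see [dnil_poly]. *)
Definition dnil K u := forall t, iter K diff u t = 0.

Lemma diffE u t : diff u t = u t - u (t + 1). Proof. by []. Qed.

Lemma diffnD n u v : iter n diff (fun t => u t + v t) =
  fun t => iter n diff u t + iter n diff v t.
Proof.
by elim: n => // n IH; apply: funext => t; rewrite !iterS /diff IH; rewrite opprD addrACA.
Qed.

Lemma diffnZ n c u : iter n diff (fun t => c *: u t) = fun t => c *: iter n diff u t.
Proof.
by elim: n => // n IH; apply: funext => t; rewrite !iterS /diff IH -scalerBr.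
Qed.

Lemma diffn_shift n k u :
  iter n diff (fun t => u (t + k)) = fun t => iter n diff u (t + k).
Proof.
by elim: n => // n IH; apply: funext => t; rewrite !iterS /diff IH addrAC.
Qed.

Lemma diffn0 n : iter n diff (fun=> 0) = fun=> 0.
Proof. by elim: n => // n IH; apply: funext => t; rewrite iterS IH /diff subr0. Qed.

Lemma dnilW K K' u : (K <= K')%N -> dnil K u -> dnil K' u.
Proof.
move=> /subnK <- h t; have : iter K diff u = fun=> 0 by apply: funext.
by rewrite iterD => ->; rewrite diffn0.
Qed.

Lemma dnilD K u v : dnil K u -> dnil K v -> dnil K (fun t => u t + v t).
Proof. by move=> hu hv t; rewrite diffnD hu hv addr0. Qed.

Lemma dnilZ K c u : dnil K u -> dnil K (fun t => c *: u t).
Proof. by move=> hu t; rewrite diffnZ hu scaler0. Qed.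

Lemma dnil_shift K k u : dnil K u -> dnil K (fun t => u (t + k)).
Proof. by move=> hu t; rewrite diffn_shift. Qed.

Lemma dnil_diff K u : dnil K u -> dnil K (diff u).
Proof. by move=> hu; move=> t; have := dnilW (leqnSn K) hu t; rewrite iterSr. Qed.

(* Greedy expansion [h = sum_l (lmu h l) kappa xi^l], valid when [h] has at most
   a simple pole. *)
Fixpoint lrem h (l : nat) : laurent R :=
  if l is k.+1 then lrem h k - lC (lrem h k (k%:Z - 1)) * (lkappa R * lxi R ^+ k)
  else h.
Definition lmu h (l : nat) : R := lrem h l (l%:Z - 1).

Lemma lremS h l : lrem h l.+1 = lrem h l - lC (lmu h l) * (lkappa R * lxi R ^+ l).
Proof. by []. Qed.

Lemma ordge_kxi l : ordge (lkappa R * lxi R ^+ l) (l%:Z - 1).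
Proof.
apply: ordgeW (ordgeM (@ordge_lkappa R) (ordge_exp (k := l) (@ordge_lxi R))).
by lia.
Qed.

Lemma lead_kxi l : (lkappa R * lxi R ^+ l) (l%:Z - 1) = 1.
Proof.
have := leadM (@ordge_lkappa R) (ordge_exp (k := l) (@ordge_lxi R)).
by rewrite lead_lkappa (lead_exp _ (@ordge_lxi R)) lead_lxi expr1n mulr1 mulr1 addrC.
Qed.

Lemma ordge_lrem h l : ordge h (-1) -> ordge (lrem h l) (l%:Z - 1).
Proof.
move=> hh; elim: l => [|l IH] //; rewrite lremS => n hn.
have [hn'|hn'] := ltP n (l%:Z - 1).
  by rewrite lcoefB lcoefC IH // ordge_kxi // mulr0 subr0.
by rewrite (_ : n = l%:Z - 1) ?lcoefB ?lcoefC ?lead_kxi ?mulr1 ?subrr //; lia.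
Qed.

Lemma lremD f g l : lrem (f + g) l = lrem f l + lrem g l.
Proof. by elim: l => //= l ->; rewrite lcoefD lCD; ring. Qed.

Lemma lremC c f l : lrem (lC c * f) l = lC c * lrem f l.
Proof. by elim: l => //= l ->; rewrite lcoefC lCM; ring. Qed.

Lemma lrem_sum h l : h = lrem h l + \sum_(k < l) lC (lmu h k) * (lkappa R * lxi R ^+ k).
Proof.
elim: l => [|l IH]; first by rewrite big_ord0 addr0.
by rewrite big_ord_recr lremS {1}IH /=; ring.
Qed.

Lemma lmuD f g l : lmu (f + g) l = lmu f l + lmu g l.
Proof. by rewrite /lmu lremD. Qed.

Lemma lmuC c f l : lmu (lC c * f) l = c * lmu f l.
Proof. by rewrite /lmu lremC lcoefC. Qed.

Lemma lmu_ord h (K l : nat) : ordge h (K%:Z - 1) -> (l < K)%N -> lmu h l = 0.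
Proof.
move=> hh hl; suff -> : lmu h l = h (l%:Z - 1) by rewrite hh //; lia.
rewrite /lmu; suff -> : lrem h l = h by [].
elim: l hl => // l IH hl; rewrite /= IH; last by lia.
by rewrite hh ?lC0 ?mul0r ?subr0 //; lia.
Qed.

(** Multiplication by $\xi$ moves the expansion in the $\kappa\xi^l$ by one place. *)
Lemma lmu_xi h l : ordge h (-1) ->
  lmu (lxi R * h) 0 = 0 /\ lmu (lxi R * h) l.+1 = lmu h l.
Proof.
move=> hh; have h0 : lmu (lxi R * h) 0 = 0.
  by rewrite /lmu /= sub0r; apply: (ordgeM (@ordge_lxi R) hh).
split=> //.
have lead k : (lxi R * lrem h k) k = lmu h k.
  have := leadM (@ordge_lxi R) (ordge_lrem (l := k) hh).
  by rewrite lead_lxi mul1r (_ : 1 + (k%:Z - 1) = k) //; lia.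
suff E k : lrem (lxi R * h) k.+1 = lxi R * lrem h k.
  by rewrite /lmu E -[RHS]lead; congr (lcoef _ _); lia.
elim: k => [|k IH]; first by rewrite lremS h0 lC0 mul0r subr0.
rewrite lremS /lmu IH (_ : k.+1%:Z - 1 = k) ?lead; last by lia.
by rewrite lremS exprS; ring.
Qed.

(** By [fpairE] every annihilating order gives the same pairing; choosing one here keeps it out of
    the arguments of [fpair]. The default 0 makes the pairing vanish when $u$ is not polynomial. *)
Definition dord u : nat :=
  if pselect (exists K, dnil K u) is left H then sval (cid H) else 0.

(** The linear functional with $\kappa\xi^l\mapsto\Delta^l u(0)$, hence with $e^{-tz}\kappa\mapsto
    u(t)$ ([fpair_eval]). For $u(t)=N_t(a,c)$ and $n\ge-1$, the value at $z^n$ is the product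
    $a_nc$. *)
Definition fpair h u : M := \sum_(l < dord u) lmu h l *: iter l diff u 0.

Lemma fpairE K h u : dnil K u -> fpair h u = \sum_(l < K) lmu h l *: iter l diff u 0.
Proof.
move=> hK; rewrite /fpair /dord; case: pselect => [H|[]]; last by exists K.
case: (cid H) => L /= hL.
have aux A B : dnil A u -> (A <= B)%N -> \sum_(l < B) lmu h l *: iter l diff u 0 =
    \sum_(l < A) lmu h l *: iter l diff u 0.
  move=> hA hAB.
  rewrite (big_ord_widen _ (fun l => lmu h l *: iter l diff u 0) hAB) [RHS]big_mkcond.
  apply: eq_bigr => -[l lB] _ /=; case: ltnP => // hl.
  by rewrite (dnilW hl hA) scaler0.
by have [/aux ->|/ltnW/aux ->] := leqP K L.
Qed.

Lemma fpairDl f g u : fpair (f + g) u = fpair f u + fpair g u.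
Proof. by rewrite -big_split; apply: eq_bigr => l _; rewrite lmuD scalerDl. Qed.

Lemma fpairCl c f u : fpair (lC c * f) u = c *: fpair f u.
Proof. by rewrite scaler_sumr; apply: eq_bigr => l _; rewrite lmuC scalerA. Qed.

Lemma fpair0l u : fpair 0 u = 0.
Proof. by rewrite -(lC0 R) -[lC 0]mulr1 fpairCl scale0r. Qed.

Lemma fpair_suml (I : Type) (r : seq I) (F : I -> laurent R) u :
  fpair (\sum_(i <- r) F i) u = \sum_(i <- r) fpair (F i) u.
Proof. exact: (big_morph (fpair^~ u) (fun f g => fpairDl f g u) (fpair0l u)). Qed.

Lemma fpairDr K h u v : dnil K u -> dnil K v ->
  fpair h (fun t => u t + v t) = fpair h u + fpair h v.
Proof.
move=> hu hv; rewrite (fpairE _ hu) (fpairE _ hv) (fpairE _ (dnilD hu hv)) -big_split.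
by apply: eq_bigr => l _; rewrite diffnD scalerDr.
Qed.

Lemma fpairZr K h c u : dnil K u -> fpair h (fun t => c *: u t) = c *: fpair h u.
Proof.
move=> hu; rewrite (fpairE _ hu) (fpairE _ (dnilZ c hu)) scaler_sumr.
by apply: eq_bigr => l _; rewrite diffnZ !scalerA mulrC.
Qed.

Lemma fpair_ord K h u : dnil K u -> ordge h (K%:Z - 1) -> fpair h u = 0.
Proof.
move=> hu hh; rewrite (fpairE _ hu) big1 // => -[l lK] _ /=.
by rewrite (lmu_ord hh lK) scale0r.
Qed.

Lemma fpair_xi K h u : dnil K u -> ordge h (-1) -> fpair (lxi R * h) u = fpair h (diff u).
Proof.
move=> hu hh; rewrite (fpairE _ (dnilW (leqnSn K) hu)) (fpairE _ (dnil_diff hu)).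
rewrite big_ord_recl /= (lmu_xi 0 hh).1 scale0r add0r; apply: eq_bigr => l _.
by rewrite (lmu_xi _ hh).2 -iterSr.
Qed.

Lemma fpair_kappa K u : dnil K u -> fpair (lkappa R) u = u 0.
Proof.
move=> hu; rewrite (fpairE _ (dnilW (leqnSn K) hu)) big_ord_recl.
have E k : lrem (lkappa R) k.+1 = 0.
  elim: k => [|k IH]; last by rewrite lremS /lmu IH lcoef0 lC0 mul0r subr0.
  by rewrite lremS /lmu /= sub0r lead_lkappa lC1 mul1r mulr1 subrr.
rewrite [X in _ + X]big1 => [|l _]; last by rewrite lift0 /lmu E lcoef0 scale0r.
by rewrite /lmu /= sub0r lead_lkappa scale1r addr0.
Qed.

Lemma fpair_shift K h u : dnil K u -> ordge h (-1) ->
  fpair h (fun t => u (t + 1)) = fpair (lexp (-1) * h) u.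
Proof.
move=> hu hh.
have -> : (fun t => u (t + 1)) = fun t => u t + (-1) *: diff u t.
  by apply: funext => t; rewrite scaleN1r /diff opprB addrCA subrr addr0.
rewrite (@fpairDr K) ?(@fpairZr K) //; [|exact: dnil_diff|exact/dnilZ/dnil_diff].
rewrite -(fpair_xi hu hh) -fpairCl -fpairDl; congr fpair.
by rewrite lCN lC1 /lxi; ring.
Qed.

Lemma fpair_shiftn (n : nat) K h u : dnil K u -> ordge h (-1) ->
  fpair h (fun t => u (t + n)) = fpair (lexp (- n%:R) * h) u.
Proof.
elim: n h u => [|n IH] h u hu hh.
  by rewrite oppr0 lexp0 mul1r; under eq_fun do rewrite addr0.
have -> : (fun t : int => u (t + n.+1%:Z)) = fun t : int => (fun s : int => u (s + n%:Z)) (t + 1).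
  by apply: funext => t; congr u; lia.
rewrite [LHS](@fpair_shift K h (fun s : int => u (s + n%:Z))) //; last exact: dnil_shift.
rewrite IH //; last by apply: (ordgeM (ordge_lexp (-1 : R)) hh).
by rewrite mulrA -lexpD -natr1 opprD.
Qed.

(** Interpolation from the differences at 0. The shift rule only moves forward, so negative $t$ is
    reached by applying it to a translate of $u$. *)
Lemma fpair_eval K u (t : int) : dnil K u -> fpair (lexp (- t%:~R) * lkappa R) u = u t.
Proof.
move=> hu; have ok := @ordge_lkappa R; case: t => n.
  by rewrite -(fpair_shiftn n hu ok) (@fpair_kappa K) ?add0r //; exact: dnil_shift.
have hk : ordge (lexp n.+1%:R * lkappa R) (-1).
  by apply: (ordgeM (ordge_lexp _) ok).
rewrite NegzE mulrNz opprK.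
pose v s := u (s - n.+1%:Z); have hv : dnil K v by exact: dnil_shift.
have -> : u = fun t => v (t + n.+1%:Z) by apply: funext => t; rewrite /v addrK.
rewrite (fpair_shiftn n.+1 hv hk) mulrA -lexpD addNr lexp0 mul1r.
by rewrite (@fpair_kappa K) // addrC subrr.
Qed.

(** The part of $h$ of order at least $K-1$ pairs to zero, so $h$ may be truncated to degrees
    $-1,\dots,K-2$. *)
Lemma fpair_expand K h u : dnil K u -> ordge h (-1) ->
  fpair h u = \sum_(n < K) h (n%:Z - 1) *: fpair (lX R (n%:Z - 1)) u.
Proof.
move=> hu hh; pose g := \sum_(n < K) lC (h (n%:Z - 1)) * lX R (n%:Z - 1).
rewrite {1}(_ : h = g + (h - g)); last by rewrite addrC subrK.
rewrite fpairDl [X in _ + X](fpair_ord hu) ?addr0; last first.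
  move=> n hn; rewrite lcoefB /g lcoef_sum.
  have [hn'|hn'] := ltP n (-1).
    rewrite hh // big1 ?subr0 // => k _; rewrite lcoefC lXE.
    by rewrite (_ : (n == _) = false) ?mulr0 //; lia.
  have hk : (absz (n + 1)%R < K)%N by lia.
  rewrite (bigD1 (Ordinal hk)) //= lcoefC lXE (_ : (absz (n + 1)%R)%:Z - 1 = n); last by lia.
  rewrite eqxx mulr1 big1 ?addr0 ?subrr // => k hk'; rewrite lcoefC lXE.
  rewrite (_ : (n == _) = false) ?mulr0 //.
  by apply/eqP => e; case/eqP: hk'; apply: val_inj => /=; lia.
by rewrite /g fpair_suml; apply: eq_bigr => k _; rewrite fpairCl.
Qed.

(** For $g=1$ this is $\sum_{j<K}\frac{(-t)^j}{j!}v_j$. The parameter $g$ is there because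
    differences act by $g\mapsto\xi g$. *)
Definition upoly K (v : nat -> M) (g : laurent R) (t : int) : M :=
  \sum_(j < K) (lexp (- t%:~R) * g) j *: v j.

Lemma diff_upoly K (v : nat -> M) g : diff (upoly K v g) = upoly K v (lxi R * g).
Proof.
apply: funext => t; rewrite /diff /upoly -sumrB; apply: eq_bigr => j _.
rewrite -scalerBl -lcoefB; congr (lcoef _ _ *: _).
by rewrite rmorphD opprD lexpD /lxi /=; ring.
Qed.

Lemma diffn_upoly K (v : nat -> M) n : iter n diff (upoly K v 1) = upoly K v (lxi R ^+ n).
Proof. by elim: n => // n IH; rewrite iterS IH diff_upoly exprS. Qed.

Lemma dnil_upoly K (v : nat -> M) : dnil K (upoly K v 1).
Proof.
move=> t; rewrite diffn_upoly /upoly big1 // => -[j jK] _ /=.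
have h := ordgeM (ordge_lexp (- t%:~R)) (ordge_exp (k := K) (@ordge_lxi R)).
by rewrite h ?scale0r //; lia.
Qed.

(** Since $\kappa\xi=1$, multiplying the expansion of $f\kappa$ in the $\kappa\xi^l$ by $\xi$ gives
    the expansion of $f$ in powers of $\xi$, and $v_j$ meets its coefficient of $z^j$. *)
Lemma fpair_upoly K (v : nat -> M) f : ordge f 0 ->
  fpair (f * lkappa R) (upoly K v 1) = \sum_(j < K) f j *: v j.
Proof.
move=> hf; rewrite (fpairE _ (@dnil_upoly K v)).
under eq_bigr do rewrite diffn_upoly /upoly scaler_sumr.
rewrite exchange_big /=; apply: eq_bigr => -[j jK] _ /=.
under eq_bigr do rewrite scalerA; rewrite -scaler_suml; congr (_ *: _).
have ho : ordge (f * lkappa R) (-1) by apply: (ordgeM hf (@ordge_lkappa R)).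
have -> : f j = (lxi R * (f * lkappa R)) j.
  by rewrite mulrCA (mulrC (lxi R)) lkappa_xi mulr1.
rewrite [in RHS](lrem_sum (f * lkappa R) K) mulrDr lcoefD.
rewrite [X in _ = X + _](_ : _ = 0); last first.
  apply: (ordgeM (@ordge_lxi R) (ordge_lrem (l := K) ho)); lia.
rewrite add0r mulr_sumr lcoef_sum; apply: eq_bigr => l _.
rewrite (_ : lxi R * _ = lC (lmu (f * lkappa R) l) * (lxi R ^+ l)); last first.
  transitivity (lC (lmu (f * lkappa R) l) * lxi R ^+ l * (lkappa R * lxi R)).
    by ring.
  by rewrite lkappa_xi mulr1.
by rewrite lcoefC mulr0z oppr0 lexp0 mul1r.
Qed.

(** By interpolation $u(t)$ is the pairing with $e^{-tz}\kappa$. Expanding the exponential gives the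
    coefficients, its terms from $z^K$ on pairing to zero. *)
Lemma dnil_poly K u : dnil K u -> exists v : nat -> M, u = upoly K v 1.
Proof.
move=> hu; exists (fun j => fpair (lX R j * lkappa R) u); apply: funext => t.
rewrite -{1}(fpair_eval t hu) /upoly mulr1.
pose f := lexp (- t%:~R : R); rewrite -/f.
pose g := \sum_(j < K) lC (f j) * lX R j.
have hg : ordge (f - g) K.
  move=> n hn; rewrite lcoefB /g lcoef_sum.
  have [hn'|hn'] := ltP n 0.
    rewrite ordge_lexp // big1 ?subr0 // => k _; rewrite lcoefC lXE.
    by rewrite (_ : (n == _) = false) ?mulr0 //; lia.
  have hk : (absz n < K)%N by lia.
  rewrite (bigD1 (Ordinal hk)) //= lcoefC lXE (_ : (absz n)%:Z = n); last by lia.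
  rewrite eqxx mulr1 big1 ?addr0 ?subrr // => k hk'; rewrite lcoefC lXE.
  rewrite (_ : (n == _) = false) ?mulr0 //.
  by apply/eqP => e; case/eqP: hk'; apply: val_inj => /=; lia.
have -> : f * lkappa R = g * lkappa R + (f - g) * lkappa R by ring.
rewrite fpairDl [X in _ + X](fpair_ord hu) ?addr0; last first.
  exact: (ordgeM hg (@ordge_lkappa R)).
rewrite /g mulr_suml fpair_suml; apply: eq_bigr => j _.
by rewrite -mulrA fpairCl.
Qed.

Definition umul u (t : int) : M := t%:~R *: u t.

(** From $t\,\frac{(-t)^i}{i!}=-(i+1)\frac{(-t)^{i+1}}{(i+1)!}$. *)
Definition umul_coef (v : nat -> M) (j : nat) : M :=
  if j is i.+1 then - (j%:R *: v i) else 0.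

Lemma umul_upoly K (v : nat -> M) : umul (upoly K v 1) = upoly K.+1 (umul_coef v) 1.
Proof.
apply: funext => t; rewrite /umul /upoly big_ord_recl scaler0 add0r scaler_sumr.
apply: eq_bigr => j _; rewrite lift0 !mulr1 !lexpE scalerN -scaleNr !scalerA.
congr (_ *: _); rewrite factS natrM exprS invfM.
have h : j.+1%:R != 0 :> R by rewrite pnatr_eq0.
move: (j.+1%:R : R) h (j`!%:R^-1 : R) ((- t%:~R) ^+ j : R) => x hx y z.
by field.
Qed.

Lemma dnil_umul K u : dnil K u -> dnil K.+1 (umul u).
Proof. by move=> /dnil_poly[v ->]; rewrite umul_upoly; exact: dnil_upoly. Qed.

(** In the basis of [upoly] the pairing with $f\kappa$ sees only the coefficients of $f$, so the
    derivative falls on $f$ alone and not on $\kappa$. *)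
Lemma fpair_umul K f u : dnil K u -> ordge f 0 ->
  fpair (f * lkappa R) (umul u) = - fpair (dL f * lkappa R) u.
Proof.
move=> /dnil_poly[v ->] hf; rewrite umul_upoly !fpair_upoly //; last first.
  exact: (@ordge_dLn0 R 1).
rewrite big_ord_recl scaler0 add0r -sumrN; apply: eq_bigr => j _.
rewrite lift0 scalerN scalerA dLE; congr (- (_ *: _)).
by rewrite (_ : j%:Z + 1 = j.+1%:Z); [rewrite mulrC | lia].
Qed.

End Differences.

Lemma fpair_morph (R : numFieldType) (M M' : lmodType R) (g : M -> M') K h (u : int -> M) :
  (forall c x y, g (c *: x + y) = c *: g x + g y) -> dnil K u ->
  fpair h (fun t => g (u t)) = g (fpair h u).
Proof.
move=> gl hu.
have g0 : g 0 = 0 by rewrite -{1}(addr0 (0 : M)) -{1}(scaler0 M (-1)) gl scaleN1r addNr.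
have gZ c x : g (c *: x) = c *: g x by rewrite -[c *: x]addr0 gl g0 addr0.
have gD x y : g (x + y) = g x + g y by rewrite -[x]scale1r gl !scale1r.
have gd n : iter n (@diff R M') (fun t => g (u t)) = fun t => g (iter n (@diff R M) u t).
  elim: n => // n IH; apply: funext => t; rewrite !iterS IH /diff.
  by rewrite -scaleN1r -gZ -gD scaleN1r.
rewrite (fpairE h hu) (@fpairE _ _ K) => [|t]; last by rewrite gd hu.
by rewrite (big_morph g gD g0); apply: eq_bigr => l _; rewrite gZ gd.
Qed.

(** * Fields, normally ordered products and modes *)

Section Fields.
Variables (R : numFieldType) (W : lmodType R).

(* [fc a n] is the coefficient of [x^n] in the field [a(x) : W -> W((x))]. *)
Record fld := Fld {
  fc :> int -> W -> W;
  fcL : forall n c x y, fc n (c *: x + y) = c *: fc n x + fc n y;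
  fcT : forall w, exists B : int, forall n, n < B -> fc n w = 0 }.

Implicit Types (a b c d : fld) (w x y : W) (i j n e t : int) (k : R) (h : laurent R).

Lemma fldP a b : (forall n w, a n w = b n w) -> a = b.
Proof.
case: a b => a la ta [b lb tb] /= h.
have eg : a = b by apply: funext => n; apply: funext.
by case: b / eg lb tb h => lb tb _; congr Fld; exact: Prop_irrelevance.
Qed.

HB.instance Definition _ := gen_eqMixin fld.
HB.instance Definition _ := gen_choiceMixin fld.

Lemma fc0 a n : a n 0 = 0.
Proof. by rewrite -{1}(addr0 (0 : W)) -{1}(scaler0 W (-1)) fcL scaleN1r addNr. Qed.
Lemma fcD a n x y : a n (x + y) = a n x + a n y.
Proof. by rewrite -[x]scale1r fcL !scale1r. Qed.
Lemma fcZ a n k x : a n (k *: x) = k *: a n x.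
Proof. by rewrite -[k *: x]addr0 fcL fc0 addr0. Qed.
Lemma fcN a n x : a n (- x) = - a n x.
Proof. by rewrite -scaleN1r fcZ scaleN1r. Qed.
Lemma fcB a n x y : a n (x - y) = a n x - a n y.
Proof. by rewrite fcD fcN. Qed.
Lemma fc_sum a n (m : nat) (F : nat -> W) :
  a n (\sum_(i < m) F i) = \sum_(i < m) a n (F i).
Proof. exact: (big_morph (a n) (fcD a n) (fc0 a n)). Qed.

Program Definition fzero := @Fld (fun _ _ => 0) _ _.
Next Obligation. by rewrite scaler0 addr0. Qed.
Next Obligation. by exists 0. Qed.
Program Definition fopp a := @Fld (fun n w => - a n w) _ _.
Next Obligation. by rewrite fcL opprD scalerN. Qed.
Next Obligation. by have [B h] := fcT a w; exists B => n /h ->; rewrite oppr0. Qed.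
Program Definition fadd a b := @Fld (fun n w => a n w + b n w) _ _.
Next Obligation. by rewrite !fcL scalerDr addrACA. Qed.
Next Obligation.
have [B h] := fcT a w; have [B' h'] := fcT b w; exists (Num.min B B') => n hn.
by rewrite h ?h' ?addr0 //; lia.
Qed.
Program Definition fscale k a := @Fld (fun n w => k *: a n w) _ _.
Next Obligation. by rewrite fcL scalerDr !scalerA mulrC. Qed.
Next Obligation. by have [B h] := fcT a w; exists B => n /h ->; rewrite scaler0. Qed.

Lemma faddA : associative fadd.
Proof. by move=> a b c; apply: fldP => n w /=; rewrite addrA. Qed.
Lemma faddC : commutative fadd.
Proof. by move=> a b; apply: fldP => n w /=; rewrite addrC. Qed.
Lemma fadd0 : left_id fzero fadd.
Proof. by move=> a; apply: fldP => n w /=; rewrite add0r. Qed.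
Lemma faddN : left_inverse fzero fopp fadd.
Proof. by move=> a; apply: fldP => n w /=; rewrite addNr. Qed.
HB.instance Definition _ := GRing.isZmodule.Build fld faddA faddC fadd0 faddN.

Lemma fscaleA k k' a : fscale k (fscale k' a) = fscale (k * k') a.
Proof. by apply: fldP => n w /=; rewrite scalerA. Qed.
Lemma fscale1 : left_id 1 fscale.
Proof. by move=> a; apply: fldP => n w /=; rewrite scale1r. Qed.
Lemma fscaleDr : right_distributive fscale +%R.
Proof. by move=> k a b; apply: fldP => n w /=; rewrite scalerDr. Qed.
Lemma fscaleDl a : {morph fscale^~ a : k k' / k + k' >-> k + k'}.
Proof. by move=> k k'; apply: fldP => n w /=; rewrite scalerDl. Qed.
HB.instance Definition _ :=
  GRing.Zmodule_isLmodule.Build R fld fscaleA fscale1 fscaleDr fscaleDl.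

Lemma f0E n w : (0 : fld) n w = 0. Proof. by []. Qed.
Lemma fDE a b n w : (a + b) n w = a n w + b n w. Proof. by []. Qed.
Lemma fBE a b n w : (a - b) n w = a n w - b n w. Proof. by []. Qed.
Lemma fZE k a n w : (k *: a) n w = k *: a n w. Proof. by []. Qed.
Lemma fsumE (m : nat) (F : nat -> fld) n w :
  (\sum_(i < m) F i) n w = \sum_(i < m) F i n w.
Proof. exact: (big_morph (fun a : fld => a n w)). Qed.

Program Definition fone := @Fld (fun n w => if n == 0 then w else 0) _ _.
Next Obligation. by case: ifP => // _; rewrite scaler0 addr0. Qed.
Next Obligation. by exists 0 => n hn; rewrite lt_eqF. Qed.

Program Definition fwt (p : int -> R) a := @Fld (fun n w => p n *: a n w) _ _.
Next Obligation. by rewrite fcL scalerDr !scalerA mulrC. Qed.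
Next Obligation. by have [B h] := fcT a w; exists B => n /h ->; rewrite scaler0. Qed.

Definition fD a := fwt (fun n => n%:~R) a.

(* [fad a c t] is [x^t [a_t, c(x)]]. *)
Program Definition fad a c t := @Fld
  (fun e w => a t (c (e - t) w) - c (e - t) (a t w)) _ _.
Next Obligation. by rewrite !fcL scalerBr opprD addrACA. Qed.
Next Obligation.
have [B h] := fcT c w; have [B' h'] := fcT c (a t w).
by exists (Num.min B B' + t) => n hn; rewrite h ?h' ?fc0 ?subr0 //; lia.
Qed.

Definition fNterm a c t e w (i : int) : W :=
  if t <= i then a i (c (e - i) w) else c (e - i) (a i w).

Lemma zfin_N a c t e w : zfin (fNterm a c t e w).
Proof.
have [B h] := fcT c w; have [B' h'] := fcT a w.
exists (Num.min B' t), (Num.max (e - B + 1) t) => i hi; rewrite /fNterm.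
case: ifP => ti; first by rewrite h ?fc0 //; lia.
by rewrite h' ?fc0 //; lia.
Qed.

(** Truncation bounds depend on the vector. A normally ordered product meets only finitely many
    nonzero vectors $a_iw$ with $i<t$, so a bound uniform on finite families suffices. *)
Lemma fcT_unif a (F : nat -> W) (m : nat) :
  exists B : int, forall (i : nat) n, (i < m)%N -> n < B -> a n (F i) = 0.
Proof.
elim: m => [|m [B h]]; first by exists 0.
have [B' h'] := fcT a (F m); exists (Num.min B B') => i n.
rewrite ltnS leq_eqVlt => /orP[/eqP ->|hi] hn; first by apply: h'; lia.
by apply: h => //; lia.
Qed.

(* The normally ordered product [N_t(a, c)]. *)
Program Definition fN a c t := @Fld (fun e w => zsum (fNterm a c t e w)) _ _.
Next Obligation.
rewrite -zsumZ -?zsumD; [|exact: zfin_morph (scaler0 _ _) (zfin_N _ _ _ _ _)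
  |exact: zfin_N|exact: zfin_N].
by apply: eq_zsum => i; rewrite /fNterm; case: ifP => _; rewrite !fcL.
Qed.
Next Obligation.
have [B h] := fcT c w; have [B' h'] := fcT a w.
have [B2 h2] := fcT_unif c (fun i : nat => a (t - i%:Z) w) (absz (t - B')%R).+1.
exists (Num.min (B + t) (B2 + Num.min B' t)) => e he; apply: zsum0 => i; rewrite /fNterm.
case: ifP => ti; first by rewrite h ?fc0 //; lia.
have [hi|hi] := ltP i B'; first by rewrite h' ?fc0.
have -> : i = t - (absz (t - i)%R)%:Z by lia.
by apply: h2; lia.
Qed.

Lemma foneE n w : fone n w = if n == 0 then w else 0. Proof. by []. Qed.
Lemma fwtE p a n w : fwt p a n w = p n *: a n w. Proof. by []. Qed.
Lemma fDerE a n w : fD a n w = n%:~R *: a n w. Proof. by []. Qed.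
Lemma fadE a c t e w : fad a c t e w = a t (c (e - t) w) - c (e - t) (a t w).
Proof. by []. Qed.
Lemma fNEz a c t e w : fN a c t e w = zsum (fNterm a c t e w). Proof. by []. Qed.

#[local] Arguments fc : simpl never.

Lemma diff_fN a c : diff (fN a c) = fad a c.
Proof.
apply: funext => t; apply: fldP => e w; rewrite /diff fBE !fNEz fadE.
rewrite -zsumN -?zsumD;
  [|exact: zfin_N|exact: zfin_morph (oppr0 _) (zfin_N _ _ _ _ _)|exact: zfin_N].
rewrite (@zsum1 _ t) => [|i hi]; rewrite /fNterm.
  by rewrite lexx (_ : (t + 1 <= t) = false) //; lia.
case: (leP t i) => ti.
  by rewrite (_ : (t + 1 <= i) = true) ?subrr //; lia.
by rewrite (_ : (t + 1 <= i) = false) ?subrr //; lia.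
Qed.

Lemma fN_linl k a a' c t : fN (k *: a + a') c t = k *: fN a c t + fN a' c t.
Proof.
apply: fldP => e w; rewrite fDE fZE !fNEz -zsumZ -?zsumD;
  [|exact: zfin_morph (scaler0 _ _) (zfin_N _ _ _ _ _)|exact: zfin_N|exact: zfin_N].
by apply: eq_zsum => i; rewrite /fNterm !fDE !fZE; case: ifP => _; rewrite ?fcD ?fcZ.
Qed.

Lemma fN_linr k a c c' t : fN a (k *: c + c') t = k *: fN a c t + fN a c' t.
Proof.
apply: fldP => e w; rewrite fDE fZE !fNEz -zsumZ -?zsumD;
  [|exact: zfin_morph (scaler0 _ _) (zfin_N _ _ _ _ _)|exact: zfin_N|exact: zfin_N].
by apply: eq_zsum => i; rewrite /fNterm !fDE !fZE; case: ifP => _; rewrite ?fcD ?fcZ.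
Qed.

Lemma fD_fN a c t : fD (fN a c t) = fN (fD a) c t + fN a (fD c) t.
Proof.
apply: fldP => e w; rewrite fDE fDerE !fNEz -zsumZ -?zsumD; try exact: zfin_N.
apply: eq_zsum => i; rewrite /fNterm !fDerE; case: ifP => _;
  by rewrite ?fcZ -scalerDl -rmorphD /= (addrC i) subrK.
Qed.

Lemma fN_fone_r a t : fN a fone t = a.
Proof.
apply: fldP => e w; rewrite fNEz (@zsum1 _ e) /fNterm => [|i hi].
  by rewrite !foneE subrr eqxx; case: ifP.
by rewrite !foneE subr_eq0 eq_sym (negPf hi) fc0; case: ifP.
Qed.

Lemma fN_fone_l c t : fN fone c t = c.
Proof.
apply: fldP => e w; rewrite fNEz (@zsum1 _ 0) /fNterm => [|i hi].
  by rewrite !foneE eqxx subr0; case: ifP.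
by rewrite !foneE (negPf hi) fc0; case: ifP.
Qed.

Lemma fN_0l c t : fN 0 c t = 0.
Proof.
apply: fldP => e w; rewrite fNEz f0E zsum0 // => i.
by rewrite /fNterm !f0E fc0; case: ifP.
Qed.

Lemma fD_fone : fD fone = 0.
Proof.
apply: fldP => n w; rewrite fDerE foneE f0E; case: eqP => [->|_]; last by rewrite scaler0.
by rewrite scale0r.
Qed.

Lemma fD_lin k a b : fD (k *: a + b) = k *: fD a + fD b.
Proof.
by apply: fldP => n w; rewrite !(fDE, fDerE, fZE) scalerDr !scalerA mulrC.
Qed.

Lemma fad_linl k a a' c : fad (k *: a + a') c = fun t => k *: fad a c t + fad a' c t.
Proof.
rewrite -!diff_fN; apply: funext => t; rewrite /diff !fN_linl scalerBr opprD.
by rewrite addrACA.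
Qed.

Lemma fad_fD a c : fad (fD a) c = umul (fad a c).
Proof.
apply: funext => t; apply: fldP => e w.
by rewrite /umul fZE !fadE !fDerE fcZ scalerBr.
Qed.

(** The coefficient form of $(x_1-x_2)^K[a(x_1),c(x_2)]=0$; compare [bdiff_fad]. *)
Definition ord_loc K a c := dnil K (fad a c).
Definition loc a c := exists K, ord_loc K a c.

Lemma ord_locW K K' a c : (K <= K')%N -> ord_loc K a c -> ord_loc K' a c.
Proof. exact: dnilW. Qed.

Lemma ord_loc_fN K a c : ord_loc K a c -> dnil K.+1 (fN a c).
Proof. by move=> h t; rewrite iterSr diff_fN h. Qed.

Lemma diffn_fld m (u : int -> fld) t e w :
  iter m (@diff R fld) u t e w = iter m (@diff R W) (fun s => u s e w) t.
Proof.
elim: m t => // m IH t; rewrite !iterS /diff fBE !IH //.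
Qed.

Lemma diffn_flip m (u : int -> W) e t :
  iter m (@diff R W) (fun s => u (e - s)) t =
  (-1) ^+ m *: iter m (@diff R W) u (e - t - m%:Z).
Proof.
elim: m t => [|m IH] t; first by rewrite expr0 scale1r subr0.
rewrite !iterS !diffE !IH -scalerBr exprS mulN1r scaleNr -scalerN opprB.
rewrite (_ : e - (t + 1) - m%:Z = e - t - m.+1%:Z); last by lia.
by rewrite (_ : e - t - m.+1%:Z + 1 = e - t - m%:Z) //; lia.
Qed.

(** In the coefficient of $x^e$, exchanging the fields changes the sign and replaces $t$ by $e-t$;
    differences respect this reflection up to sign and a shift. *)
Lemma ord_loc_sym K a c : ord_loc K a c -> ord_loc K c a.
Proof.
move=> h t; apply: fldP => e w; rewrite diffn_fld f0E.
have -> : (fun s => fad c a s e w) = fun s => (fun r => - fad a c r e w) (e - s).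
  by apply: funext => s; rewrite !fadE opprB subKr.
rewrite (diffn_flip K (fun r => - fad a c r e w) e t).
have -> : (fun r => - fad a c r e w) = (fun r => (-1) *: fad a c r e w).
  by apply: funext => r; rewrite scaleN1r.
by rewrite diffnZ -diffn_fld h f0E !scaler0.
Qed.

Lemma loc_sym a c : loc a c -> loc c a.
Proof. by case=> K h; exists K; exact: ord_loc_sym. Qed.

Lemma loc2 a c a' c' : loc a c -> loc a' c' ->
  exists K, ord_loc K a c /\ ord_loc K a' c'.
Proof.
move=> [K h] [K' h']; exists (maxn K K').
by split; [apply: ord_locW h; exact: leq_maxl|apply: ord_locW h'; exact: leq_maxr].
Qed.

Lemma loc_linl k a a' c : loc a c -> loc a' c -> loc (k *: a + a') c.
Proof.
move=> h h'; have [K [H H']] := loc2 h h'; exists K; rewrite /ord_loc fad_linl.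
by apply: dnilD => //; exact: dnilZ.
Qed.

Lemma loc0 c : loc 0 c.
Proof.
exists 0%N => t /=; apply: fldP => e w; rewrite fadE !f0E fc0 subr0 //.
Qed.

Lemma locD a a' c : loc a c -> loc a' c -> loc (a + a') c.
Proof. by move=> h h'; rewrite -[a]scale1r; exact: loc_linl. Qed.

Lemma locZ k a c : loc a c -> loc (k *: a) c.
Proof. by move=> h; rewrite -[k *: a]addr0; apply: loc_linl => //; exact: loc0. Qed.

Lemma loc_suml (m : nat) (F : nat -> fld) c :
  (forall i : nat, loc (F i) c) -> loc (\sum_(i < m) F i) c.
Proof.
move=> h; elim: m => [|m IH]; first by rewrite big_ord0; exact: loc0.
by rewrite big_ord_recr; exact: locD.
Qed.

Lemma loc_fDl a c : loc a c -> loc (fD a) c.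
Proof. by case=> K h; exists K.+1; rewrite /ord_loc fad_fD; exact: dnil_umul. Qed.

Lemma loc_fDr a c : loc a c -> loc a (fD c).
Proof. by move=> /loc_sym/loc_fDl/loc_sym. Qed.

Lemma loc_fDn m a c : loc a c -> loc (iter m fD a) c.
Proof. by move=> h; elim: m => // m IH; exact: loc_fDl. Qed.

Lemma loc_fone a : loc a fone.
Proof. by exists 0%N => t /=; rewrite -diff_fN /diff !fN_fone_r subrr. Qed.

(** For $n\ge-1$ the kernel $z^n$ has at most a simple pole and can be paired. Below that, iterating
    $(Da)_nc=-n\,a_{n-1}c$ with $D=x\,d/dx$ forces $a_{-j-1}c=\frac1{j!}(D^ja)_{-1}c$. *)
Definition nprod a n c : fld :=
  match n with
  | Posz m => fpair (lX R m) (fN a c)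
  | Negz j => (j`!%:R)^-1 *: fpair (lX R (-1)) (fN (iter j fD a) c)
  end.

(** The residue of $h(z)\sum_n(a_nc)z^{-n-1}$ for a kernel with a pole of any order; it agrees with
    [fpair] on simple poles. *)
Definition fpr h a c : fld := zsum (fun n => h n *: nprod a n c).

Lemma nprod_ge a n c : -1 <= n -> nprod a n c = fpair (lX R n) (fN a c).
Proof.
case: n => [//|[|n]] h; last by lia.
by rewrite /nprod fact0 invr1 scale1r.
Qed.

Lemma nprod_ord K a c n : ord_loc K a c -> K%:Z <= n -> nprod a n c = 0.
Proof.
move=> h hn; rewrite nprod_ge; last by lia.
apply: (fpair_ord (ord_loc_fN h)); apply: ordgeW (@ordge_X R n); lia.
Qed.

Lemma zfin_fpr h a c : loc a c -> zfin (fun n => h n *: nprod a n c).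
Proof.
move=> [K hK]; have [B hB] := lcoefP h; exists B, K => n /orP[/hB ->|hn].
  by rewrite scale0r.
by rewrite (nprod_ord hK hn) scaler0.
Qed.

Lemma fpair_fpr h a c : loc a c -> ordge h (-1) -> fpair h (fN a c) = fpr h a c.
Proof.
move=> [K hK] hh; rewrite (fpair_expand (ord_loc_fN hK) hh) /fpr.
rewrite (@zsumI _ (-1) K.+1) => [|n /orP[/hh ->|hn]]; last 2 first.
- by rewrite scale0r.
- by rewrite (nprod_ord hK) ?scaler0 //; lia.
by apply: eq_bigr => n _; rewrite addrC nprod_ge //; lia.
Qed.

Lemma fN_fpr a c t : loc a c -> fN a c t = fpr (lexp (- t%:~R) * lkappa R) a c.
Proof.
move=> h; have [K hK] := h.
rewrite -fpair_fpr // ?(fpair_eval t (ord_loc_fN hK)) //.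
exact: (ordgeM (ordge_lexp _) (@ordge_lkappa R)).
Qed.

Lemma fpr_X a c n : fpr (lX R n) a c = nprod a n c.
Proof.
rewrite /fpr (@zsum1 _ n) => [|i hi]; first by rewrite lXE eqxx scale1r.
by rewrite lXE (negPf hi) scale0r.
Qed.

Lemma fprDl g h a c : loc a c -> fpr (g + h) a c = fpr g a c + fpr h a c.
Proof.
move=> ha; rewrite /fpr -zsumD; try exact: zfin_fpr.
by apply: eq_zsum => n; rewrite lcoefD scalerDl.
Qed.

Lemma fprCl k h a c : loc a c -> fpr (lC k * h) a c = k *: fpr h a c.
Proof.
move=> ha; rewrite /fpr -zsumZ; last exact: zfin_fpr.
by apply: eq_zsum => n; rewrite lcoefC scalerA.
Qed.

Lemma fprNl h a c : loc a c -> fpr (- h) a c = - fpr h a c.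
Proof. by move=> ha; rewrite -mulN1r -(lC1 R) -lCN fprCl // scaleN1r. Qed.

Lemma fpr_ord K h a c : ord_loc K a c -> ordge h K%:Z -> fpr h a c = 0.
Proof.
move=> hK hh; apply: zsum0 => n; have [hn|hn] := ltP n K%:Z.
  by rewrite hh // scale0r.
by rewrite (nprod_ord hK hn) scaler0.
Qed.

Lemma nprod_linr k a c c' n : loc a c -> loc a c' ->
  nprod a n (k *: c + c') = k *: nprod a n c + nprod a n c'.
Proof.
have aux h b : loc b c -> loc b c' ->
    fpair h (fN b (k *: c + c')) = k *: fpair h (fN b c) + fpair h (fN b c').
  move=> hc hc'; have [K [H H']] := loc2 hc hc'.
  have -> : fN b (k *: c + c') = fun t => k *: fN b c t + fN b c' t.
    by apply: funext => t; rewrite fN_linr.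
  rewrite (fpairDr _ (dnilZ k (ord_loc_fN H)) (ord_loc_fN H')).
  by rewrite (fpairZr _ _ (ord_loc_fN H)).
move=> hc hc'; case: n => n /=; first exact: aux.
by rewrite aux; [rewrite scalerDr !scalerA mulrC|exact: loc_fDn|exact: loc_fDn].
Qed.

Lemma fDn_lin m k a a' : iter m fD (k *: a + a') = k *: iter m fD a + iter m fD a'.
Proof. by elim: m => //= m ->; rewrite fD_lin. Qed.

Lemma nprod_linl k a a' c n : loc a c -> loc a' c ->
  nprod (k *: a + a') n c = k *: nprod a n c + nprod a' n c.
Proof.
have aux h b b' : loc b c -> loc b' c ->
    fpair h (fN (k *: b + b') c) = k *: fpair h (fN b c) + fpair h (fN b' c).
  move=> hc hc'; have [K [H H']] := loc2 hc hc'.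
  have -> : fN (k *: b + b') c = fun t => k *: fN b c t + fN b' c t.
    by apply: funext => t; rewrite fN_linl.
  rewrite (fpairDr _ (dnilZ k (ord_loc_fN H)) (ord_loc_fN H')).
  by rewrite (fpairZr _ _ (ord_loc_fN H)).
move=> hc hc'; case: n => n /=; first exact: aux.
by rewrite fDn_lin aux; [rewrite scalerDr !scalerA mulrC|exact: loc_fDn|exact: loc_fDn].
Qed.

(** Writing $z^m=\xi\cdot z^m\kappa$ moves a difference onto $N_t(a,c)$: products with $m\ge0$
    depend on commutators only. *)
Lemma nprod_fpairX K a c (m : nat) : ord_loc K a c ->
  nprod a m c = fpair (lX R m * lkappa R) (fad a c).
Proof.
move=> h; rewrite -diff_fN -(fpair_xi (ord_loc_fN h)).
  by rewrite /= mulrCA (mulrC (lxi R)) lkappa_xi mulr1.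
apply: (ordgeW _ (ordgeM (@ordge_X R m) (@ordge_lkappa R))); lia.
Qed.

(** Built into the definition for $n<0$. For $n\ge0$ it has content: the modes of $Da$ carry a
    factor $t$, which [fpair_umul] turns into the derivative of $z^n$. *)
Lemma nprod_fD a c n : loc a c -> nprod (fD a) n c = - (n%:~R *: nprod a (n - 1) c).
Proof.
move=> h; have [K hK] := h; case: n => [m|j].
  have [K' hK'] := loc_fDl h.
  rewrite (nprod_fpairX m hK') fad_fD (fpair_umul hK); last first.
    by apply: ordgeW (@ordge_X R m).
  case: m => [|m]; first by rewrite dL_X lC0 !mul0r fpair0l scale0r oppr0.
  rewrite dL_X -mulrA fpairCl (_ : m.+1%:Z - 1 = m); last by lia.
  by rewrite (nprod_fpairX m hK).
rewrite (_ : Negz j - 1 = Negz j.+1); last by lia.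
rewrite /nprod -iterSr -scaleNr scalerA; congr (_ *: _).
rewrite NegzE mulrNz opprK factS natrM.
have h1 : j.+1%:R != 0 :> R by rewrite pnatr_eq0.
have h2 := fact_neq0 R j.
rewrite (_ : j.+1%:~R = j.+1%:R :> R) //.
by move: (j.+1%:R : R) (j`!%:R : R) h1 h2 => x y h1 h2; field; rewrite h1 h2.
Qed.

(** Integration by parts in $z$, as $x\,d/dx$ acts on $\sum_n(a_nc)z^{-n-1}$ through $a$ as
    $d/dz$. *)
Lemma fpr_dL h a c : loc a c -> fpr (dL h) a c = - fpr h (fD a) c.
Proof.
move=> ha; rewrite /fpr -zsumN; last exact/zfin_fpr/loc_fDl.
rewrite -[LHS](@zsum_shift _ (-1)); apply: eq_zsum => n.
by rewrite nprod_fD // dLE subrK scalerN opprK !scalerA mulrC.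
Qed.

Lemma fwt_cons (p : {poly R}) k d :
  fwt (fun t => (p * 'X + k%:P).[t%:~R]) d = fwt (fun t => p.[t%:~R]) (fD d) + k *: d.
Proof.
apply: fldP => n w; by rewrite fDE fZE !fwtE hornerMXaddC scalerDl scalerA.
Qed.

(** The weight $p(n)$ on modes is $p(x\,d/dx)$, and integration by parts carries it to the
    kernel. *)
Lemma fN_fwt (p : {poly R}) d c t : loc d c ->
  fN (fwt (fun n => p.[n%:~R]) d) c t = fpr (pd p (lexp (- t%:~R) * lkappa R)) d c.
Proof.
elim/poly_ind: p d => [|p k IH] d hd.
  rewrite (_ : fwt _ d = 0).
    rewrite /pd size_poly0 big_ord0 /fpr zsum0 => [|i]; last by rewrite lcoef0 scale0r.
    exact: fN_0l.
  by apply: fldP => n w; rewrite fwtE horner0 scale0r.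
rewrite fwt_cons addrC fN_linl IH; last exact: loc_fDl.
by rewrite pd_cons fprDl // fprNl // fpr_dL // opprK fprCl // fN_fpr // addrC.
Qed.

Lemma fD_nprod a n c : loc a c ->
  fD (nprod a n c) = nprod (fD a) n c + nprod a n (fD c).
Proof.
have aux h b : loc b c ->
    fD (fpair h (fN b c)) = fpair h (fN (fD b) c) + fpair h (fN b (fD c)).
  move=> hb; have [K [H H']] := loc2 (loc_fDl hb) (loc_fDr hb).
  rewrite -(fpairDr _ (ord_loc_fN H) (ord_loc_fN H')).
  have [L hL] := hb; rewrite -(fpair_morph h fD_lin (ord_loc_fN hL)).
  by congr fpair; apply: funext => t; rewrite fD_fN.
move=> ha; case: n => [n|j] /=; first exact: aux.
rewrite -(addr0 (_ *: _)) fD_lin (_ : fD 0 = 0).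
  by rewrite aux ?addr0 ?scalerDr -?iterS -?iterSr //; exact: loc_fDn.
by apply: fldP => e w; rewrite fDerE !f0E scaler0.
Qed.

Lemma fpair_cst h (a : fld) : fpair h (fun=> a) = h (-1) *: a.
Proof.
have h1 : dnil 1 (fun=> a) by move=> t; rewrite /= /diff subrr.
by rewrite (fpairE _ h1) big_ord1 /lmu /= sub0r.
Qed.

Lemma nprod_fone_r a n : nprod a n fone =
  if n is Negz j then (j`!%:R)^-1 *: iter j fD a else 0.
Proof.
have E b : fN b fone = fun=> b by apply: funext => t; rewrite fN_fone_r.
case: n => n; rewrite /nprod E fpair_cst lXE; first by rewrite scale0r.
by rewrite scale1r.
Qed.

Lemma nprod_fone_l n c : nprod fone n c = if n == -1 then c else 0.
Proof.
have E : fN fone c = fun=> c by apply: funext => t; rewrite fN_fone_l.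
case: n => [n|[|j]]; rewrite /nprod.
- by rewrite E fpair_cst lXE scale0r.
- by rewrite E fpair_cst lXE !scale1r fact0 invr1 scale1r.
rewrite iterSr fD_fone; have -> : iter j fD 0 = 0.
  elim: j => //= j ->; apply: fldP => e w; by rewrite fDerE !f0E scaler0.
have -> : fN 0 c = fun=> 0 by apply: funext => t; rewrite fN_0l.
by rewrite fpair_cst !scaler0.
Qed.

(** Passing from $N_t$ to $N_t-N_{t+1}$ removes $\kappa$ from the kernel and leaves the power series
    $e^{-tz}$, which sees no negative products. *)
Lemma fad_modes K a c t : ord_loc K a c ->
  fad a c t = \sum_(m < K) (lexp (- t%:~R) : laurent R) m *: nprod a m c.
Proof.
move=> h; have hl : loc a c by exists K.
rewrite -diff_fN /diff !fN_fpr // -fprNl // -fprDl //.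
rewrite rmorphD opprD /= lexp_kappaB /fpr (@zsumI _ 0 K) => [|n /orP[hn|hn]].
- by apply: eq_bigr => m _; rewrite add0r.
- by rewrite ordge_lexp // scale0r.
- by rewrite (nprod_ord h) ?scaler0.
Qed.

(** Converse of [fad_modes]: once a commutator is written in the basis $(-t)^j/j!$, its coefficients
    are the nonnegative products. *)
Lemma nprod_upoly K (v : nat -> fld) a c (m : nat) : fad a c = upoly K v 1 ->
  nprod a m c = if (m < K)%N then v m else 0.
Proof.
move=> h; have hK : ord_loc K a c by rewrite /ord_loc h; exact: dnil_upoly.
rewrite (nprod_fpairX m hK) h fpair_upoly; last by apply: ordgeW (@ordge_X R m).
case: ltnP => hm.
  rewrite (bigD1 (Ordinal hm)) //= lXE eqxx scale1r big1 ?addr0 // => j hj.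
  rewrite lXE (_ : (_ == _) = false) ?scale0r //.
  by apply/eqP => e; case/eqP: hj; apply: val_inj; case: e.
rewrite big1 // => -[j hj] _; rewrite lXE (_ : (_ == _) = false) ?scale0r //=; lia.
Qed.

End Fields.

Arguments fc : simpl never.
Arguments nprod : simpl never.

(** * Dong's lemma *)

Section NilpotentOperators.
Variables (T : zmodType) (f g h : T -> T).
Hypotheses (fg : forall x, f (g x) = g (f x)) (hE : forall x, h x = f x + g x)
  (fD : forall x y, f (x + y) = f x + f y) (gD : forall x y, g (x + y) = g x + g y).

(** Nilpotency is only known on the single vector $x$. Splitting off one $h=f+g$ and inducting on
    $p+q$ replaces the binomial expansion. *)
Lemma nilp_add p q x : iter p f x = 0 -> iter q g x = 0 -> iter (p + q) h x = 0.
Proof.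
have f0 : f 0 = 0 by apply: (addrI (f 0)); rewrite -fD !addr0.
have g0 : g 0 = 0 by apply: (addrI (g 0)); rewrite -gD !addr0.
have h0 : h 0 = 0 by rewrite hE f0 g0 addr0.
have hD y z : h (y + z) = h y + h z by rewrite !hE fD gD addrACA.
have hn0 n : iter n h 0 = 0 by elim: n => // n; rewrite iterS => ->.
have hnD n y z : iter n h (y + z) = iter n h y + iter n h z.
  by elim: n => // n IH; rewrite !iterS IH hD.
have fgn n y : f (iter n g y) = iter n g (f y) by elim: n => //= n <-.
have gfn n y : g (iter n f y) = iter n f (g y) by elim: n => //= n <-.
have [N] := ubnP (p + q); elim: N p q x => // N IH [|p] [|q] x hN hf hg;
  try by rewrite -[x]/(iter 0 f x) hf hn0.
- by rewrite -[x]/(iter 0 g x) hg hn0.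
rewrite addSn iterSr hE hnD.
have -> : iter (p + q.+1) h (f x) = 0.
  by apply: IH; [rewrite addSn in hN|rewrite -iterSr|rewrite -fgn hg].
rewrite add0r addnS -addSn; apply: IH; last by rewrite -iterSr.
- by rewrite addnS in hN.
- by rewrite -gfn hf.
Qed.

End NilpotentOperators.

(** * Multiplication by a difference of formal variables, read on coefficients *)

Section ShiftDifferences.
Variables (R : numFieldType) (W : lmodType R) (I : Type).

Definition shd (f g : I -> I) (Y : I -> W) (x : I) : W := Y (f x) - Y (g x).

Lemma shdD f g (Y Z : I -> W) : shd f g (Y + Z) = shd f g Y + shd f g Z.
Proof. by apply: funext => x; rewrite /shd /= !fctE opprD addrACA. Qed.

Lemma shdnD n f g (Y Z : I -> W) :
  iter n (shd f g) (Y + Z) = iter n (shd f g) Y + iter n (shd f g) Z.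
Proof. by elim: n => // n IH; rewrite !iterS IH shdD. Qed.

Lemma shdn0 n f g : iter n (shd f g) (0 : I -> W) = 0.
Proof. by elim: n => // n IH; rewrite iterS IH; apply: funext => x; rewrite /shd subrr. Qed.

Lemma shdC f g f' g' (Y : I -> W) :
  (forall x, f (f' x) = f' (f x)) -> (forall x, f (g' x) = g' (f x)) ->
  (forall x, g (f' x) = f' (g x)) -> (forall x, g (g' x) = g' (g x)) ->
  shd f g (shd f' g' Y) = shd f' g' (shd f g Y).
Proof.
move=> h1 h2 h3 h4; apply: funext => x; rewrite /shd h1 h2 h3 h4.
by rewrite !opprB addrACA [RHS]addrACA (addrC (- Y (g' (f x)))).
Qed.

Lemma zfin_shdn n f g (B : int -> I -> W) : (forall x, zfin (B^~ x)) ->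
  forall x, zfin (fun s => iter n (shd f g) (B s) x).
Proof.
move=> h; elim: n => // n IH x; apply: zfinD; first exact: IH.
exact: (zfin_morph (g := -%R) (oppr0 _) (IH (g x))).
Qed.

Lemma shdn_zsum n f g (B : int -> I -> W) : (forall x, zfin (B^~ x)) ->
  iter n (shd f g) (fun x => zsum (B^~ x)) =
  fun x => zsum (fun s => iter n (shd f g) (B s) x).
Proof.
move=> h; elim: n => // n IH; rewrite iterS IH; apply: funext => x.
rewrite {1}/shd -zsumN -?zsumD //; try exact: zfin_shdn.
exact: (zfin_morph (g := -%R) (oppr0 _) (zfin_shdn n f g h (g x))).
Qed.

End ShiftDifferences.

Section Locality.
Variables (R : numFieldType) (W : lmodType R).
Notation fld := (@fld R W).
Implicit Types (a b c d : fld) (w : W) (i j n e t : int) (k : R) (h : laurent R).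

(** An index $(t,e,r)$ holds the threshold $t$ and the degree $e$ of $N_t(a,b)$, and the degree $r$
    of $c$. Reading $t$ and $e-t$ as degrees in $x_1$ and $x_2$, the maps [s12], [s2], [s3] raise
    the degrees in $x_1$, $x_2$, $x_3$. *)
Let I := (int * int * int)%type.
Let s12 (x : I) : I := let: (t, e, r) := x in (t + 1, e + 1, r).
Let s2 (x : I) : I := let: (t, e, r) := x in (t, e + 1, r).
Let s3 (x : I) : I := let: (t, e, r) := x in (t, e, r + 1).

(** [L] and [F] depend on $e-t$ only, which [s12] preserves, so the operator $x_1-x_3$ acts on the
    commutator of $a$ and $c$ alone. *)
Lemma shd_fad_t (n : nat) a c (L : int -> W -> W) (F : int -> W) (s : int) :
  (forall q x y, L q (x + y) = L q x + L q y) ->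
  iter n (shd s12 s3)
    (fun x : I => let: (t, e, r) := x in L (e - t) (fad a c (t + s) (t + s + r) (F (e - t)))) =
  fun x : I => let: (t, e, r) := x in
    (-1) ^+ n *: L (e - t) (iter n (@diff R fld) (fad a c) (t + s) (t + s + r + n%:Z) (F (e - t))).
Proof.
move=> LD; have L0 q : L q 0 = 0 by apply: (addrI (L q 0)); rewrite -LD !addr0.
have LN q x : L q (- x) = - L q x by apply/eqP; rewrite -addr_eq0 -LD addNr L0.
elim: n => [|n IH]; first by apply: funext => -[[t e] r]; rewrite expr0 scale1r addr0.
rewrite iterS IH; apply: funext => -[[t e] r]; rewrite /shd /= -scalerBr.
rewrite exprS mulN1r scaleNr -scalerN; congr (_ *: _).
rewrite (_ : e + 1 - (t + 1) = e - t); last by lia.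
rewrite /= diffE fBE LD LN opprB.
rewrite (_ : t + 1 + s = t + s + 1); last by lia.
rewrite (_ : t + s + 1 + r + n%:Z = t + s + r + n.+1%:Z); last by lia.
by rewrite (_ : t + s + (r + 1) + n%:Z = t + s + r + n.+1%:Z) //; lia.
Qed.

Lemma shd_fad_e (n : nat) (b : int -> fld) c (L : int -> W -> W) (F : int -> W) (p : int -> int) :
  (forall q x y, L q (x + y) = L q x + L q y) ->
  iter n (shd s2 s3)
    (fun x : I => let: (t, e, r) := x in L t (fad (b t) c (e - p t) (e - p t + r) (F t))) =
  fun x : I => let: (t, e, r) := x in
    (-1) ^+ n *: L t (iter n (@diff R fld) (fad (b t) c) (e - p t) (e - p t + r + n%:Z) (F t)).
Proof.
move=> LD; have L0 q : L q 0 = 0 by apply: (addrI (L q 0)); rewrite -LD !addr0.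
have LN q x : L q (- x) = - L q x by apply/eqP; rewrite -addr_eq0 -LD addNr L0.
elim: n => [|n IH]; first by apply: funext => -[[t e] r]; rewrite expr0 scale1r addr0.
rewrite iterS IH; apply: funext => -[[t e] r]; rewrite /shd /= -scalerBr.
rewrite exprS mulN1r scaleNr -scalerN; congr (_ *: _).
rewrite /= diffE fBE LD LN opprB.
rewrite (_ : e + 1 - p t = e - p t + 1); last by lia.
rewrite (_ : e - p t + 1 + r + n%:Z = e - p t + r + n.+1%:Z); last by lia.
by rewrite (_ : e - p t + (r + 1) + n%:Z = e - p t + r + n.+1%:Z) //; lia.
Qed.

Let shd23C (n m : nat) (Y : I -> W) :
  iter n (shd s12 s3) (iter m (shd s2 s3) Y) = iter m (shd s2 s3) (iter n (shd s12 s3) Y).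
Proof.
have C Z : shd s12 s3 (shd s2 s3 Z) = shd s2 s3 (shd s12 s3 Z).
  by apply: shdC => -[[t e] r].
elim: n => // n IH; rewrite !iterS IH.
by elim: m {IH} => // m IH; rewrite !iterS C IH.
Qed.

Let shd13C (n m : nat) (Y : I -> W) :
  iter n (shd s2 s12) (iter m (shd s2 s3) Y) = iter m (shd s2 s3) (iter n (shd s2 s12) Y).
Proof.
have C Z : shd s2 s12 (shd s2 s3 Z) = shd s2 s3 (shd s2 s12 Z).
  by apply: shdC => -[[t e] r].
elim: n => // n IH; rewrite !iterS IH.
by elim: m {IH} => // m IH; rewrite !iterS C IH.
Qed.

(* The commutator of [a(x1) b(x2)] and [c(x3)] is killed by a high power of
   [x2 - x3 = (x2 - x1) + (x1 - x3)]: after multiplication by [(x2 - x3)^K]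
   it is killed by powers of both summands. *)
Lemma loc_fN a b c t : loc a b -> loc a c -> loc b c -> loc (fN a b t) c.
Proof.
move=> hab hac hbc; have [K1 [H1 H2]] := loc2 hab hac; have [K3 H3] := hbc.
pose K := maxn K1 K3.
have {H1}Hab : ord_loc K a b by apply: ord_locW H1; exact: leq_maxl.
have {H2}Hac : ord_loc K a c by apply: ord_locW H2; exact: leq_maxl.
have {H3}Hbc : ord_loc K b c by apply: ord_locW H3; exact: leq_maxr.
exists (K.+1 + K + K)%N => e0; apply: fldP => e1 w; rewrite f0E.
pose Y (x : I) := let: (t, e, r) := x in fad (fN a b t) c e (e + r) w.
(* Modes are counted from the threshold, $i=s+t$. The choice of ordering then depends on the sign of
   $s$ only, and shifting $t$ does not mix different $s$. *)
pose B (s : int) (x : I) := let: (t, e, r) := x in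
  fNterm a b t e (c r w) (s + t) - c r (fNterm a b t e w (s + t)).
have YE (x : I) : Y x = let: (t, e, r) := x in
    fN a b t e (c r w) - c r (fN a b t e w).
  by case: x => -[t' e] r; rewrite /Y fadE (addrC e) addrK.
have Bfin (x : I) : zfin (B^~ x).
  case: x => -[t' e] r; apply: zfinD; first exact: (zfin_shift t' (zfin_N _ _ _ _ _)).
  apply: (zfin_morph (g := fun x => - c r x)); first by rewrite fc0 oppr0.
  exact: (zfin_shift t' (zfin_N _ _ _ _ _)).
have YB : Y = fun x => zsum (B^~ x).
  apply: funext => -[[t' e] r]; rewrite YE !fNEz.
  rewrite -(zsum_shift t' (fNterm a b t' e (c r w))) -(zsum_shift t' (fNterm a b t' e w)).
  have z1 v := zfin_shift t' (zfin_N a b t' e v).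
  rewrite -(zsum_morph (fcD c r) (z1 w)) -zsumN -?zsumD //.
  - by apply: (zfin_morph (g := fun x => - c r x)) => //; rewrite fc0 oppr0.
  - exact: (zfin_morph (fc0 c r) (z1 w)).
(* [shd s2 s12] is the difference in $t$, and $N_t(a,b)$ has degree at most $K$ in $t$. *)
have N1 : iter K.+1 (shd s2 s12) Y = 0.
  have -> : iter K.+1 (shd s2 s12) Y = fun x : I => let: (t, e, r) := x in
      iter K.+1 (@diff R fld) (fN a b) t (e + K.+1%:Z) (c r w) -
      c r (iter K.+1 (@diff R fld) (fN a b) t (e + K.+1%:Z) w).
    elim: K.+1 => [|n IH].
      by apply: funext => -[[t' e] r]; rewrite addr0; exact: (YE (t', e, r)).
    rewrite iterS IH; apply: funext => -[[t' e] r]; rewrite /shd /= diffE !fBE fcB.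
    rewrite (_ : e + 1 + n%:Z = e + n.+1%:Z); last by lia.
    by rewrite !opprB addrACA [RHS]addrACA [X in _ = _ + X]addrC.
  apply: funext => -[[t' e] r].
  by rewrite (ord_loc_fN Hab) !f0E fc0 subr0.
(* For each $s$ the Leibniz rule splits the commutator into a term with $[a,c]$, killed by
   $(x_1-x_3)^K$, and one with $[b,c]$, killed by $(x_2-x_3)^K$. *)
have N2 : iter K (shd s12 s3) (iter K (shd s2 s3) Y) = 0.
  rewrite YB shdn_zsum // shdn_zsum; last exact: zfin_shdn.
  apply: funext => x; apply: zsum0 => s.
  have -> : B s = (if 0 <= s then
      (fun x : I => let: (t, e, r) := x in
         (fun q y => y) (e - t) (fad a c (t + s) (t + s + r) (b (e - t - s) w))) +
      (fun x : I => let: (t, e, r) := x in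
         a (t + s) (fad b c (e - (t + s)) (e - (t + s) + r) w))
    else
      (fun x : I => let: (t, e, r) := x in
         b (e - t - s) (fad a c (t + s) (t + s + r) w)) +
      (fun x : I => let: (t, e, r) := x in
         (fun q y => y) t (fad b c (e - (t + s)) (e - (t + s) + r) (a (t + s) w)))).
    apply: funext => -[[t' e] r]; rewrite /B /fNterm.
    rewrite (_ : (t' <= s + t') = (0 <= s)); last by lia.
    case: ifP => _; rewrite /= fctE !fadE (_ : e - t' - s = e - (t' + s)); try lia;
    rewrite (_ : t' + s + r - (t' + s) = r); try lia;
    rewrite (_ : e - (t' + s) + r - (e - (t' + s)) = r); try lia;
    rewrite (addrC s) fcB ?subrKA //.
    by rewrite [RHS]addrC subrKA.
  case: ifP => _; rewrite !shdnD.
  - rewrite shd23C (@shd_fad_t K a c (fun q y => y) (fun q => b (q - s) w)) //.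
    rewrite (@shd_fad_e K (fun=> b) c (fun t => a (t + s)) (fun=> w) (fun t => t + s));
      last by move=> q; exact: fcD.
    rewrite [X in iter K _ X + _](_ : _ = 0); last first.
      by apply: funext => -[[t' e] r]; rewrite Hac f0E scaler0.
    rewrite [X in _ + iter K _ X](_ : _ = 0); last first.
      by apply: funext => -[[t' e] r]; rewrite Hbc f0E fc0 scaler0.
    by rewrite !shdn0 addr0.
  - rewrite shd23C (@shd_fad_t K a c (fun q => b (q - s)) (fun q => w));
      last by move=> q; exact: fcD.
    rewrite (@shd_fad_e K (fun=> b) c (fun t y => y) (fun t => a (t + s) w) (fun t => t + s)) //.
    rewrite [X in iter K _ X + _](_ : _ = 0); last first.
      by apply: funext => -[[t' e] r]; rewrite Hac f0E fc0 scaler0.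
    rewrite [X in _ + iter K _ X](_ : _ = 0); last first.
      by apply: funext => -[[t' e] r]; rewrite Hbc f0E scaler0.
    by rewrite !shdn0 addr0.
have N3 : iter (K.+1 + K) (shd s2 s3) (iter K (shd s2 s3) Y) = 0.
  apply: (@nilp_add _ (shd s2 s12) (shd s12 s3)) => //.
  - by move=> Z; apply: shdC => -[[t' e] r].
  - by move=> Z; apply: funext => x; rewrite fctE /shd subrKA.
  - exact: shdD.
  - exact: shdD.
  - by rewrite shd13C N1 shdn0.
move: N3; rewrite -iterD.
have -> : Y = fun x : I => let: (t, e, r) := x in
    (fun q y => y) t (fad (fN a b t) c (e - 0) (e - 0 + r) w).
  by apply: funext => -[[t' e] r]; rewrite /Y subr0.
rewrite (@shd_fad_e _ (fN a b) c (fun t y => y) (fun=> w) (fun=> 0)) //.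
set N := (K.+1 + K + K)%N.
move=> h; have {h} : (-1) ^+ N *: iter N (@diff R fld) (fad (fN a b t) c) (e0 - 0)
    (e0 - 0 + (e1 - e0 - N%:Z) + N%:Z) w = 0.
  exact: (congr1 (fun Z => Z (t, e0, e1 - e0 - N%:Z)) h).
move=> /eqP; rewrite scaler_eq0 signr_eq0 /= subr0 => /eqP.
by rewrite (_ : e0 + (e1 - e0 - N%:Z) + N%:Z = e1) //; lia.
Qed.

Lemma loc_diffn a b c (m : nat) t : loc a b -> loc a c -> loc b c ->
  loc (iter m (@diff R fld) (fN a b) t) c.
Proof.
move=> h1 h2 h3; elim: m t => [|m IH] t; first exact: loc_fN.
by rewrite iterS diffE; apply: locD => //; rewrite -scaleN1r; exact: locZ.
Qed.

Lemma loc_nprod a b c n : loc a b -> loc a c -> loc b c -> loc (nprod a n b) c.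
Proof.
have aux h a' : loc a' b -> loc a' c -> loc b c -> loc (fpair h (fN a' b)) c.
  move=> h1 h2 h3; have [K hK] := h1; rewrite (fpairE h (ord_loc_fN hK)).
  apply: (@loc_suml R W K.+1 (fun l => lmu h l *: iter l (@diff R fld) (fN a' b) 0)) => l.
  by apply/locZ/loc_diffn.
move=> h1 h2 h3; case: n => n; rewrite /nprod; first exact: aux.
by apply: locZ; apply: aux => //; exact: loc_fDn.
Qed.

End Locality.

(** * The commutator formula *)

Section AntiDifference.
Variable R : numFieldType.
Implicit Types p q : {poly R}.

Let rising (n : nat) : {poly R} := \prod_(j < n) ('X + j%:R%:P).

Let rising_sub n : rising n.+1 - (rising n.+1 \Po ('X - 1%:P)) = n.+1%:R *: rising n.
Proof.
have E : rising n.+1 \Po ('X - 1%:P) = ('X - 1%:P) * rising n.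
  rewrite /rising rmorph_prod big_ord_recl /= !rmorphD /= comp_polyX !comp_polyC addr0.
  congr (_ * _); apply: eq_bigr => j _; rewrite rmorphD /= comp_polyX comp_polyC.
  by rewrite /bump /= add1n -natr1 polyCD; ring.
by rewrite E /rising big_ord_recr /= -mul_polyC -natr1 polyCD; ring.
Qed.

Lemma antidiff q : exists p, p - (p \Po ('X - 1%:P)) = q.
Proof.
(* Multiples of a rising factorial are treated together: a factor $X$ is absorbed by $X
   r_n=r_{n+1}-n r_n$, and the backward difference of $r_{n+1}$ is $(n+1)r_n$. *)
suff [p hp] : exists p, p - (p \Po ('X - 1%:P)) = q * rising 0.
  by exists p; rewrite hp /rising big_ord0 mulr1.
elim/poly_ind: q 0%N => [|q c IH] n; first by exists 0; rewrite comp_poly0 subr0 mul0r.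
have [p1 h1] := IH n.+1; have [p2 h2] := IH n.
exists (p1 - n%:R *: p2 + (c / n.+1%:R) *: rising n.+1).
rewrite !(comp_polyD, comp_polyB, comp_polyZ).
transitivity ((p1 - (p1 \Po ('X - 1%:P))) - n%:R *: (p2 - (p2 \Po ('X - 1%:P)))
   + (c / n.+1%:R) *: (rising n.+1 - (rising n.+1 \Po ('X - 1%:P)))).
  by rewrite -!mul_polyC; ring.
rewrite h1 h2 rising_sub scalerA divfK ?pnatr_eq0 // /rising big_ord_recr /=.
by rewrite -!mul_polyC; ring.
Qed.

(** The free constant is spent on a zero at $s+t-1$, where the sums of the next section are
    empty. *)
Lemma antidiff_exp (m : nat) (s t : R) : exists p,
  p - (p \Po ('X - 1%:P)) = (m`!%:R)^-1 *: (t%:P - 'X) ^+ m /\ p.[s + t - 1] = 0.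
Proof.
have [p hp] := antidiff ((m`!%:R)^-1 *: (t%:P - 'X) ^+ m).
exists (p - p.[s + t - 1]%:P); split.
  by rewrite comp_polyB comp_polyC -hp; ring.
by rewrite hornerD hornerN hornerC subrr.
Qed.

End AntiDifference.

(** * Telescoping sums above and below a pair of thresholds *)

Section Telescope.
Variables (R : numFieldType) (q p : int -> R) (s t : int).
Hypotheses (pq : forall x, p x - p (x - 1) = q (x - t)) (p0 : p (s + t - 1) = 0).

Lemma tele_up n : \sum_(k < n) q (s + k%:Z) = p (s + t - 1 + n%:Z).
Proof.
elim: n => [|n IH]; first by rewrite big_ord0 addr0 p0.
rewrite big_ord_recr /= IH (_ : s + n%:Z = s + t - 1 + n.+1%:Z - t); last by lia.
rewrite -pq (_ : s + t - 1 + n.+1%:Z - 1 = s + t - 1 + n%:Z); last by lia.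
by rewrite addrC subrK.
Qed.

Lemma tele_down n : \sum_(k < n) q (s - n%:Z + k%:Z) = - p (s + t - 1 - n%:Z).
Proof.
elim: n => [|n IH]; first by rewrite big_ord0 subr0 p0 oppr0.
rewrite big_ord_recl /=.
rewrite (eq_bigr (fun k : 'I_n => q (s - n%:Z + k%:Z))); last first.
  by move=> k _; congr q; rewrite /bump /=; lia.
rewrite IH (_ : s - n.+1%:Z + 0 = s + t - 1 - n%:Z - t); last by lia.
rewrite -pq (_ : s + t - 1 - n%:Z - 1 = s + t - 1 - n.+1%:Z); last by lia.
by rewrite addrAC subrr add0r.
Qed.

(** The same $p$ serves the complementary region of [zsum_tele_down] with the opposite sign; this
    makes the sums in [fN_comm] recombine into one normally ordered product. *)
Lemma zsum_tele_up x : s + t <= x ->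
  zsum (fun i => if (s <= i) && (t <= x - i) then q i else 0) = p x.
Proof.
move=> hx; rewrite (@zsumI _ s (absz (x - t - s + 1)%R)) => [|i hi]; last first.
  by rewrite (_ : _ && _ = false) //; lia.
transitivity (\sum_(k < absz (x - t - s + 1)%R) q (s + k%:Z)).
  by apply: eq_bigr => -[k hk] _ /=; rewrite (_ : _ && _ = true) //; lia.
by rewrite tele_up; congr p; lia.
Qed.

Lemma zsum_tele_down x : x < s + t ->
  zsum (fun i => if (i < s) && (x - i < t) then q i else 0) = - p x.
Proof.
move=> hx; pose n := absz (s + t - 1 - x)%R.
rewrite (@zsumI _ (s - n%:Z) n) => [|i hi]; last first.
  by rewrite (_ : _ && _ = false) //; lia.
transitivity (\sum_(k < n) q (s - n%:Z + k%:Z)).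
  by apply: eq_bigr => -[k hk] _ /=; rewrite (_ : _ && _ = true) //; lia.
by rewrite tele_down; congr (- p _); lia.
Qed.

End Telescope.

Section Commutator.
Variables (R : numFieldType) (W : lmodType R).
Notation fld := (@fld R W).
Implicit Types (a b c d : fld) (w : W) (i j n e s t : int) (k : R) (h : laurent R).

Definition fN2term a b c s t e w (i j : int) : W :=
  if s <= i then a i (fNterm b c t (e - i) w j) else fNterm b c t (e - i) (a i w) j.

Lemma fN2E a b c s t e w :
  fN a (fN b c t) s e w = zsum (fun i => zsum (fN2term a b c s t e w i)).
Proof.
rewrite fNEz; apply: eq_zsum => i; rewrite /fNterm /fN2term; case: ifP => _ //.
by rewrite fNEz (zsum_morph (fcD a i)) //; exact: zfin_N.
Qed.

(** In each of the four orderings the support is bounded by truncation on $w$, and by uniform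
    truncation on the finitely many vectors $a_iw$, $b_jw$ below the thresholds. *)
Lemma zfinj_fN2 a b c s t e w : zfinj (fN2term a b c s t e w).
Proof.
have [Bc hc] := fcT c w; have [Bb hb] := fcT b w; have [Ba ha] := fcT a w.
have [B1 h1] := fcT_unif c (fun i : nat => b (t - i%:Z) w) (absz (t - Bb)%R).+1.
have [B2 h2] := fcT_unif c (fun i : nat => a (s - i%:Z) w) (absz (s - Ba)%R).+1.
have [B3 h3] := fcT_unif b (fun i : nat => a (s - i%:Z) w) (absz (s - Ba)%R).+1.
exists (Num.min (Num.min Ba s) (Num.min (Num.min Bb t) B3)).
exists (Num.max (Num.max (Num.max s t) (Num.max (e - Bc - t + 1) (e - Bc - s + 1)))
  (Num.max (e - B1 - Bb + 1) (e - B2 - Ba + 1))) => i j hij.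
rewrite /fN2term /fNterm; case: ifP => hi; case: ifP => hj.
- by rewrite hc ?fc0 //; lia.
- have [hj'|hj'] := ltP j Bb; first by rewrite hb ?fc0.
  rewrite (_ : b j w = b (t - (absz (t - j)%R)%:Z) w) ?h1 ?fc0 //; try lia.
  by congr (fc _ _ _); lia.
- have [hi'|hi'] := ltP i Ba; first by rewrite ha ?fc0.
  rewrite (_ : a i w = a (s - (absz (s - i)%R)%:Z) w) ?h2 ?fc0 //; try lia.
  by congr (fc _ _ _); lia.
- have [hi'|hi'] := ltP i Ba; first by rewrite ha ?fc0.
  rewrite (_ : a i w = a (s - (absz (s - i)%R)%:Z) w) ?h3 ?fc0 //; try lia.
  by congr (fc _ _ _); lia.
Qed.

(** In the mixed regions $a_i$ and $b_j$ stand on opposite sides of $c$ in both products, and the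
    terms cancel. *)
Lemma fN2_sub a b c s t e w i j :
  fN2term a b c s t e w i j - fN2term b a c t s e w j i =
  (if (s <= i) && (t <= j) then fad a b i (i + j) (c (e - (i + j)) w) else 0) -
  (if (i < s) && (j < t) then c (e - (i + j)) (fad a b i (i + j) w) else 0).
Proof.
rewrite /fN2term /fNterm !fadE (_ : e - i - j = e - (i + j)); last by lia.
rewrite (_ : e - j - i = e - (i + j)); last by lia.
rewrite (_ : i + j - i = j); last by lia.
have [hi|hi] := leP s i; have [hj|hj] := leP t j; rewrite /= ?subr0 ?subrr //.
by rewrite fcB opprB add0r.
Qed.

(** At fixed $x=i+j$ the commutators are polynomial in $i$ by [fad_modes], so their sum telescopes
    to $p_m(x)$ to the left of $c$ when $x\ge s+t$. When $x<s+t$ it gives $-p_m(x)$, whose sign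
    cancels that of [fN2_sub]. The result is a normally ordered product with threshold $s+t$. *)
Lemma fN_comm K a b c s t (p : nat -> int -> R) : ord_loc K a b ->
  (forall m x, p m x - p m (x - 1) = (lexp (- (x - t)%:~R) : laurent R) m) ->
  (forall m, p m (s + t - 1) = 0) ->
  fN a (fN b c t) s - fN b (fN a c s) t =
  \sum_(m < K) fN (fwt (p m) (nprod a m b)) c (s + t).
Proof.
move=> hK hp hp0; apply: fldP => e w; rewrite fBE !fN2E.
rewrite (@fsumE _ _ K (fun m => fN (fwt (p m) (nprod a m b)) c (s + t))).
rewrite (zsum_exchange (zfinj_fN2 b a c t s e w)).
have fj := zfinj_fN2 a b c s t e w; have fj' := zfinj_swap (zfinj_fN2 b a c t s e w).
have fjB : zfinj (fun i j => fN2term a b c s t e w i j - fN2term b a c t s e w j i).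
  case: fj => l [u H]; case: fj' => l' [u' H'].
  exists (Num.min l l'), (Num.max u u') => i j hij.
  by rewrite H ?H' ?subr0 //; lia.
rewrite -zsumN -?zsumD; try exact: zfinj_zsum; last first.
  exact: (zfin_morph (g := -%R) (oppr0 _) (zfinj_zsum fj')).
transitivity (zsum (fun i => zsum (fun x =>
    fN2term a b c s t e w i (x - i) - fN2term b a c t s e w (x - i) i))).
  apply: eq_zsum => i; have z1 := zfinj_row i fj; have z2 := zfinj_row i fj'.
  rewrite -zsumN // -zsumD //; last exact: (zfin_morph (g := -%R) (oppr0 _) z2).
  by rewrite -[LHS](@zsum_shift _ (- i)).
rewrite (zsum_exchange (zfinj_shear fjB)).
transitivity (zsum (fun x => \sum_(m < K) fNterm (fwt (p m) (nprod a m b)) c (s + t) e w x));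
  last by rewrite (@zsum_sum _ K (fun m => fNterm (fwt (p m) (nprod a m b)) c (s + t) e w))
    // => m; exact: zfin_N.
apply: eq_zsum => x.
transitivity (zsum (fun i =>
    (if (s <= i) && (t <= x - i) then fad a b i x (c (e - x) w) else 0) -
    (if (i < s) && (x - i < t) then c (e - x) (fad a b i x w) else 0))).
  by apply: eq_zsum => i; rewrite fN2_sub (_ : i + (x - i) = x) //; lia.
have finq m (P : pred int) : (exists l u : int, forall i, P i -> l <= i < u) ->
    zfin (fun i => if P i then (lexp (- i%:~R) : laurent R) (Posz m) else 0).
  by case=> l [u H]; exists l, u => i hi; case: ifP => // /H; lia.
have [hx|hx] := leP (s + t) x.
  transitivity (zsum (fun i => \sum_(m < K) (if (s <= i) && (t <= x - i)
      then (lexp (- i%:~R) : laurent R) m else 0) *: nprod a m b x (c (e - x) w))).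
    apply: eq_zsum => i; rewrite (_ : (i < s) && _ = false) ?subr0; last by lia.
    case: ifP => _; last by rewrite big1 // => m _; rewrite scale0r.
    rewrite (fad_modes _ hK).
    by rewrite (@fsumE _ _ K (fun m => (lexp (- i%:~R) : laurent R) (Posz m) *: nprod a m b)).
  rewrite (@zsum_sum _ K (fun m i => (if (s <= i) && (t <= x - i)
      then (lexp (- i%:~R) : laurent R) m else 0) *: nprod a m b x (c (e - x) w))).
    apply: eq_bigr => m _; rewrite /fNterm hx fwtE.
    rewrite (zsum_morph (g := fun y => y *: nprod a m b x (c (e - x) w))).
    - by rewrite (zsum_tele_up (q := fun i => (lexp (- i%:~R) : laurent R) m) (hp m) (hp0 m)).
    - by move=> y z; rewrite scalerDl.
    - by apply: finq; exists s, (x - t + 1) => i; lia.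
  move=> m; apply: (zfin_morph (g := fun y => y *: nprod a m b x (c (e - x) w))).
    by rewrite scale0r.
  by apply: finq; exists s, (x - t + 1) => i; lia.
transitivity (zsum (fun i => \sum_(m < K) (if (i < s) && (x - i < t)
    then (lexp (- i%:~R) : laurent R) m else 0) *: - c (e - x) (nprod a m b x w))).
  apply: eq_zsum => i; rewrite (_ : (s <= i) && _ = false) ?sub0r; last by lia.
  case: ifP => _; last by rewrite oppr0 big1 // => m _; rewrite scale0r.
  rewrite (fad_modes _ hK).
  rewrite (@fsumE _ _ K (fun m => (lexp (- i%:~R) : laurent R) (Posz m) *: nprod a m b)).
  rewrite (fc_sum c (e - x) K (fun m => ((lexp (- i%:~R) : laurent R) m *: nprod a m b) x w)).
  by rewrite -sumrN; apply: eq_bigr => m _; rewrite fZE fcZ scalerN.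
rewrite (@zsum_sum _ K (fun m i => (if (i < s) && (x - i < t)
    then (lexp (- i%:~R) : laurent R) m else 0) *: - c (e - x) (nprod a m b x w))).
  apply: eq_bigr => m _; rewrite /fNterm leNgt hx /= fwtE fcZ.
  rewrite (zsum_morph (g := fun y => y *: - c (e - x) (nprod a m b x w))).
  - rewrite (zsum_tele_down (q := fun i => (lexp (- i%:~R) : laurent R) m) (hp m) (hp0 m)) //.
    by rewrite scalerN scaleNr opprK.
  - by move=> y z; rewrite scalerDl.
  - by apply: finq; exists (x - t), s => i; lia.
move=> m; apply: (zfin_morph (g := fun y => y *: - c (e - x) (nprod a m b x w))).
  by rewrite scale0r.
by apply: finq; exists (x - t), s => i; lia.
Qed.

Lemma loc_fN_r a b c t : loc a b -> loc a c -> loc b c -> loc a (fN b c t).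
Proof. by move=> h1 h2 h3; apply/loc_sym/loc_fN => //; exact: loc_sym. Qed.

Lemma loc_nprod_r a b c n : loc a b -> loc a c -> loc b c -> loc a (nprod b n c).
Proof. by move=> h1 h2 h3; apply/loc_sym/loc_nprod => //; exact: loc_sym. Qed.

(** For $g=z^n$ and $h=z^s$ this is the usual formula, since $\frac1{m!}g^{(m)}=\binom nm z^{n-m}$.
    In this form it is bilinear in the kernels and can be checked on exponentials. *)
Definition comm_kernel K a b c (g h : laurent R) :=
  fpr g a (fpr h b c) - fpr h b (fpr g a c) =
  \sum_(m < K) fpr (lC (m`!%:R)^-1 * iter m (@dL R) g * h) (nprod a m b) c.

Notation ek t := (lexp (- t%:~R) * lkappa R).

(** For these kernels every pairing on the left is a normally ordered product. [fN_comm] computes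
    the commutator, [fN_fwt] moves its weights to the kernel, and [pd_telescope] recognises the
    result. *)
Lemma comm_kernel_exp K a b c s t : ord_loc K a b -> loc a c -> loc b c ->
  comm_kernel K a b c (ek s) (ek t).
Proof.
move=> hK hac hbc; have hab : loc a b by exists K.
rewrite /comm_kernel -(fN_fpr t hbc) -(fN_fpr s hac) -fN_fpr; last exact: loc_fN_r.
rewrite -fN_fpr; last by apply: loc_fN_r => //; exact: loc_sym.
have /choice[p hp] := fun m => antidiff_exp m (s%:~R : R) (t%:~R : R).
rewrite (@fN_comm K a b c s t (fun m x => (p m).[x%:~R])) //.
- apply: eq_bigr => m _; rewrite fN_fwt; last exact: loc_nprod.
  by rewrite rmorphD /= (pd_telescope (hp m).1 (hp m).2).
- move=> m x; have /(congr1 (fun r => r.[x%:~R])) := (hp m).1.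
  rewrite hornerD hornerN horner_comp hornerXsubC hornerZ horner_exp hornerD hornerN.
  by rewrite hornerC hornerX !rmorphB /= => ->; rewrite lexpE opprB mulrC.
- by move=> m; rewrite rmorphB rmorphD /= (hp m).2.
Qed.

(** Inductive, so that bilinear extension of the commutator formula is an induction. *)
Inductive espan : laurent R -> Prop :=
| espan_exp t : espan (ek t)
| espan_add g h : espan g -> espan h -> espan (g + h)
| espan_scale k h : espan h -> espan (lC k * h).

Lemma espan_shift h : espan h -> espan (lexp (-1) * h).
Proof.
elim=> [t|f g _ hf _ hg|k f _ hf].
- rewrite mulrA -lexpD -opprD (_ : 1 + t%:~R = (1 + t)%:~R :> R); last by rewrite rmorphD.
  exact: espan_exp.
- by rewrite mulrDr; exact: espan_add.
- by rewrite mulrCA; exact: espan_scale.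
Qed.

Lemma espan_kxi m : espan (lkappa R * lxi R ^+ m).
Proof.
elim: m => [|m IH].
  rewrite expr0 mulr1 -[lkappa R]mul1r -(lexp0 R) -oppr0 -(mulr0z (1 : R)).
  exact: espan_exp.
have -> : lkappa R * lxi R ^+ m.+1 =
    lkappa R * lxi R ^+ m + lC (-1) * (lexp (-1) * (lkappa R * lxi R ^+ m)).
  by rewrite exprS lCN lC1 {1}/lxi; ring.
by apply: espan_add => //; apply/espan_scale/espan_shift.
Qed.

(** Approximation is as good as membership, because locality makes kernels of high order pair to
    zero. *)
Lemma espan_approx (L : nat) n : -1 <= n ->
  exists g, espan g /\ ordge (lX R n - g) (L%:Z - 1).
Proof.
move=> hn; have hX : ordge (lX R n) (-1) by apply: ordgeW (@ordge_X R n).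
exists (\sum_(k < L) lC (lmu (lX R n) k) * (lkappa R * lxi R ^+ k)); split.
  elim: L => [|L IH].
    rewrite big_ord0 -(mul0r (lkappa R)) -(lC0 R) -(mulr1 (lkappa R)) -(expr0 (lxi R)).
    exact/espan_scale/espan_kxi.
  by rewrite big_ord_recr; apply: espan_add => //; exact/espan_scale/espan_kxi.
by rewrite {1}(lrem_sum (lX R n) L) addrK; exact: ordge_lrem.
Qed.

Lemma fpr_linr h k a c c' : loc a c -> loc a c' ->
  fpr h a (k *: c + c') = k *: fpr h a c + fpr h a c'.
Proof.
move=> hc hc'; rewrite /fpr -zsumZ -?zsumD; try exact: zfin_fpr.
  by apply: eq_zsum => n; rewrite nprod_linr // scalerDr !scalerA mulrC.
exact: (zfin_morph (g := fun x => k *: x) (scaler0 _ _) (zfin_fpr h hc)).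
Qed.

Lemma loc_espan a b c h : espan h -> loc a b -> loc a c -> loc b c -> loc a (fpr h b c).
Proof.
move=> hh hab hac hbc; elim: hh => [t|f g _ hf _ hg|k f _ hf].
- by rewrite -fN_fpr //; exact: loc_fN_r.
- by rewrite fprDl //; apply: loc_sym; apply: locD; exact: loc_sym.
- by rewrite fprCl //; apply: loc_sym; apply: locZ; exact: loc_sym.
Qed.

Lemma dLnDl m (g g' h : laurent R) k : lC k * iter m (@dL R) (g + g') * h =
  lC k * iter m (@dL R) g * h + lC k * iter m (@dL R) g' * h.
Proof. by rewrite dLnD; ring. Qed.

Lemma comm_kernel_espan K a b c g h : ord_loc K a b -> loc a c -> loc b c ->
  espan g -> espan h -> comm_kernel K a b c g h.
Proof.
move=> hK hac hbc; have hab : loc a b by exists K.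
have hba := loc_sym hab.
have hd m : loc (nprod a m b) c by exact: loc_nprod.
have fpr_D f a' x y : loc a' x -> loc a' y -> fpr f a' (x + y) = fpr f a' x + fpr f a' y.
  by move=> hx hy; rewrite -[x]scale1r fpr_linr // !scale1r.
have fpr_Z f a' k x : loc a' x -> fpr f a' (k *: x) = k *: fpr f a' x.
  move=> hx; rewrite -[k *: x]addr0 fpr_linr //; last exact/loc_sym/loc0.
  rewrite [fpr f a' 0](_ : _ = 0) ?addr0 //.
  rewrite -[0 as X in fpr f a' X](scale0r x) -[0 *: x]addr0 fpr_linr ?scale0r ?add0r //;
    last exact/loc_sym/loc0.
  have := fpr_D f a' 0 0 (loc_sym (loc0 _)) (loc_sym (loc0 _)).
  by rewrite addr0 => /eqP; rewrite -subr_eq0 opprD addrA subrr sub0r oppr_eq0 => /eqP.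
move=> hg; elim: hg h => {g} [s|g g' eg IH eg' IH'|k g eg IH] h hh.
- elim: hh => [t|f f' ef IH ef' IH'|k f ef IH].
  + exact: comm_kernel_exp.
  + rewrite /comm_kernel !fprDl //; last by apply: loc_espan => //; exact: espan_exp.
    rewrite fpr_D; try exact: loc_espan.
    rewrite opprD addrACA IH IH' -big_split; apply: eq_bigr => m _.
    by rewrite mulrDr fprDl.
  + rewrite /comm_kernel !fprCl //; last by apply: loc_espan => //; exact: espan_exp.
    rewrite fpr_Z; try exact: loc_espan.
    rewrite -scalerBr IH scaler_sumr; apply: eq_bigr => m _.
    by rewrite mulrCA fprCl.
- rewrite /comm_kernel !fprDl //; last exact: loc_espan.
  rewrite fpr_D; try exact: loc_espan.
  rewrite opprD addrACA IH // IH' // -big_split; apply: eq_bigr => m _.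
  by rewrite dLnDl fprDl.
- rewrite /comm_kernel !fprCl //; last exact: loc_espan.
  rewrite fpr_Z; try exact: loc_espan.
  rewrite -scalerBr IH // scaler_sumr; apply: eq_bigr => m _.
  rewrite dLnC (_ : lC (m`!%:R)^-1 * (lC k * _) * h =
    lC k * (lC (m`!%:R)^-1 * iter m (@dL R) g * h)) ?fprCl //.
  by ring.
Qed.

(** * From kernels to modes, with arbitrary integer indices *)

Definition zbin (n : int) (m : nat) : R := (\prod_(j < m) (n%:~R - j%:R)) / (m`!)%:R.

Lemma zbinS n m : m.+1%:R * zbin n m.+1 = (n%:~R - m%:R) * zbin n m.
Proof.
rewrite /zbin big_ord_recr /= factS natrM invfM.
have h1 : m.+1%:R != 0 :> R by rewrite pnatr_eq0.
move: (m.+1%:R : R) h1 (m`!%:R^-1 : R) (\prod_(i < m) _) => x hx y z.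
by field.
Qed.

Lemma zbin_pred n m : m.+1%:R * zbin n m.+1 = n%:~R * zbin (n - 1) m.
Proof.
rewrite /zbin big_ord_recl /= subr0 factS natrM invfM.
have h1 : m.+1%:R != 0 :> R by rewrite pnatr_eq0.
rewrite (eq_bigr (fun i : 'I_m => (n - 1)%:~R - i%:R)); last first.
  by move=> i _; rewrite /bump /= add1n -natr1 rmorphB /=; ring.
move: (m.+1%:R : R) h1 (m`!%:R^-1 : R) (\prod_(i < m) _) => x hx y z.
by field.
Qed.

Lemma zbin0 n : zbin n 0 = 1.
Proof. by rewrite /zbin big_ord0 fact0 divr1. Qed.

Definition comm_formula K a b c n s :=
  nprod a n (nprod b s c) - nprod b s (nprod a n c) =
  \sum_(m < K) zbin n m *: nprod (nprod a m b) (n + s - m%:Z) c.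

Lemma ord_loc_fam (F : nat -> fld) c (K : nat) : (forall m, loc (F m) c) ->
  exists L, forall m, (m < K)%N -> ord_loc L (F m) c.
Proof.
move=> h; elim: K => [|K [L hL]]; first by exists 0%N.
have [L' hL'] := h K; exists (maxn L L') => m; rewrite ltnS leq_eqVlt => /orP[/eqP ->|hm].
  by apply: ord_locW hL'; exact: leq_maxr.
by apply: ord_locW (hL _ hm); exact: leq_maxl.
Qed.

(** $z^n$ and $z^s$ are replaced by approximants from [espan] close enough that no pairing in the
    formula changes. *)
Lemma comm_formula_ge K a b c n s : ord_loc K a b -> loc a c -> loc b c ->
  -1 <= n -> -1 <= s -> comm_formula K a b c n s.
Proof.
move=> hK hac hbc hn hs; have hab : loc a b by exists K.
have hba := loc_sym hab.
set x := nprod b s c; set y := nprod a n c.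
have hax : loc a x by exact: loc_nprod_r.
have hby : loc b y by exact: loc_nprod_r.
have hd m : loc (nprod a m b) c by exact: loc_nprod.
have [L1 [o1 o2]] := loc2 hbc hby; have [L2 [o3 o4]] := loc2 hac hax.
have [L3 o5] := ord_loc_fam K hd.
(* Room for all the locality orders, for up to $K-1$ derivatives and for a simple pole. *)
pose L := (maxn (maxn L1 L2) L3 + K + 3)%N.
have [g [eg og]] := espan_approx L hn; have [h [eh oh]] := espan_approx L hs.
have approx (f : laurent R) N a' z (M : nat) : ord_loc M a' z -> (M <= maxn L1 L2)%N ->
    ordge (lX R N - f) (L%:Z - 1) -> fpr f a' z = nprod a' N z.
  move=> hM hle of_; have hl : loc a' z by exists M.
  rewrite -fpr_X; apply/esym/eqP; rewrite -subr_eq0 -fprNl // -fprDl //; apply/eqP.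
  by apply: (fpr_ord hM); apply: ordgeW of_; rewrite /L; lia.
have := comm_kernel_espan hK hac hbc eg eh; rewrite /comm_kernel.
rewrite (approx h s b c L1) ?leq_maxl // (approx g n a c L2) ?leq_maxr //.
rewrite -/x -/y (approx h s b y L1) ?leq_maxl // (approx g n a x L2) ?leq_maxr //.
rewrite /comm_formula -/x -/y => ->; apply: eq_bigr => -[m hm] _ /=.
have -> : zbin n m *: nprod (nprod a m b) (n + s - m%:Z) c =
    fpr (lC (m`!%:R)^-1 * iter m (@dL R) (lX R n) * lX R s) (nprod a m b) c.
  rewrite dLn_X (_ : _ * lX R s = lC (zbin n m) * lX R (n + s - m%:Z)).
    by rewrite fprCl // fpr_X.
  rewrite (_ : n + s - m%:Z = (n - m%:Z) + s); last by lia.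
  by rewrite (lXD R (n - m%:Z) s) /zbin lCM; ring.
apply/esym/eqP; rewrite -subr_eq0 -fprNl // -fprDl //; apply/eqP.
apply: (fpr_ord (o5 _ hm)).
have hX : ordge (lX R n) (-1) by apply: ordgeW (@ordge_X R n).
have ohh : ordge h (-1).
  have -> : h = lX R s - (lX R s - h) by rewrite subKr.
  apply: ordgeD; first by apply: ordgeW (@ordge_X R s).
  by apply: ordgeN; apply: ordgeW oh; rewrite /L; lia.
rewrite (_ : _ - _ = lC (m`!%:R)^-1 * (iter m (@dL R) (lX R n) * (lX R s - h) +
    iter m (@dL R) (lX R n - g) * h)); last by rewrite dLnD dLnN; ring.
apply/ordgeC/ordgeD.
  by apply: ordgeW (ordgeM (ordge_dLn (m := m) hX) oh); rewrite /L; lia.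
by apply: ordgeW (ordgeM (ordge_dLn (m := m) og) ohh); rewrite /L; lia.
Qed.

Lemma nprod_0l n c : nprod 0 n c = 0.
Proof.
have h : loc (0 : fld) c := loc0 c.
have := nprod_linl 1 n h h; rewrite scale1r addr0 scale1r => /eqP.
by rewrite -subr_eq0 opprD addrA subrr sub0r oppr_eq0 => /eqP.
Qed.

Lemma nprod_0r n a : nprod a n 0 = 0.
Proof.
have h : loc a 0 := loc_sym (loc0 a).
have := nprod_linr 1 n h h; rewrite scale1r addr0 scale1r => /eqP.
by rewrite -subr_eq0 opprD addrA subrr sub0r oppr_eq0 => /eqP.
Qed.

Lemma nprodZr k n a c : loc a c -> nprod a n (k *: c) = k *: nprod a n c.
Proof.
move=> h; rewrite -[k *: c]addr0 nprod_linr // ?nprod_0r ?addr0 //.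
exact/loc_sym/loc0.
Qed.

Lemma nprodZl k n a c : loc a c -> nprod (k *: a) n c = k *: nprod a n c.
Proof.
by move=> h; rewrite -[k *: a]addr0 nprod_linl // ?nprod_0l ?addr0 //; exact: loc0.
Qed.

Lemma ord_loc_fDl K a c : ord_loc K a c -> ord_loc K.+1 (fD a) c.
Proof. by move=> h; rewrite /ord_loc fad_fD; exact: dnil_umul. Qed.

(** All modes of $Da$ are $-n\,a_{n-1}$. On the right the term $m=0$ drops out, as $(Da)_0b=0$, and
    the shifted sum matches through [zbin_pred]; dividing by $n$ requires $n\ne0$. *)
Lemma comm_formula_fDl K a b c n s : ord_loc K a b -> loc a c -> loc b c -> n != 0 ->
  comm_formula K.+1 (fD a) b c n s -> comm_formula K a b c (n - 1) s.
Proof.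
move=> hK hac hbc n0; have hab : loc a b by exists K.
have hd m : loc (nprod a m b) c by exact: loc_nprod.
rewrite /comm_formula nprod_fD; last exact: loc_nprod_r.
rewrite nprod_fD // -!scaleNr nprodZr; last by apply: loc_nprod_r => //; exact: loc_sym.
rewrite -scalerBr big_ord_recl nprod_fD // scale0r oppr0 nprod_0l scaler0 add0r.
move=> /(congr1 (fun v => (- n%:~R)^-1 *: v)); rewrite scalerA mulVf ?oppr_eq0 ?intr_eq0 //.
rewrite scale1r => ->; rewrite scaler_sumr; apply: eq_bigr => m _; rewrite lift0.
rewrite nprod_fD // (_ : m.+1%:Z - 1 = m); last by lia.
rewrite -scaleNr nprodZl // !scalerA (_ : n + s - m.+1%:Z = n - 1 + s - m%:Z); last by lia.
congr (_ *: _); rewrite (_ : zbin n m.+1 * _ = - n%:~R * zbin (n - 1) m).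
  by rewrite mulrA mulVf ?mul1r // oppr_eq0 intr_eq0.
by rewrite mulNr -zbin_pred mulrN mulrC.
Qed.

Lemma comm_formulaW K K' a b c n s : ord_loc K a b -> (K <= K')%N ->
  comm_formula K a b c n s <-> comm_formula K' a b c n s.
Proof.
move=> hK hle; rewrite /comm_formula.
rewrite (big_ord_widen _ (fun m => zbin n m *: nprod (nprod a m b) (n + s - m%:Z) c) hle).
rewrite big_mkcond /=.
suff -> : \sum_(m < K') (if (m < K)%N then zbin n m *: nprod (nprod a m b) (n + s - m%:Z) c
    else 0) = \sum_(m < K') zbin n m *: nprod (nprod a m b) (n + s - m%:Z) c by [].
apply: eq_bigr => m _; case: ltnP => // hm.
by rewrite (nprod_ord hK) ?nprod_0l ?scaler0 //; lia.
Qed.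

(** Here $a_m(Db)=D(a_mb)+m\,a_{m-1}b$ yields two sums, merged by [zbinS]: $-(n+s-m)\binom
    nm+(n-m)\binom nm=-s\binom nm$. *)
Lemma comm_formula_fDr K a b c n s : ord_loc K a b -> ord_loc K a (fD b) ->
  loc a c -> loc b c -> s != 0 ->
  comm_formula K.+1 a (fD b) c n s -> comm_formula K a b c n (s - 1).
Proof.
move=> hK hK' hac hbc s0 H; apply/(comm_formulaW _ _ _ hK (leqnSn K)).
have hab : loc a b by exists K.
have hd m : loc (nprod a m b) c by exact: loc_nprod.
have A : nprod a n (nprod (fD b) s c) = - s%:~R *: nprod a n (nprod b (s - 1) c).
  by rewrite nprod_fD // -scaleNr nprodZr //; exact: loc_nprod_r.
have B : nprod (fD b) s (nprod a n c) = - s%:~R *: nprod b (s - 1) (nprod a n c).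
  by rewrite nprod_fD ?scaleNr //; apply: loc_nprod_r => //; exact: loc_sym.
move: H; rewrite /comm_formula A B -scalerBr => /(congr1 (fun v => (- s%:~R)^-1 *: v)).
rewrite scalerA mulVf ?oppr_eq0 ?intr_eq0 // scale1r => ->.
have E m : nprod a (Posz m) (fD b) =
    fD (nprod a m b) + m%:R *: nprod a (m%:Z - 1) b.
  by rewrite fD_nprod // nprod_fD // -pmulrn addrAC addNr add0r.
have T m : nprod (nprod a (Posz m) (fD b)) (n + s - m%:Z) c =
   - ((n + s - m%:Z)%:~R *: nprod (nprod a m b) (n + (s - 1) - m%:Z) c) +
   m%:R *: nprod (nprod a (m%:Z - 1) b) (n + s - m%:Z) c.
  rewrite E addrC nprod_linl ?nprod_fD //; last exact: loc_fDl.
  by rewrite addrC (_ : n + s - m%:Z - 1 = n + (s - 1) - m%:Z) //; lia.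
under eq_bigr => m _ do rewrite T scalerDr.
rewrite big_split /= [X in _ + X]big_ord_recl scale0r scaler0 add0r.
rewrite [X in _ + X](eq_bigr (fun m : 'I_K => ((n%:~R - m%:R) * zbin n m) *:
    nprod (nprod a m b) (n + (s - 1) - m%:Z) c)); last first.
  move=> m _; rewrite lift0 scalerA mulrC zbinS (_ : m.+1%:Z - 1 = m); last by lia.
  by rewrite (_ : n + s - m.+1%:Z = n + (s - 1) - m%:Z) //; lia.
have -> : \sum_(m < K) ((n%:~R - m%:R) * zbin n m) *:
     nprod (nprod a m b) (n + (s - 1) - m%:Z) c =
   \sum_(m < K.+1) ((n%:~R - m%:R) * zbin n m) *:
     nprod (nprod a m b) (n + (s - 1) - m%:Z) c.
  by rewrite big_ord_recr /= (nprod_ord hK) ?nprod_0l ?scaler0 ?addr0.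
rewrite -big_split scaler_sumr; apply: eq_bigr => m _ /=.
rewrite scalerN -scaleNr scalerA -scalerDl scalerA; congr (_ *: _).
rewrite rmorphB rmorphD /= -pmulrn.
rewrite (_ : - zbin n m * (n%:~R + s%:~R - m%:R) + (n%:~R - m%:R) * zbin n m =
  - s%:~R * zbin n m); last by ring.
by rewrite mulrA mulVf ?mul1r // oppr_eq0 intr_eq0.
Qed.

(** From indices at least $-1$, first $n$ and then $s$ is lowered. The fields are generalised in
    both inductions, since each step trades $a$ or $b$ for its derivative. *)
Theorem nprod_comm K a b c n s : ord_loc K a b -> loc a c -> loc b c ->
  comm_formula K a b c n s.
Proof.
have step1 (N : nat) : forall K a b c n s, ord_loc K a b -> loc a c -> loc b c ->
    - (N%:Z + 1) <= n -> -1 <= s -> comm_formula K a b c n s.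
  elim: N => [|N IH] {}K {}a {}b {}c {}n {}s hK hac hbc hn hs.
    exact: comm_formula_ge.
  have [hn'|hn'] := leP (- (N%:Z + 1)) n; first exact: IH.
  have -> : n = (n + 1) - 1 by lia.
  apply: comm_formula_fDl => //; first by lia.
  by apply: IH => //; [exact: ord_loc_fDl|exact: loc_fDl|lia].
have step2 (N : nat) : forall K a b c n s, ord_loc K a b -> loc a c -> loc b c ->
    - (N%:Z + 1) <= s -> comm_formula K a b c n s.
  elim: N => [|N IH] {}K {}a {}b {}c {}n {}s hK hac hbc hs.
    by apply: (step1 (absz n)) => //; lia.
  have [hs'|hs'] := leP (- (N%:Z + 1)) s; first exact: IH.
  have hab : loc a b by exists K.
  have [K' [h1 h2]] := loc2 hab (loc_fDr hab).
  pose M := maxn K K'.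
  have hM : ord_loc M a b by apply: ord_locW hK; exact: leq_maxl.
  apply/(comm_formulaW _ _ _ hK (leq_maxl K K')); rewrite -/M.
  have -> : s = (s + 1) - 1 by lia.
  have hM' : ord_loc M a (fD b) by apply: ord_locW h2; exact: leq_maxr.
  apply: comm_formula_fDr => //; first by lia.
  by apply: IH => //; [exact: (ord_locW (leqnSn _))|exact: loc_fDl|lia].
by move=> *; apply: (step2 (absz s)) => //; lia.
Qed.

End Commutator.

(** * Submodules and associativity *)

Definition submod_pred (R : numFieldType) (U : lmodType R) (P : U -> Prop) :=
  P 0 /\ forall k x y, P x -> P y -> P (k *: x + y).

Section SubModule.
Variables (R : numFieldType) (U : lmodType R) (P : U -> Prop) (hP : submod_pred P).

(* The closure proof is a parameter of the type so that the module structure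
   below is canonical. *)
Record smod (h : submod_pred P) := SMod { sval_ :> U; svalP_ : P sval_ }.

Notation smodP := (smod hP).
Implicit Types x y : smodP.

Lemma smod_inj x y : (x : U) = y -> x = y.
Proof.
case: x y => x px [y py] /= e; case: y / e py => py.
by congr SMod; exact: Prop_irrelevance.
Qed.

HB.instance Definition _ := gen_eqMixin (smod hP).
HB.instance Definition _ := gen_choiceMixin (smod hP).

Let pD (x y : U) : P x -> P y -> P (x + y).
Proof. by move=> px py; rewrite -[x]scale1r; exact: hP.2. Qed.
Let pZ k (x : U) : P x -> P (k *: x).
Proof. by move=> px; rewrite -[k *: x]addr0; apply: hP.2 => //; exact: hP.1. Qed.

Definition szero : smodP := @SMod hP 0 hP.1.
Definition sadd x y : smodP := @SMod hP ((x : U) + (y : U)) (pD (svalP_ x) (svalP_ y)).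
Definition sscale k x : smodP := @SMod hP (k *: (x : U)) (pZ k (svalP_ x)).
Definition sopp x : smodP := sscale (-1) x.

Lemma saddA : associative sadd.
Proof. by move=> x y z; apply: smod_inj; rewrite /= addrA. Qed.
Lemma saddC : commutative sadd.
Proof. by move=> x y; apply: smod_inj; rewrite /= addrC. Qed.
Lemma sadd0 : left_id szero sadd.
Proof. by move=> x; apply: smod_inj; rewrite /= add0r. Qed.
Lemma saddN : left_inverse szero sopp sadd.
Proof. by move=> x; apply: smod_inj; rewrite /= scaleN1r addNr. Qed.
HB.instance Definition _ := GRing.isZmodule.Build (smod hP) saddA saddC sadd0 saddN.

Lemma sscaleA k k' x : sscale k (sscale k' x) = sscale (k * k') x.
Proof. by apply: smod_inj; rewrite /= scalerA. Qed.
Lemma sscale1 : left_id 1 sscale.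
Proof. by move=> x; apply: smod_inj; rewrite /= scale1r. Qed.
Lemma sscaleDr : right_distributive sscale +%R.
Proof. by move=> k x y; apply: smod_inj; rewrite /= scalerDr. Qed.
Lemma sscaleDl x : {morph sscale^~ x : k k' / k + k' >-> k + k'}.
Proof. by move=> k k'; apply: smod_inj; rewrite /= scalerDl. Qed.
HB.instance Definition _ :=
  GRing.Zmodule_isLmodule.Build R (smod hP) sscaleA sscale1 sscaleDr sscaleDl.

Lemma svalD x y : sval_ (x + y) = sval_ x + sval_ y. Proof. by []. Qed.
Lemma svalN x : sval_ (- x) = - sval_ x. Proof. by rewrite /= scaleN1r. Qed.
Lemma svalB x y : sval_ (x - y) = sval_ x - sval_ y. Proof. by rewrite svalD svalN. Qed.
Lemma svalZ k x : sval_ (k *: x) = k *: sval_ x. Proof. by []. Qed.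
Lemma sval0 : sval_ (0 : smodP) = 0. Proof. by []. Qed.

End SubModule.

(** * Powers of $x_1-x_2$ and of $e^z-1$ on coefficients *)

Section BinomialDifferences.
Variables (R : numFieldType) (W : lmodType R).

(** The coefficient of $x_1^ax_2^b$ in $(x_1-x_2)^kF$, in a shape convertible with [prod_coef]. *)
Definition bdiff k (F : int -> int -> W) (a b : int) : W :=
  \sum_(p < k.+1) ('C(k, p)%:R * (-1 : R) ^+ (k - p)) *: F (a - p%:Z) (b - k%:Z + p%:Z).

Lemma bdiffS k F a b : bdiff k.+1 F a b = bdiff k F (a - 1) b - bdiff k F a (b - 1).
Proof.
pose c (k l : nat) : R := 'C(k, l)%:R * (-1) ^+ (k - l).
pose X (l : nat) := F (a - l%:Z) (b - k.+1%:Z + l%:Z).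
have -> : bdiff k.+1 F a b = \sum_(l < k.+2) c k.+1 l *: X l by [].
have -> : bdiff k F (a - 1) b = \sum_(l < k.+1) c k l *: X l.+1.
  by apply: eq_bigr => l _; congr (_ *: F _ _); lia.
have -> : bdiff k F a (b - 1) = \sum_(l < k.+2) c k l *: X l.
  rewrite [RHS]big_ord_recr /= /c bin_small // mul0r scale0r addr0.
  by apply: eq_bigr => l _; congr (_ *: F _ _); lia.
rewrite big_ord_recl [X in _ = _ - X]big_ord_recl opprD addrCA; congr (_ + _).
  by rewrite -scaleNr /c !bin0 !subn0 exprS !mul1r mulN1r.
rewrite -sumrB; apply: eq_bigr => -[l hl] _; rewrite lift0 /= -scalerBl; congr (_ *: _).
rewrite /c binS subSS natrD mulrDl addrC; congr (_ + _).
move: hl; rewrite ltnS leq_eqVlt => /orP[/eqP ->|hl].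
  by rewrite bin_small // !mul0r oppr0.
by rewrite -(subnSK hl) exprS mulN1r mulrN.
Qed.

Lemma diffn_bdiff k (u : int -> W) (p : int) :
  iter k (@diff R W) u (p - k%:Z) = bdiff k (fun s _ => u s) p 0.
Proof.
have E n (x y z : int) : bdiff n (fun s _ => u s) x y = bdiff n (fun s _ => u s) x z by [].
elim: k p => [|k IH] p.
  by rewrite /bdiff big_ord1 bin0 expr0 mulr1 scale1r !subr0.
rewrite iterS diffE bdiffS (E k p _ 0) -!IH.
rewrite (_ : p - k.+1%:Z = p - 1 - k%:Z); last by lia.
by rewrite (_ : p - 1 - k%:Z + 1 = p - k%:Z) //; lia.
Qed.

Lemma dnil_trunc K (u : int -> W) (B : int) : dnil K u ->
  (forall t, t < B -> u t = 0) -> forall t, u t = 0.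
Proof.
elim: K u B => [|K IH] u B h hB; first by move=> t; have := h t.
have d0 t : diff u t = 0.
  apply: (IH _ (B - 1)) => [s|s hs]; first by rewrite -iterSr h.
  by rewrite diffE !hB ?subr0 //; lia.
have step t : u t = u (t + 1) by apply/eqP; rewrite -subr_eq0 -diffE d0.
move=> t; have [/hB //|hBt] := ltP t B.
have -> : t = B - 1 + (absz (t - B + 1)%R)%:Z by lia.
elim: (absz _) => [|n IHn]; first by rewrite addr0 hB //; lia.
by rewrite (_ : B - 1 + n.+1%:Z = B - 1 + n%:Z + 1) -?step //; lia.
Qed.

(** $(x_2e^z-x_2)^k$ in the associativity axiom is $x_2^k$ times the $k$-th power of this series. *)
Definition leps : laurent R := lexp 1 - 1.

Lemma ordge_leps : ordge leps 1.
Proof.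
case=> [[|n]|n] // _; rewrite lcoefB lcoef1 ?lexpE //=.
- by rewrite expr0 fact0 divr1 subrr.
- by rewrite ordge_lexp // subr0.
Qed.

Lemma lead_leps : leps 1 = 1.
Proof. by rewrite lcoefB lcoef1 lexpE subr0 expr1 (_ : 1`!%:R = 1 :> R) // divr1. Qed.

Lemma lexp_nat n : lexp (1 : R) ^+ n = lexp n%:R.
Proof. by elim: n => [|n IH]; rewrite ?lexp0 // exprS IH -lexpD nat1r. Qed.

Lemma leps_exp k :
  leps ^+ k = \sum_(p < k.+1) lC ('C(k, p)%:R * (-1 : R) ^+ (k - p)) * lexp p%:R.
Proof.
rewrite /leps addrC exprDn; apply: eq_bigr => -[p hp] _ /=.
rewrite lexp_nat lCM -mulr_natl -!mulrA; congr (_ * (_ * _)).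
  elim: ('C(k, p)) => [|n IH]; first by rewrite lC0.
  by rewrite -!natr1 lCD lC1 IH.
by elim: (k - p)%N => [|n IH]; rewrite ?expr0 ?lC1 // !exprS lCM IH lCN lC1.
Qed.

(** Extracting the coefficient of $z^q$ is pairing with $z^{-q-1}$. If $q+M+1<0$, the range given by
    [absz] is meaningless and the guard empties the sum. *)
Lemma window_sum (y : int -> W) (M q : int) (p : nat) : (forall n, M <= n -> y n = 0) ->
  \sum_(j < absz (q + M + 1) | j%:Z < q + M + 1)
     ((j`!%:R)^-1 * p%:R ^+ j) *: y (j%:Z - q - 1) =
  zsum (fun n => (lX R (- q - 1) * lexp p%:R) n *: y n).
Proof.
move=> hy; have [h0|h0] := leP 0 (q + M + 1); last first.
  rewrite big_pred0 => [|j]; last by lia.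
  rewrite zsum0 // => n; rewrite lcoefX; have [hn|hn] := ltP (n - (- q - 1)) 0.
    by rewrite ordge_lexp ?scale0r.
  by rewrite hy ?scaler0 //; lia.
rewrite (@zsumI _ (- q - 1) (absz (q + M + 1)%R)) => [|n /orP[hn|hn]]; last 2 first.
- by rewrite lcoefX ordge_lexp ?scale0r //; lia.
- by rewrite hy ?scaler0 //; lia.
rewrite /zint [LHS]big_mkcond /=; apply: eq_bigr => -[j hj] _ /=.
rewrite (_ : (j%:Z < _) = true); last by lia.
rewrite lcoefX (_ : - q - 1 + j%:Z - (- q - 1) = j); last by lia.
by rewrite lexpE mulrC (_ : - q - 1 + j%:Z = j%:Z - q - 1) //; lia.
Qed.

Lemma zfin_pairing (h : laurent R) (y : int -> W) (M : int) :
  (forall n, M <= n -> y n = 0) -> zfin (fun n => h n *: y n).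
Proof.
move=> hy; have [B hB] := lcoefP h; exists B, M => n /orP[/hB ->|/hy ->].
  by rewrite scale0r.
by rewrite scaler0.
Qed.

Lemma window_bdiff k (y : int -> W) (M q : int) : (forall n, M <= n -> y n = 0) ->
  \sum_(p < k.+1) ('C(k, p)%:R * (-1 : R) ^+ (k - p)) *:
   \sum_(j < absz (q + M + 1) | j%:Z < q + M + 1)
     ((j`!%:R)^-1 * p%:R ^+ j) *: y (j%:Z - q - 1) =
  zsum (fun n => (lX R (- q - 1) * leps ^+ k) n *: y n).
Proof.
move=> hy.
pose G (p : nat) := lC ('C(k, p)%:R * (-1 : R) ^+ (k - p)) * (lX R (- q - 1) * lexp p%:R).
transitivity (\sum_(p < k.+1) zsum (fun n => G p n *: y n)).
  apply: eq_bigr => p _; rewrite (window_sum q p hy) -zsumZ; last exact: zfin_pairing hy.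
  by apply: eq_zsum => n; rewrite /G lcoefC scalerA.
rewrite -(@zsum_sum _ k.+1 (fun p n => G p n *: y n)); last first.
  by move=> p; exact: zfin_pairing hy.
apply: eq_zsum => n; rewrite -scaler_suml -lcoef_sum; congr (lcoef _ _ *: _).
by rewrite leps_exp mulr_sumr; apply: eq_bigr => p _; rewrite /G; ring.
Qed.

(** The system is triangular: $z^{-q-1}(e^z-1)^k$ starts with $z^{k-q-1}$, so $q=k-n-1$ isolates
    $y_n$ once the later values are known to vanish. *)
Lemma leps_pairing_inj k (y : int -> W) (M : int) : (forall n, M <= n -> y n = 0) ->
  (forall q, zsum (fun n => (lX R (- q - 1) * leps ^+ k) n *: y n) = 0) ->
  forall n, y n = 0.
Proof.
move=> hM h n; suff H (N : nat) : forall n, M - N%:Z <= n -> y n = 0.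
  by apply: (H (absz (M - n)%R)); lia.
elim: N => [|N IH] {}n hn; first by apply: hM; lia.
have [/IH //|hn'] := leP (M - N%:Z) n.
have o : ordge (lX R (- (k%:Z - n - 1) - 1) * leps ^+ k) n.
  by apply: ordgeW (ordgeM (@ordge_X R _) (ordge_exp (k := k) ordge_leps)); lia.
have := h (k%:Z - n - 1); rewrite (@zsum1 _ n) => [|i hi].
  have := leadM (@ordge_X R (- (k%:Z - n - 1) - 1)) (ordge_exp (k := k) ordge_leps).
  have E : - (k%:Z - n - 1) - 1 + k%:Z * 1 = n by lia.
  by rewrite (lead_exp _ ordge_leps) lead_leps expr1n lXE eqxx E => ->; rewrite mulr1 scale1r.
have [hi'|hi'] := ltP i n; first by rewrite o ?scale0r.
by rewrite IH ?scaler0 //; lia.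
Qed.

End BinomialDifferences.

Section Associativity.
Variables (R : numFieldType) (W : lmodType R).
Notation fld := (@fld R W).
Implicit Types (a b c d : fld) (w : W) (n e t : int) (h : laurent R).

Lemma fpr_eval h a c e w : loc a c ->
  fpr h a c e w = zsum (fun n => h n *: nprod a n c e w).
Proof.
move=> ha; rewrite /fpr -(zsum_morph (g := fun b : fld => b e w)) //.
exact: zfin_fpr.
Qed.

(** The kernel has order $k-q-1\ge k$. *)
Lemma fpr_leps_neg k a c (q : int) : ord_loc k a c -> q < 0 ->
  fpr (lX R (- q - 1) * leps R ^+ k) a c = 0.
Proof.
move=> hk hq; apply: (fpr_ord hk).
by apply: ordgeW (ordgeM (@ordge_X R _) (ordge_exp (k := k) (@ordge_leps R))); lia.
Qed.

Lemma fpr_suml (m : nat) (F : nat -> laurent R) a c : loc a c ->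
  fpr (\sum_(i < m) F i) a c = \sum_(i < m) fpr (F i) a c.
Proof.
move=> ha; elim: m => [|m IH]; last by rewrite !big_ord_recr fprDl // IH.
by rewrite !big_ord0 /fpr zsum0 // => n; rewrite lcoef0 scale0r.
Qed.

(* [z^-1] differs from [kappa] by a power series, which pairs to zero after
   multiplication by [(exp z - 1)^k]; so [z^(-q-1)] may be replaced by a
   derivative of [kappa], for which the pairing is a normally ordered product. *)
Lemma fpr_leps k a c (q : nat) : ord_loc k a c ->
  fpr (lX R (- q%:Z - 1) * leps R ^+ k) a c =
  (q`!%:R)^-1 *: \sum_(l < k.+1) ('C(k, l)%:R * (-1) ^+ (k - l)) *:
     fN (fwt (fun n => (n + l%:Z)%:~R ^+ q) a) c (- l%:Z).
Proof.
move=> hk; have ha : loc a c by exists k.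
pose g := lX R (-1) - lkappa R.
have og : ordge g 0.
  move=> n hn; have [hn'|hn'] := ltP n (-1).
    by rewrite lcoefB (@ordge_X R (-1)) // (@ordge_lkappa R) // subr0.
  by rewrite (_ : n = -1) ?lcoefB ?lXE ?lead_lkappa ?subrr //; lia.
have fq := fact_neq0 R q.
(* The $q$-th derivative of $z^{-1}$ is $(-1)^qq!\,z^{-q-1}$. *)
pose s : R := (-1) ^+ q / q`!%:R.
have Xq : lX R (- q%:Z - 1) = lC s * iter q (@dL R) (lX R (-1)).
  rewrite dLn_X mulrA -lCM (_ : -1 - q%:Z = - q%:Z - 1); last by lia.
  rewrite (_ : s * _ = 1) ?lC1 ?mul1r //.
  rewrite (_ : \prod_(j < q) _ = (-1) ^+ q * q`!%:R).
    by rewrite /s mulrACA -expr2 sqrr_sign mul1r mulVf.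
  elim: q {fq s} => [|q IH]; first by rewrite big_ord0 mul1r.
  rewrite big_ord_recr /= IH factS natrM exprS -natr1 -[(-1)%:~R]/(-1 : R); ring.
have sgn2 : (-1 : R) ^+ q * (-1) ^+ q = 1 by rewrite -expr2 sqrr_sign.
have -> : lX R (- q%:Z - 1) * leps R ^+ k =
    lC s * iter q (@dL R) (lkappa R) * leps R ^+ k + lC s * iter q (@dL R) g * leps R ^+ k.
  rewrite Xq (_ : lX R (-1) = lkappa R + g); last by rewrite /g addrC subrK.
  by rewrite dLnD; ring.
rewrite fprDl // [X in _ + X](fpr_ord hk) ?addr0; last first.
  have := ordgeM (ordgeC s (@ordge_dLn0 R q g og)) (ordge_exp (k := k) (@ordge_leps R)).
  by apply: ordgeW; lia.
have -> : lC s * iter q (@dL R) (lkappa R) * leps R ^+ k =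
    \sum_(l < k.+1) lC (s * ('C(k, l)%:R * (-1) ^+ (k - l))) *
      (lexp l%:R * iter q (@dL R) (lkappa R)).
  by rewrite leps_exp mulr_sumr; apply: eq_bigr => l _; rewrite [lC (s * _)]lCM; ring.
rewrite (@fpr_suml _ (fun l => lC (s * ('C(k, l)%:R * (-1) ^+ (k - l))) *
      (lexp l%:R * iter q (@dL R) (lkappa R)))) // scaler_sumr.
apply: eq_bigr => l _; rewrite fprCl // scalerA.
(* By [pd_expr] this kernel is $p(-d/dz)(e^{lz}\kappa)$ with $p=(-l-X)^q$: threshold $-l$ and weight
   $(-1)^q(n+l)^q$. *)
have -> : fpr (lexp l%:R * iter q (@dL R) (lkappa R)) a c =
    (-1) ^+ q *: fN (fwt (fun n => (n + l%:Z)%:~R ^+ q) a) c (- l%:Z).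
  pose p : {poly R} := ((- l%:R)%:P - 'X) ^+ q.
  have := fN_fwt p (- l%:Z) ha; rewrite /p pd_expr mulrNz !opprK mulrA -lexpD addNr lexp0.
  rewrite mul1r => <-; rewrite -[RHS]addr0 -(fN_0l c (- l%:Z)) -fN_linl addr0.
  congr (fN _ c _); apply: fldP => n w; rewrite fZE !fwtE scalerA; congr (_ *: _).
  rewrite horner_exp hornerD hornerN hornerC hornerX -opprD [LHS]exprNn rmorphD /= addrC.
  by rewrite -pmulrn.
rewrite scalerA; congr (_ *: _); rewrite /s.
by rewrite [LHS](_ : _ = ((-1) ^+ q * (-1) ^+ q) * (q`!%:R^-1 * ('C(k, l)%:R * (-1) ^+ (k - l))));
  [rewrite sgn2 mul1r|ring].
Qed.

Lemma bdiff_fad k a c w (p p' : int) :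
  iter k (@diff R fld) (fad a c) (p - k%:Z) (p + p' - k%:Z) w =
  bdiff k (fun i j => a i (c j w)) p p' - bdiff k (fun i j => c j (a i w)) p p'.
Proof.
rewrite diffn_fld diffn_bdiff -sumrB; apply: eq_bigr => l _.
rewrite -scalerBr fadE; congr (_ *: _).
by rewrite (_ : p + p' - k%:Z - (p - l%:Z) = p' - k%:Z + l%:Z) //; lia.
Qed.

Lemma bdiff_loc k a c w (p p' : int) : ord_loc k a c ->
  bdiff k (fun i j => a i (c j w)) p p' = bdiff k (fun i j => c j (a i w)) p p'.
Proof. by move=> hk; apply/eqP; rewrite -subr_eq0 -bdiff_fad hk f0E. Qed.

(** With $e$ fixed, the $k$-th difference of the commutator is polynomial in $t$ by locality of some
    order, and by truncation it vanishes for very negative $t$; hence it is zero. Uniqueness needs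
    this, as there $k$ comes from another module structure. *)
Lemma ord_loc_trunc k a c : loc a c ->
  (forall w, exists N : int, forall p p', p < N ->
     bdiff k (fun i j => a i (c j w)) p p' = 0) -> ord_loc k a c.
Proof.
move=> [K hK] h t; apply: fldP => e w; rewrite diffn_fld f0E.
have [N hN] := h w; have [B hB] := fcT a w.
apply: (@dnil_trunc _ _ K _ (Num.min N B - k%:Z)) => {t} t.
  by rewrite -iterD -diffn_fld (ord_locW (leq_addr k K) hK) f0E.
move=> ht; rewrite -diffn_fld (_ : t = t + k%:Z - k%:Z); last by lia.
rewrite (_ : e = t + k%:Z + (e - t) - k%:Z); last by lia.
rewrite bdiff_fad hN ?sub0r; last by lia.
rewrite /bdiff big1 ?oppr0 // => l _; rewrite hB ?fc0 ?scaler0 //; lia.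
Qed.

(** With $p=i+l$ the thresholds $-l$ all become $p\ge0$, so whole binomial differences appear. For
    $p<0$ they have the factors in the other order, which locality reverses. *)
Lemma fpr_leps_subst k a c (q : nat) (e : int) w : ord_loc k a c ->
  fpr (lX R (- q%:Z - 1) * leps R ^+ k) a c (e - k%:Z) w =
  (q`!%:R)^-1 *: zsum (fun p => p%:~R ^+ q *: bdiff k (fun i j => a i (c j w)) p (e - p)).
Proof.
move=> hk; rewrite fpr_leps // fZE; congr (_ *: _).
rewrite (@fsumE _ _ k.+1 (fun l => ('C(k, l)%:R * (-1) ^+ (k - l)) *:
     fN (fwt (fun n => (n + l%:Z)%:~R ^+ q) a) c (- l%:Z))).
pose G (l : nat) (p : int) : W := ('C(k, l)%:R * (-1 : R) ^+ (k - l)) *: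
  fNterm (fwt (fun n => (n + l%:Z)%:~R ^+ q) a) c (- l%:Z) (e - k%:Z) w (p - l%:Z).
have Gfin l : zfin (G l).
  apply: (zfin_morph (scaler0 _ _)).
  exact: (zfin_shift (- l%:Z) (zfin_N (fwt (fun n => (n + l%:Z)%:~R ^+ q) a) c (- l%:Z) (e - k%:Z) w)).
transitivity (\sum_(l < k.+1) zsum (G l)).
  apply: eq_bigr => l _; rewrite fZE fNEz /G zsumZ; last first.
    exact: (zfin_shift (- l%:Z) (zfin_N (fwt (fun n => (n + l%:Z)%:~R ^+ q) a) c (- l%:Z) (e - k%:Z) w)).
  by rewrite (zsum_shift (- l%:Z) (fNterm (fwt (fun n => (n + l%:Z)%:~R ^+ q) a) c (- l%:Z) (e - k%:Z) w)).
rewrite -zsum_sum //; apply: eq_zsum => p.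
have [hp|hp] := leP 0 p; last rewrite bdiff_loc //.
all: rewrite /bdiff scaler_sumr; apply: eq_bigr => l _; rewrite /G /fNterm.
  rewrite (_ : (- l%:Z <= p - l%:Z) = true); last by lia.
  rewrite fwtE subrK (_ : e - k%:Z - (p - l%:Z) = e - p - k%:Z + l%:Z); last by lia.
  by rewrite !scalerA mulrC.
rewrite (_ : (- l%:Z <= p - l%:Z) = false); last by lia.
rewrite fwtE subrK (_ : e - k%:Z - (p - l%:Z) = e - p - k%:Z + l%:Z); last by lia.
by rewrite fcZ !scalerA mulrC.
Qed.

End Associativity.

(** * Generating fields, the vacuum module and the vertex algebra *)

Section LinearMaps.
Variables (U V : lmodType C) (f : U -> V) (hf : islin f).

Lemma islin0 : f 0 = 0.
Proof. by rewrite -{1}(addr0 (0 : U)) -{1}(scaler0 U (-1)) hf scaleN1r addNr. Qed.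
Lemma islinD x y : f (x + y) = f x + f y.
Proof. by rewrite -[x]scale1r hf !scale1r. Qed.
Lemma islinZ k x : f (k *: x) = k *: f x.
Proof. by rewrite -[k *: x]addr0 hf islin0 addr0. Qed.
Lemma islinN x : f (- x) = - f x.
Proof. by rewrite -scaleN1r islinZ scaleN1r. Qed.
Lemma islinB x y : f (x - y) = f x - f y.
Proof. by rewrite islinD islinN. Qed.
Lemma islin_sum n (F : nat -> U) : f (\sum_(i < n) F i) = \sum_(i < n) f (F i).
Proof. exact: (big_morph f islinD islin0). Qed.

End LinearMaps.

Section GeneratingFields.
Variable W : lmodType C.
Implicit Types (A B : int -> int -> W -> W) (l : C) (m r n s i e : int) (w : W).

Definition gen_ok A := (forall m n, islin (A m n)) /\
  forall m w, exists N : int, forall n, N <= n -> A m n w = 0.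

Lemma tz_nz A m n w : nz m n -> tz A m n w = A m n w.
Proof. by rewrite /tz => ->. Qed.

Lemma tz_lin A m n : (forall m n, islin (A m n)) -> islin (tz A m n).
Proof.
move=> hA a x y; rewrite /tz; case: ifP => _; first exact: hA.
by rewrite scaler0 addr0.
Qed.

Program Definition genf A (hA : gen_ok A) m : fld W :=
  @Fld _ W (fun n w => tz A m (- n) w) _ _.
Next Obligation. by apply: tz_lin; exact: hA.1. Qed.
Next Obligation.
have [N hN] := hA.2 m w; exists (1 - N) => n hn; rewrite /tz.
by case: ifP => // _; apply: hN; lia.
Qed.

Lemma genfE A (hA : gen_ok A) m n w : genf hA m n w = tz A m (- n) w.
Proof. by []. Qed.

Definition bracket A B l l' := forall m n r s w, nz m n -> nz r s ->
  A m n (B r s w) - B r s (A m n w) =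
    (n * r - m * s)%:~R *: tz A (m + r) (n + s) w
    + (kd (m + r) 0 * kd (n + s) 0 * (m%:~R * l + n%:~R * l')) *: w.

(* The relations stay valid with the zero operators in degree [(0, 0)]. *)
Lemma tz_bracket A B l l' m n r s w : gen_ok A -> gen_ok B -> bracket A B l l' ->
  tz A m n (tz B r s w) - tz B r s (tz A m n w) =
    (n * r - m * s)%:~R *: tz A (m + r) (n + s) w
    + (kd (m + r) 0 * kd (n + s) 0 * (m%:~R * l + n%:~R * l')) *: w.
Proof.
move=> hA hB hAB.
have nz0 x y : nz x y = false -> x = 0 /\ y = 0.
  by rewrite /nz => /negbT; rewrite negb_or !negbK => /andP[/eqP -> /eqP ->].
have tz0 X : tz X 0 0 =1 (fun=> 0 : W) by move=> v; rewrite /tz /nz !eqxx.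
have l0 X x y : gen_ok X -> tz X x y 0 = 0.
  by move=> hX; exact: islin0 (tz_lin x y hX.1).
case h1: (nz m n); last first.
  have [-> ->] := nz0 _ _ h1; rewrite !tz0 (l0 B) // subrr !mul0r subrr scale0r.
  by rewrite addr0 mulr0 scale0r addr0.
case h2: (nz r s); last first.
  have [-> ->] := nz0 _ _ h2; rewrite !tz0 (l0 A) // subrr !mulr0 subrr scale0r add0r.
  rewrite /kd !addr0; move: h1; rewrite /nz.
  case: (m == 0) => /=; last by rewrite !mul0r scale0r.
  by case: (n == 0) => // _; rewrite mulr0 mul0r scale0r.
by rewrite !(tz_nz _ _ h1, tz_nz _ _ h2) hAB.
Qed.

(** The products $(A_m)_0B_r$ and $(A_m)_1B_r$. The bracket has degree at most one in the mode of
    $A_m$ at fixed total degree, so no higher product survives. *)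
Definition gen_ope A (hA : gen_ok A) l l' m r (j : nat) : fld W :=
  if j == 0%N then m%:~R *: fD (genf hA (m + r)) + (m%:~R * kd (m + r) 0 * l) *: fone W
  else (m + r)%:~R *: genf hA (m + r) + (kd (m + r) 0 * l') *: fone W.

Lemma fad_gen A B (hA : gen_ok A) (hB : gen_ok B) l l' m r : bracket A B l l' ->
  fad (genf hA m) (genf hB r) = upoly 2 (gen_ope hA l l' m r) 1.
Proof.
move=> hAB; apply: funext => i; apply: fldP => e w; rewrite fadE !genfE.
rewrite (tz_bracket _ _ _ _ _ hA hB hAB) /upoly big_ord_recl big_ord1 /gen_ope /=.
rewrite !mulr1 !lexpE expr0 expr1 fact0 (_ : 1`!%:R = 1) // !divr1 scale1r.
rewrite !(fDE, fZE) fDerE foneE !genfE (_ : - i - (e - i) = - e); last by lia.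
have -> : kd (- e) 0 = if e == 0 then 1 else 0 by rewrite /kd oppr_eq0.
case: eqP => [->|_].
  rewrite oppr0 !mulr1 !scale0r scaler0 add0r !scalerDr !scalerA.
  rewrite !add0r addrCA -scalerDl; congr (_ *: _ + _ *: _).
    by rewrite !(rmorphB, rmorphM, rmorphN, rmorphD) /=; ring.
  by rewrite rmorphN /=; ring.
rewrite !mulr0 !mul0r !scale0r !scaler0 !addr0 !scalerA -scalerDl; congr (_ *: _).
by rewrite !(rmorphB, rmorphM, rmorphN, rmorphD) /=; ring.
Qed.

Lemma ord_loc_gen A B (hA : gen_ok A) (hB : gen_ok B) l l' m r : bracket A B l l' ->
  ord_loc 2 (genf hA m) (genf hB r).
Proof. by move=> hAB; rewrite /ord_loc (fad_gen _ _ _ _ hAB); exact: dnil_upoly. Qed.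

(** The commutator formula with two terms. The derivative in the first contributes $-m(n+s)$, the
    second $n(m+r)$, with sum $nr-ms$; the identity field has only its mode $-1$, whence the two
    delta factors. *)
Lemma nprod_gen A B (hA : gen_ok A) (hB : gen_ok B) l l' m r n s c :
  bracket A B l l' -> loc (genf hA m) c -> loc (genf hB r) c ->
  loc (genf hA (m + r)) c ->
  nprod (genf hA m) n (nprod (genf hB r) s c) -
  nprod (genf hB r) s (nprod (genf hA m) n c) =
    (n * r - m * s)%:~R *: nprod (genf hA (m + r)) (n + s - 1) c
    + (m%:~R * kd (m + r) 0 * kd (n + s + 1) 0 * l
       + n%:~R * kd (m + r) 0 * kd (n + s) 0 * l') *: c.
Proof.
move=> hAB h1 h2 h3.
have := nprod_comm n s (ord_loc_gen hA hB m r hAB) h1 h2; rewrite /comm_formula => ->.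
rewrite big_ord_recl big_ord1 zbin0 scale1r /= subr0.
have f1 : loc (fone W) c by exact/loc_sym/loc_fone.
rewrite !(nprod_upoly _ (fad_gen hA hB m r hAB)) /= /gen_ope /=.
have -> : zbin C n 1 = n%:~R.
  by have := zbinS C n 0; rewrite zbin0 subr0 mulr1 mul1r.
rewrite !nprod_linl //; try exact: locZ; try exact: loc_fDl.
rewrite !nprodZl // nprod_fD // !nprod_fone_l.
rewrite (_ : (n + s == -1) = (n + s + 1 == 0)); last by lia.
rewrite (_ : (n + s - 1 == -1) = (n + s == 0)); last by lia.
rewrite /kd scalerN -scaleNr !scalerA scalerDr !scalerA addrACA -scalerDl.
congr (_ *: _ + _).
  by rewrite -!rmorphM -rmorphN -rmorphM -rmorphD /=; congr (_%:~R); ring.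
rewrite scalerDl; congr (_ + _).
  by case: (n + s + 1 == 0); rewrite ?mulr1 ?mulr0 ?mul0r ?scale0r ?scaler0.
by case: (n + s == 0); rewrite ?mulr1 ?mulr0 ?mul0r ?scale0r ?scaler0 ?mulrA.
Qed.

End GeneratingFields.

Section VacuumModule.
Variables (l1 l2 l3 l4 : C) (V : lmodType C) (TV EV : int -> int -> V -> V) (vac : V).
Hypothesis HV : vacuum_module l1 l2 l3 l4 TV EV vac.

(* [P] cuts out a submodule containing the vacuum, into which the universal
   property maps [V]; by uniqueness the composite with the inclusion is [id]. *)
Lemma vacuum_ind (P : V -> Prop) : submod_pred P -> P vac ->
  (forall m n v, P v -> P (TV m n v)) -> (forall m n v, P v -> P (EV m n v)) ->
  forall v, P v.
Proof.
move=> hP pv pT pE; have [hM [hvac univ]] := HV.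
pose S := smod hP.
pose TS m n (x : S) : S := @SMod _ _ _ hP _ (pT m n _ (svalP_ x)).
pose ES m n (x : S) : S := @SMod _ _ _ hP _ (pE m n _ (svalP_ x)).
pose vS : S := @SMod _ _ _ hP _ pv.
have [lT [lE [b1 [b2 b3]]]] := hM.
have hS : Lhat_module l1 l2 l3 l4 TS ES.
  do !split.
  - by move=> m n a x y; apply: smod_inj; rewrite svalD svalZ /= lT.
  - by move=> m n a x y; apply: smod_inj; rewrite svalD svalZ /= lE.
  - by move=> m n r s x; apply: smod_inj; rewrite svalB /= b1.
  - by move=> m n r s x; apply: smod_inj; rewrite svalB svalD !svalZ /= b2.
  - by move=> m n r s x; apply: smod_inj; rewrite svalB svalD !svalZ /= b3.
have hvS : nonneg_annihilated TS ES vS.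
  by move=> m n hn; have [hT hE] := hvac m n hn; split; apply: smod_inj.
have [[f [lf [fv [fT fE]]]] _] := univ S TS ES vS hS hvS.
have [_ uniq] := univ V TV EV vac hM hvac.
move=> v; suff <- : sval_ (f v) = v by exact: svalP_.
apply: (uniq (fun v => sval_ (f v)) id) => //.
- by move=> a x y; rewrite lf svalD svalZ.
- by rewrite fv.
- by move=> m n x; rewrite fT.
- by move=> m n x; rewrite fE.
Qed.

End VacuumModule.

(** * The commutator formula and translation, extracted from the Borcherds identity *)

Section VertexAlgebra.
Variables (V : lmodType C) (vac : V) (YV : V -> int -> V -> V).
Hypothesis HVA : vertex_algebra vac YV.

Let linl := let: conj h _ := HVA in h.
Let linr := let: conj _ (conj h _) := HVA in h.
Let trunc := let: conj _ (conj _ (conj h _)) := HVA in h.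
Let vacl := let: conj _ (conj _ (conj _ (conj h _))) := HVA in h.
Let vacr := let: conj _ (conj _ (conj _ (conj _ (conj h _)))) := HVA in h.
Let vacr1 := let: conj _ (conj _ (conj _ (conj _ (conj _ (conj h _))))) := HVA in h.
Let borch := let: conj _ (conj _ (conj _ (conj _ (conj _ (conj _ h))))) := HVA in h.

Lemma YV_bound u v w (p q r : int) : exists N : nat, forall i : nat, leq N i ->
  YV u (r + i%:Z) v = 0 /\ YV v (q + i%:Z) w = 0 /\ YV u (p + i%:Z) w = 0.
Proof.
have [N1 h1] := trunc u v; have [N2 h2] := trunc v w; have [N3 h3] := trunc u w.
exists (absz (N1 - r)%R + absz (N2 - q)%R + absz (N3 - p)%R)%N => i hi.
by rewrite h1 ?h2 ?h3 //; lia.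
Qed.

Lemma zbinom0S i : zbinom 0 i.+1 = 0.
Proof. by rewrite /zbinom big_ord_recl /= subrr !mul0r. Qed.

Lemma zbinom_0 p : zbinom p 0 = 1.
Proof. by rewrite /zbinom big_ord0 fact0 divr1. Qed.

Lemma zbinom_1 p : zbinom p 1 = p%:~R.
Proof. by rewrite /zbinom big_ord1 subr0 divr1. Qed.

(** The Borcherds identity at $r=0$. The number of terms is free above a bound, so that it can be
    matched with a locality order on $W$. *)
Lemma YV_comm u v w (p q : int) : exists N : nat,
  (forall i, (N <= i)%N -> YV u i v = 0) /\
  forall N', (N <= N')%N ->
  YV u p (YV v q w) - YV v q (YV u p w) =
  \sum_(i < N') zbinom p i *: YV (YV u i v) (p + q - i%:Z) w.
Proof.
have [N hN] := YV_bound u v w p q 0; exists N.+1; split.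
  by move=> i hi; have [] := hN i (ltnW hi); rewrite add0r.
move=> N' hN'; have hN1 i : leq N' i -> _ := fun h => hN i (leq_trans (ltnW hN') h).
have := borch hN1; under eq_bigr do rewrite add0r; move=> ->.
case: N' hN' hN1 => // N' _ _.
rewrite big_ord_recl expr0 mul1r zbinom_0 scale1r big1 => [|i _].
  by rewrite /= !addr0 ?subr0 expr0z scale1r.
by rewrite zbinom0S mulr0 scale0r.
Qed.

(* [u |-> u_(-2) vac] is the translation operator. *)
Lemma YV_transl a u (r : int) :
  YV (YV a r u) (-2) vac = YV a r (YV u (-2) vac) - r%:~R *: YV a (r - 1) u.
Proof.
have [N hN] := YV_bound a u vac 0 (-2) r.
have hN1 i : leq N.+2 i -> _ := fun h => hN i (leq_trans (leqW (leqnSn N)) h).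
have := borch hN1.
rewrite big_ord_recl zbinom_0 scale1r big1 => [|i _]; last by rewrite zbinom0S scale0r.
rewrite addr0 subr0 add0r addr0 => ->.
have va (i : nat) : YV a i vac = 0 by exact: vacr.
rewrite big_ord_recl big_ord_recl big1 => [|i _].
  rewrite /= !(add0r, addr0, subr0) expr0 expr1 zbinom_0 zbinom_1 mul1r scale1r !va.
  rewrite !(islin0 (linr _ _)) !scaler0 !subr0 mulN1r scaleNr.
  by rewrite (_ : -2 + 1%:Z = -1) // vacr1.
have -> : YV u (-2 + (lift ord0 (lift ord0 i))%:Z) vac = 0.
  by apply: vacr; rewrite !lift0; lia.
by rewrite add0r va !(islin0 (linr _ _)) scaler0 subr0 scaler0.
Qed.

(** The Borcherds identity with the vacuum in second place and $r=-2$. Only mode $-1$ of the vacuum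
    acts: at $i=-q-1$ in the first product if $q<0$, at $i=q-1$ in the second if $q>0$, nowhere if
    $q=0$; the coefficient is $i+1$ up to sign. *)
Lemma YV_transl_mode u (q : int) w :
  YV (YV u (-2) vac) q w = - (q%:~R *: YV u (q - 1) w).
Proof.
have [N hN] := YV_bound u vac w 0 q (-2).
pose N' := (N + absz q).+2.
have hN1 i : leq N' i -> _ := fun h => hN i (leq_trans (leq_trans (leq_addr _ _) (leqW (leqnSn _))) h).
have := borch hN1; rewrite {1}/N'.
rewrite big_ord_recl zbinom_0 scale1r big1 => [|i _]; last by rewrite zbinom0S scale0r.
rewrite addr0 subr0 add0r addr0 => ->.
have cf (i : nat) : (-1) ^+ i * zbinom (-2) i = i.+1%:R.
  elim: i => [|i IH]; first by rewrite expr0 mul1r zbinom_0.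
  have e : i.+1%:R * zbinom (-2) i.+1 = ((-2)%:~R - i%:R) * zbinom (-2) i := zbinS C (-2) i.
  have i1 : i.+1%:R != 0 :> C by rewrite pnatr_eq0.
  apply: (mulfI i1); rewrite mulrCA e exprS.
  rewrite (_ : -1 * (-1) ^+ i * _ = ((-1) ^+ i * zbinom (-2) i) * (2 + i%:R)).
    by rewrite IH (_ : 2 + i%:R = i.+2%:R :> C) // -natrD.
  by rewrite (_ : (-2)%:~R = -2 :> C) //; ring.
under eq_bigr => i _ do rewrite cf !vacl.
have -> : (-1) ^ (-2) = 1 :> C.
  by rewrite (_ : (-1) ^ (-2) = ((-1) ^+ 2)^-1 :> C) // sqrrN expr1n invr1.
have [hq|hq] := ltP q 0.
  have hj : (absz (q + 1)%R < N')%N by rewrite /N'; lia.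
  rewrite (bigD1 (Ordinal hj)) //= big1 ?addr0 => [|i hi]; last first.
    rewrite (_ : (q + i%:Z == -1) = false); last first.
      by apply/eqP => e; case/eqP: hi; apply: val_inj => /=; lia.
    rewrite (_ : (q + -2 - i%:Z == -1) = false); last by lia.
    by rewrite (islin0 (linr _ _)) scaler0 subr0 scaler0.
  rewrite (_ : (q + _ == -1) = true); last by lia.
  rewrite (_ : (q + -2 - _ == -1) = false); last by lia.
  rewrite scaler0 subr0 (_ : 0 + -2 - _ = q - 1); last by lia.
  rewrite -scaleNr; congr (_ *: _).
  by rewrite pmulrn -mulrNz; congr (_%:~R); lia.
have [->|q0] := eqVneq q 0.
  rewrite scale0r oppr0 big1 // => i _.
  rewrite (_ : (0 + i%:Z == -1) = false); last by lia.
  rewrite (_ : (0 + -2 - i%:Z == -1) = false); last by lia.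
  by rewrite (islin0 (linr _ _)) scaler0 subr0 scaler0.
have hj : (absz (q - 1)%R < N')%N by rewrite /N'; lia.
rewrite (bigD1 (Ordinal hj)) //= big1 ?addr0 => [|i hi]; last first.
  rewrite (_ : (q + i%:Z == -1) = false); last by lia.
  rewrite (_ : (q + -2 - i%:Z == -1) = false); last first.
    by apply/eqP => e; case/eqP: hi; apply: val_inj => /=; lia.
  by rewrite (islin0 (linr _ _)) scaler0 subr0 scaler0.
rewrite (_ : (q + _ == -1) = false); last by lia.
rewrite (_ : (q + -2 - _ == -1) = true); last by lia.
rewrite (islin0 (linr _ _)) sub0r scale1r scalerN; congr (- _).
rewrite (_ : 0 + (absz (q - 1)%R)%:Z = q - 1); last by lia.
by congr (_ *: _); rewrite pmulrn; congr (_%:~R); lia.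
Qed.

End VertexAlgebra.

(** * The coordinated module *)

Lemma subst_zsum (W : lmodType C) (F : int -> int -> W) (N c : int) (q : nat) :
  (forall a b, (a < N) || (b < N) -> F a b = 0) ->
  subst_coef F N c q = (q`!%:R)^-1 *: zsum (fun p => p%:~R ^+ q *: F p (c - p)).
Proof.
move=> hF; rewrite /subst_coef; congr (_ *: _).
have [h0|h0] := leP 0 (c - 2 * N + 1); last first.
  rewrite big_pred0 => [|i]; last by lia.
  by rewrite zsum0 // => p; rewrite hF ?scaler0 //; lia.
rewrite (@zsumI _ N (absz (c - 2 * N + 1)%R)) => [|p hp]; last first.
  by rewrite hF ?scaler0 //; lia.
rewrite /zint [LHS]big_mkcond; apply: eq_bigr => -[i hi] _ /=.
rewrite (_ : (i%:Z <= _) = true); last by lia.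
by congr (_ *: F _ _); lia.
Qed.

Section CoordinatedModule.
Variables (l1 l2 l3 l4 : C) (W : lmodType C) (tW EW : int -> int -> W -> W).
Hypotheses (HW : Lstar_module l1 l2 l3 l4 tW EW) (Hres : restricted tW EW).

Lemma gen_okT : gen_ok tW.
Proof.
split=> [|m w]; first by case: HW.
by have [N h] := Hres m w; exists N => n /h[].
Qed.

Lemma gen_okE : gen_ok EW.
Proof.
split=> [|m w]; first by case: HW => _ [].
by have [N h] := Hres m w; exists N => n /h[].
Qed.

Notation Tf := (genf gen_okT).
Notation Ef := (genf gen_okE).

Lemma bracketTE : bracket tW EW l1 l2.
Proof. by move=> m n r s w h1 h2; case: HW => _ [_ [_ [h _]]]; exact: h. Qed.

Lemma bracketEE : bracket EW EW l3 l4.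
Proof. by move=> m n r s w h1 h2; case: HW => _ [_ [_ [_ h]]]; exact: h. Qed.

Lemma ord_locTT m r : ord_loc 0 (Tf m) (Tf r).
Proof.
move=> t; apply: fldP => e w; rewrite fadE !genfE f0E.
have l0 x y : tz tW x y 0 = 0 by exact: islin0 (tz_lin x y gen_okT.1).
have [h1|h1] := boolP (nz m (- t)); last by rewrite {1 4}/tz (negPf h1) l0 subrr.
have [h2|h2] := boolP (nz r (- (e - t))); last by rewrite {2 3}/tz (negPf h2) l0 subrr.
by rewrite !(tz_nz _ _ h1, tz_nz _ _ h2); case: HW => _ [_ [h _]]; exact: h.
Qed.

Lemma locTT m r : loc (Tf m) (Tf r). Proof. by exists 0%N; exact: ord_locTT. Qed.
Lemma locTE m r : loc (Tf m) (Ef r).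
Proof. by exists 2%N; exact: ord_loc_gen bracketTE. Qed.
Lemma locEE m r : loc (Ef m) (Ef r).
Proof. by exists 2%N; exact: ord_loc_gen bracketEE. Qed.

(** Locality to the generators is a linear condition on $c$, so it cuts out a subspace; mutual
    locality is recovered afterwards on the image of $V$, in [locY]. *)
Definition gen_loc (c : fld W) := forall m, loc (Tf m) c /\ loc (Ef m) c.

Lemma loc_linr (a c c' : fld W) k : loc a c -> loc a c' -> loc a (k *: c + c').
Proof. by move=> h h'; apply/loc_sym/loc_linl; exact: loc_sym. Qed.

Lemma gen_loc_sub : submod_pred gen_loc.
Proof.
split=> [m|k x y hx hy m]; first by split; exact/loc_sym/loc0.
by have [? ?] := hx m; have [? ?] := hy m; split; exact: loc_linr.
Qed.

Notation FM := (smod gen_loc_sub).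

Lemma gen_loc_T m n c : gen_loc c -> gen_loc (nprod (Tf m) n c).
Proof.
move=> hc r; have [h1 h2] := hc r; have [h3 h4] := hc m.
by split; apply: loc_nprod_r => //; [exact: locTT|exact/loc_sym/locTE].
Qed.

Lemma gen_loc_E m n c : gen_loc c -> gen_loc (nprod (Ef m) n c).
Proof.
move=> hc r; have [h1 h2] := hc r; have [h3 h4] := hc m.
by split; apply: loc_nprod_r => //; [exact: locTE|exact: locEE].
Qed.

Definition TM m n (x : FM) : FM := @SMod _ _ _ gen_loc_sub _ (gen_loc_T m n (svalP_ x)).
Definition EM m n (x : FM) : FM := @SMod _ _ _ gen_loc_sub _ (gen_loc_E m n (svalP_ x)).

Lemma gen_loc_fone : gen_loc (fone W).
Proof. by move=> m; split; exact: loc_fone. Qed.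

Definition vM : FM := @SMod _ _ _ gen_loc_sub _ gen_loc_fone.

Lemma Lhat_FM : Lhat_module l1 l2 l3 l4 TM EM.
Proof.
have hT (x : FM) m : loc (Tf m) (sval_ x) by have [] := svalP_ x m.
have hE (x : FM) m : loc (Ef m) (sval_ x) by have [] := svalP_ x m.
split; first by move=> m n k x y; apply: smod_inj; rewrite svalD svalZ /= -nprod_linr.
split; first by move=> m n k x y; apply: smod_inj; rewrite svalD svalZ /= -nprod_linr.
split.
  move=> m n r s x; apply: smod_inj; rewrite svalB sval0 /=.
  have := nprod_comm n s (ord_locTT m r) (hT x m) (hT x r).
  by rewrite /comm_formula big_ord0.
split=> m n r s x; apply: smod_inj; rewrite svalB svalD !svalZ /=.
  exact: nprod_gen bracketTE _ _ _.
exact: nprod_gen bracketEE _ _ _.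
Qed.

Lemma vM_annihilated : nonneg_annihilated TM EM vM.
Proof.
move=> m n hn; split; apply: smod_inj; rewrite /= nprod_fone_r;
  by case: n hn.
Qed.

Variables (V : lmodType C) (TV EV : int -> int -> V -> V) (vac : V).
Hypothesis HV : vacuum_module l1 l2 l3 l4 TV EV vac.
Variable YV : V -> int -> V -> V.
Hypotheses (HVA : vertex_algebra vac YV)
  (HYT : forall m n v, YV (TV m (-1) vac) n v = TV m n v)
  (HYE : forall m n v, YV (EV m (-1) vac) n v = EV m n v).

Variable f : V -> FM.
Hypotheses (f_lin : islin f) (f_vac : f vac = vM)
  (f_T : forall m n v, f (TV m n v) = TM m n (f v))
  (f_E : forall m n v, f (EV m n v) = EM m n (f v)).

Definition Y (v : V) : fld W := sval_ (f v).

Lemma Y_lin : islin Y.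
Proof. by move=> k x y; rewrite /Y f_lin. Qed.
Lemma Y_vac : Y vac = fone W.
Proof. by rewrite /Y f_vac. Qed.
Lemma Y_T m n v : Y (TV m n v) = nprod (Tf m) n (Y v).
Proof. by rewrite /Y f_T. Qed.
Lemma Y_E m n v : Y (EV m n v) = nprod (Ef m) n (Y v).
Proof. by rewrite /Y f_E. Qed.

Lemma nprod_m1_fone (a : fld W) : nprod a (-1) (fone W) = a.
Proof. by rewrite (nprod_fone_r a (-1)) /= invr1 scale1r. Qed.

Lemma Y_Tgen m : Y (TV m (-1) vac) = Tf m.
Proof. by rewrite Y_T Y_vac nprod_m1_fone. Qed.
Lemma Y_Egen m : Y (EV m (-1) vac) = Ef m.
Proof. by rewrite Y_E Y_vac nprod_m1_fone. Qed.

Lemma locTY m v : loc (Tf m) (Y v). Proof. by have [] := svalP_ (f v) m. Qed.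
Lemma locEY m v : loc (Ef m) (Y v). Proof. by have [] := svalP_ (f v) m. Qed.

(** Induction on $v$ alone suffices: membership in [FM] makes [Y u] local to the generators, and
    Dong's lemma gives the step. *)
Lemma locY u v : loc (Y u) (Y v).
Proof.
apply: (vacuum_ind HV (P := fun v => loc (Y u) (Y v))) => {v}.
- split=> [|k x y hx hy]; first by rewrite (islin0 Y_lin); exact/loc_sym/loc0.
  by rewrite Y_lin; exact: loc_linr.
- by rewrite Y_vac; exact: loc_fone.
- move=> m n v h; rewrite Y_T; apply: loc_nprod_r => //; last exact: locTY.
  exact/loc_sym/locTY.
- move=> m n v h; rewrite Y_E; apply: loc_nprod_r => //; last exact: locEY.
  exact/loc_sym/locEY.
Qed.

Let linl : forall n v, islin (fun u => YV u n v). Proof. by case: HVA. Qed.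
Let linr : forall u n, islin (YV u n). Proof. by case: HVA => _ []. Qed.

Lemma fD0 : fD (0 : fld W) = 0.
Proof. by apply: fldP => n w; rewrite fDerE !f0E scaler0. Qed.

(** On both sides translation is a derivation that sends the mode $a_n$ to $-n\,a_{n-1}$. *)
Lemma Y_transl_gen (a : V) (A : fld W) u n :
  (forall n v, Y (YV a n v) = nprod A n (Y v)) -> loc A (Y u) ->
  Y (YV u (-2) vac) = fD (Y u) -> Y (YV (YV a n u) (-2) vac) = fD (Y (YV a n u)).
Proof.
move=> hA hl hu; rewrite (YV_transl HVA) (islinB Y_lin) (islinZ Y_lin) !hA hu.
by rewrite fD_nprod // nprod_fD // addrC.
Qed.

Lemma Y_gen_T m n v : Y (YV (TV m (-1) vac) n v) = nprod (Tf m) n (Y v).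
Proof. by rewrite HYT Y_T. Qed.
Lemma Y_gen_E m n v : Y (YV (EV m (-1) vac) n v) = nprod (Ef m) n (Y v).
Proof. by rewrite HYE Y_E. Qed.

Lemma Y_transl u : Y (YV u (-2) vac) = fD (Y u).
Proof.
apply: (vacuum_ind HV (P := fun u => Y (YV u (-2) vac) = fD (Y u))) => {u}.
- split=> [|k x y hx hy].
    by rewrite (islin0 (linl _ _)) (islin0 Y_lin) fD0.
  by rewrite (linl (-2) vac) !Y_lin hx hy fD_lin.
- have -> : YV vac (-2) vac = 0 by case: HVA => _ [_ [_ [h _]]]; rewrite h.
  by rewrite Y_vac (islin0 Y_lin) fD_fone.
- move=> m n u hu; rewrite -HYT.
  exact: (Y_transl_gen n (fun n v => Y_gen_T m n v) (locTY m u) hu).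
- move=> m n u hu; rewrite -HYE.
  exact: (Y_transl_gen n (fun n v => Y_gen_E m n v) (locEY m u) hu).
Qed.

(** Negative modes are reached by induction over all $u$ at once: the hypothesis is applied to
    $u_{-2}\mathbf 1$, whose modes are $-n\,u_{n-1}$, and the nonzero factor is cancelled. *)
Lemma Y_prod_vac u n : Y (YV u n vac) = nprod (Y u) n (fone W).
Proof.
case: n => [n|j].
  have -> : YV u n vac = 0 by case: HVA => _ [_ [_ [_ [h _]]]]; rewrite h.
  by rewrite (islin0 Y_lin) nprod_fone_r.
elim: j u => [|j IH] u.
  have -> : YV u (Negz 0) vac = u by case: HVA => _ [_ [_ [_ [_ [h _]]]]]; exact: h.
  by rewrite (nprod_m1_fone (Y u)).
have := IH (YV u (-2) vac); rewrite Y_transl (YV_transl_mode HVA) nprod_fD; last first.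
  exact: loc_fone.
rewrite (islinN Y_lin) (islinZ Y_lin) (_ : Negz j - 1 = Negz j.+1); last by lia.
have j0 : (Negz j)%:~R != 0 :> C by rewrite intr_eq0.
by move=> /oppr_inj h; apply: (scalerI j0).
Qed.

(* Both [Y(a, z)] on [V] and the field products on [W] satisfy the same
   commutator formula, which moves [u_n] past a generator [a_s]. *)
Lemma Y_prod_gen (a : V) (A : fld W) v s :
  (forall n v, Y (YV a n v) = nprod A n (Y v)) -> (forall v, loc A (Y v)) ->
  (forall u n, Y (YV u n v) = nprod (Y u) n (Y v)) ->
  forall u n, Y (YV u n (YV a s v)) = nprod (Y u) n (Y (YV a s v)).
Proof.
move=> hA hl hv u n; have [N [_ hN]] := YV_comm HVA a u v s n.
have [K hK] := hl u; pose K' := maxn N K.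
have e1 := hN K' (leq_maxl N K).
have e2 := nprod_comm s n (ord_locW (leq_maxr N K) hK) (hl v) (locY u v).
have {e1} : Y (YV a s (YV u n v) - YV u n (YV a s v)) =
    nprod A s (nprod (Y u) n (Y v)) - nprod (Y u) n (nprod A s (Y v)).
  rewrite e1 e2; rewrite (islin_sum Y_lin K' (fun i => zbinom s i *: YV (YV a i u) (s + n - i%:Z) v)).
  by apply: eq_bigr => i _; rewrite (islinZ Y_lin) hv hA.
by rewrite (islinB Y_lin) !hA hv => /addrI /oppr_inj.
Qed.

Lemma Y_prod u n v : Y (YV u n v) = nprod (Y u) n (Y v).
Proof.
move: u n; apply: (vacuum_ind HV (P := fun v =>
  forall u n, Y (YV u n v) = nprod (Y u) n (Y v))) => {v}.
- split=> [u n|k x y hx hy u n].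
    by rewrite (islin0 (linr _ _)) (islin0 Y_lin) nprod_0r.
  by rewrite linr !Y_lin hx hy nprod_linr //; exact: locY.
- by move=> u n; rewrite Y_vac; exact: Y_prod_vac.
- move=> m s v h; rewrite -HYT.
  exact: (Y_prod_gen s (fun n v => Y_gen_T m n v) (locTY m) h).
- move=> m s v h; rewrite -HYE.
  exact: (Y_prod_gen s (fun n v => Y_gen_E m n v) (locEY m) h).
Qed.

Notation YW := (fun v n w => Y v n w).

Lemma prod_coefE k u v w a b :
  prod_coef YW k u v w a b = bdiff k (fun i j => Y u i (Y v j w)) a b.
Proof. by []. Qed.

(** Stated for any [Y'] linear in the vector of $V$, because uniqueness applies it to a second
    structure. *)
Lemma assoc_coefE (Y' : V -> int -> W -> W) k u v w (M c q : int) :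
  (forall n, islin (Y' ^~ n ^~ w)) -> (forall n, M <= n -> YV u n v = 0) ->
  assoc_coef YV Y' k u v w M c q =
  zsum (fun n => (lX C (- q - 1) * leps C ^+ k) n *: Y' (YV u n v) (c - k%:Z) w).
Proof.
move=> hY hM; rewrite /assoc_coef -(@window_bdiff _ _ k _ M) // => n hn.
by rewrite hM // (islin0 (hY (c - k%:Z))).
Qed.

Lemma Y_assoc k u v w (N : int) : ord_loc k (Y u) (Y v) ->
  (forall a b, (a < N) || (b < N) -> prod_coef YW k u v w a b = 0) ->
  forall M : int, (forall n, M <= n -> YV u n v = 0) -> forall c q,
  assoc_coef YV YW k u v w M c q =
  if q < 0 then 0 else subst_coef (prod_coef YW k u v w) N c (absz q).
Proof.
move=> hk hN M hM c q; rewrite assoc_coefE //; last first.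
  by move=> n a x y; rewrite Y_lin fDE fZE.
under eq_zsum => n do rewrite Y_prod.
rewrite -fpr_eval; last by exists k.
case: (ltP q 0) => hq; first by rewrite fpr_leps_neg.
rewrite (subst_zsum _ _ hN); case: q hq => // q _.
by rewrite fpr_leps_subst.
Qed.

Lemma Y_phi_coordinated : phi_coordinated_module vac YV YW.
Proof.
split; first by move=> n w k x y; rewrite Y_lin fDE fZE.
split; first by move=> v n k x y; exact: fcL.
split; first by move=> v w; exact: fcT.
split; first by move=> n w; rewrite Y_vac foneE.
move=> u v; have [k hk] := locY u v; exists k => w.
have [Bu hu] := fcT (Y u) w; have [Bv hv] := fcT (Y v) w.
(* The bound in $x_2$ is that of [Y v] on $w$; the bound in $x_1$ is that of [Y u] on $w$, after
   locality has exchanged the factors. *)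
have hN a b : (a < Num.min Bu Bv) || (b < Num.min Bu Bv) -> prod_coef YW k u v w a b = 0.
  rewrite prod_coefE; case: (ltP b Bv) => hb.
    by move=> _; rewrite /bdiff big1 // => p _; rewrite hv ?fc0 ?scaler0 //; case: p => p /=; lia.
  move=> hab; rewrite bdiff_loc // /bdiff big1 // => p _; rewrite hu ?fc0 ?scaler0 //.
  by case: p => p /=; lia.
exists (Num.min Bu Bv); split=> // M hM c q.
exact: Y_assoc.
Qed.

Lemma Y_generating : generating_fields TV EV vac tW EW YW.
Proof. by move=> m n w; rewrite Y_Tgen Y_Egen. Qed.

(** * Associativity determines the structure from the generating fields *)

Section Uniqueness.
Variable Y' : V -> int -> W -> W.
Hypotheses (phi' : phi_coordinated_module vac YV Y')
  (gen' : generating_fields TV EV vac tW EW Y').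

Let lin' : forall n w, islin (fun v => Y' v n w). Proof. by case: phi'. Qed.

(** Both structures have the same product coefficients, and the exponent $k$ supplied by [Y'] is a
    locality order for [Y] by [ord_loc_trunc]. Associativity then equates all pairings with
    $z^{-q-1}(e^z-1)^k$, and [leps_pairing_inj] cancels the kernel. *)
Lemma uniq_gen a v s : (forall n w, Y' a n w = Y a n w) ->
  (forall n w, Y' v n w = Y v n w) ->
  forall d w, Y' (YV a s v) d w = Y (YV a s v) d w.
Proof.
move=> ha hv d w; have [_ [_ [_ [_ /(_ a v) [k hk]]]]] := phi'.
have pE x : prod_coef Y' k a v x = prod_coef YW k a v x.
  apply: funext => p; apply: funext => p'; apply: eq_bigr => i _.
  by rewrite hv ha.
have ok : ord_loc k (Y a) (Y v).
  apply: ord_loc_trunc (locY a v) _ => x; have [N [hN _]] := hk x.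
  by exists N => p p' hp; rewrite -prod_coefE -pE hN ?hp.
have [N [hN hA]] := hk w; rewrite pE in hN hA.
have [M hM] : exists M : int, forall n, M <= n -> YV a n v = 0.
  by case: HVA => _ [_ [h _]]; exact: h.
pose y n := Y' (YV a n v) d w - Y (YV a n v) d w.
have yM n : M <= n -> y n = 0.
  by move=> hn; rewrite /y hM // (islin0 (lin' _ _)) (islin0 Y_lin) f0E subr0.
suff /(_ s)/eqP : forall n, y n = 0 by rewrite subr_eq0 => /eqP.
apply: (leps_pairing_inj (k := k) yM) => q.
(* The degree $d+k$ compensates the factor $x_2^k$ in $(x_2e^z-x_2)^k$. *)
have e := hA M hM (d + k%:Z) q.
rewrite -(Y_assoc ok hN hM) !assoc_coefE // in e; last first.
  by move=> n b x z; rewrite Y_lin fDE fZE.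
rewrite addrK in e.
have z1 : zfin (fun n => (lX C (- q - 1) * leps C ^+ k) n *: Y' (YV a n v) d w).
  by apply: (@zfin_pairing _ _ _ _ M) => n hn; rewrite hM // (islin0 (lin' _ _)).
have z2 : zfin (fun n => (lX C (- q - 1) * leps C ^+ k) n *: Y (YV a n v) d w).
  by apply: (@zfin_pairing _ _ _ _ M) => n hn; rewrite hM // (islin0 Y_lin) f0E.
transitivity (zsum (fun n => (lX C (- q - 1) * leps C ^+ k) n *: Y' (YV a n v) d w) -
   zsum (fun n => (lX C (- q - 1) * leps C ^+ k) n *: Y (YV a n v) d w)).
  rewrite -zsumN // -zsumD //.
    by apply: eq_zsum => n; rewrite scalerBr.
  exact: (zfin_morph (g := -%R) (oppr0 _) z2).
by rewrite e subrr.
Qed.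

Lemma Y_unique v n w : Y' v n w = Y v n w.
Proof.
move: n w; apply: (vacuum_ind HV (P := fun v => forall n w, Y' v n w = Y v n w)) => {v}.
- split=> [n w|k x y hx hy n w].
    by rewrite (islin0 (lin' n w)) (islin0 Y_lin) f0E.
  by rewrite (lin' n w) Y_lin fDE fZE hx hy.
- by move=> n w; rewrite Y_vac foneE; case: phi' => _ [_ [_ [h _]]]; exact: h.
- move=> m s v h d w; rewrite -HYT; apply: uniq_gen => // n x.
  by rewrite Y_Tgen; have [] := gen' m n x.
- move=> m s v h d w; rewrite -HYE; apply: uniq_gen => // n x.
  by rewrite Y_Egen; have [] := gen' m n x.
Qed.

End Uniqueness.
End CoordinatedModule.

Theorem theorem4p5 (l1 l2 l3 l4 : C)
    (W : lmodType C) (tW EW : int -> int -> W -> W)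
    (HW : Lstar_module l1 l2 l3 l4 tW EW) (Hres : restricted tW EW)
    (V : lmodType C) (TV EV : int -> int -> V -> V) (vac : V)
    (HV : vacuum_module l1 l2 l3 l4 TV EV vac)
    (YV : V -> int -> V -> V) (HVA : vertex_algebra vac YV)
    (HYT : forall m n v, YV (TV m (-1) vac) n v = TV m n v)
    (HYE : forall m n v, YV (EV m (-1) vac) n v = EV m n v) :
  exists YW : V -> int -> W -> W,
    phi_coordinated_module vac YV YW /\
    generating_fields TV EV vac tW EW YW /\
    (forall YW' : V -> int -> W -> W,
       phi_coordinated_module vac YV YW' ->
       generating_fields TV EV vac tW EW YW' ->
       forall v n w, YW' v n w = YW v n w).
Proof.
have [_ [_ univ]] := HV.
have [[f [f_lin [f_vac [f_T f_E]]]] _] :=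
  univ _ _ _ _ (Lhat_FM HW Hres) (vM_annihilated HW Hres).
exists (fun v n w => Y f v n w); split.
  exact: (Y_phi_coordinated HV HVA HYT HYE f_lin f_vac f_T f_E).
split; first exact: (Y_generating f_vac f_T f_E).
move=> Y' h1 h2 v n w.
exact: (Y_unique HV HVA HYT HYE f_lin f_vac f_T f_E h1 h2).
Qed.
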